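(* Let $d\ge1$, let $f\colon(0,\infty)\to(0,\infty)$ be nondecreasing, and let $Y_0$ be the value at $x=0$ of the mild solution to the stochastic heat equation with additive Lévy noise of mean $m$ and Lévy measure $\lambda$ (see context). Assume that there exists $\varepsilon>0$ with $\int_{\mathbb{R}}|z|^{1+\varepsilon}\,\lambda(dz)<\infty$, and that $\int_{-1}^1|z\log|z||\,\lambda(dz)<\infty$. (1) Suppose $\int_1^\infty 1/f(t)\,dt=\infty$. If $\lambda((0,\infty))>0$, then $\limsup_{t\to\infty}Y_0(t)/f(t)=\infty$ a.s. If $\lambda((-\infty,0))>0$, then $\liminf_{t\to\infty}Y_0(t)/f(t)=-\infty$ a.s. (2) If $\int_1^\infty 1/f(t)\,dt<\infty$, then $\lim_{t\to\infty}Y_0(t)/f(t)=0$ a.s. (3) If $\lambda((0,\infty))=0$, then $\limsup_{t\to\infty}Y_0(t)/t=m$ a.s. If $\lambda((-\infty,0))=0$, then $\liminf_{t\to\infty}Y_0(t)/t=m$ a.s.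
   Context: The heat kernel on $\mathbb{R}^d$ is $g(t,x)=(4\pi t)^{-d/2}e^{-|x|^2/(4t)}$ for $t>0$, and $g(t,x)=0$ for $t\le 0$. Let $\lambda$ be a Lévy measure on $\mathbb{R}$ (so $\lambda(\{0\})=0$), not identically zero, with $\int_{\mathbb{R}}|z|\,\lambda(dz)<\infty$. Let $\mu$ be a Poisson random measure on $(0,\infty)\times\mathbb{R}^d\times\mathbb{R}$ with intensity $dt\,dx\,\lambda(dz)$ and points $(\tau_i,\eta_i,\zeta_i)_{i\in\mathbb{N}}$. Let $m\in\mathbb{R}$ (the mean of the noise) and $m_0=m-\int_{\mathbb{R}}z\,\lambda(dz)$ (the drift). The Lévy space-time white noise without Gaussian part is $\Lambda(dt,dx)=m_0\,dt\,dx+\int_{\mathbb{R}}z\,\mu(dt,dx,dz)$. The mild solution to $\partial_tY=\Delta Y+\dot\Lambda$ on $(0,\infty)\times\mathbb{R}^d$, $Y(0,\cdot)=0$, is $Y(t,x)=\int_0^t\int_{\mathbb{R}^d}g(t-s,x-y)\,\Lambda(ds,dy)$, so that $Y_0(t)=Y(t,0)=m_0t+\sum_{\tau_i\le t}g(t-\tau_i,\eta_i)\zeta_i$. *)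

(* Defs.v *)
From HB Require Import structures.
From mathcomp Require Import all_boot all_order all_algebra.
From mathcomp Require Import all_classical all_reals all_analysis.
From mathcomp Require Import measurable_realfun.

Set Implicit Arguments.
Unset Strict Implicit.
Unset Printing Implicit Defensive.

Import Order.TTheory GRing.Theory Num.Theory.
Import numFieldNormedType.Exports.

Local Open Scope classical_set_scope.
Local Open Scope ring_scope.

(* R^d is [d.-tuple R] with the product sigma-algebra of the library. *)
Section lebesgue_tuple.
Context {R : realType}.
Local Open Scope ereal_scope.

Definition tcons n (p : R * n.-tuple R) : n.+1.-tuple R := cons_tuple p.1 p.2.

Fixpoint lebesgue_tuple n : set (n.-tuple R) -> \bar R :=
  match n with
  | 0%N => \d_([tuple] : 0.-tuple R)
  | k.+1 => pushforward (@lebesgue_measure R \x @lebesgue_tuple k)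
                        (@tcons k)
  end.

Lemma measurable_tcons n : measurable_fun setT (@tcons n).
Proof. exact: (measurable_cons measurable_fst measurable_snd). Qed.

Lemma measurable_tcons_image n (A : set (R * n.-tuple R)) :
  measurable A -> measurable (@tcons n @` A).
Proof.
move=> mA.
pose g (v : n.+1.-tuple R) : R * n.-tuple R := (thead v, [tuple of behead v]).
have mg : measurable_fun setT g.
  apply/measurable_fun_pairP; split; first exact: measurable_tnth.
  exact: measurable_behead.
rewrite (_ : _ @` _ = g @^-1` A).
  by rewrite -[X in measurable X]setTI; exact: mg.
apply/seteqP; split => [_ [[x v] Axv <-]|v Av].
  rewrite /g /tcons/= theadE (_ : [tuple of _] = v)//.
  exact/val_inj.
by exists (g v) => //; rewrite [RHS]tuple_eta; exact/val_inj.
Qed.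

Section step.
Variables (n : nat) (m : {sigma_finite_measure set (n.-tuple R) -> \bar R}).

Let step := pushforward (@lebesgue_measure R \x m) (@tcons n).

Let step0 : step set0 = 0.
Proof. by rewrite /step /pushforward preimage_set0 measure0. Qed.

Let step_ge0 A : 0 <= step A.
Proof. by rewrite /step /pushforward. Qed.

Let step_sigma_additive : semi_sigma_additive step.
Proof.
move=> F mF tF mUF; rewrite /step /pushforward preimage_bigcup.
apply: measure_semi_sigma_additive.
- by move=> i; rewrite -[X in measurable X]setTI; exact: measurable_tcons.
- apply/trivIsetP => /= i j _ _ ij; rewrite -preimage_setI.
  by move/trivIsetP : tF => /(_ _ _ _ _ ij) ->//; rewrite preimage_set0.
- rewrite -preimage_bigcup -[X in measurable X]setTI.
  exact: measurable_tcons.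
Qed.

HB.instance Definition _ := isMeasure.Build _ _ _ step
  step0 step_ge0 step_sigma_additive.

Let step_sigma_finite : sigma_finite setT step.
Proof.
have /sigma_finiteP[F [FT ndF Foo]] := sigma_finiteT (@lebesgue_measure R).
have /sigma_finiteP[G [GT ndG Goo]] := sigma_finiteT m.
exists (fun k => @tcons n @` (F k `*` G k)).
  apply/esym; rewrite -subTset => v _.
  have : setT (thead v) by [].
  rewrite FT => -[i _ Fi].
  have : setT [tuple of behead v] by [].
  rewrite GT => -[j _ Gj]; exists (maxn i j) => //.
  exists (thead v, [tuple of behead v]).
    split; first by move: Fi; exact/subsetPset/ndF/leq_maxl.
    by move: Gj; exact/subsetPset/ndG/leq_maxr.
  by rewrite [RHS]tuple_eta; exact/val_inj.
move=> k; have [mF Fk] := Foo k; have [mG Gk] := Goo k.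
split; first by apply: measurable_tcons_image; exact: measurableX.
rewrite /step /pushforward (_ : _ @^-1` _ = F k `*` G k).
  by rewrite product_measure1E// lte_mul_pinfty// ge0_fin_numE.
apply/seteqP; split => [[x v] [[y w] Fyw]|[x v] Fxv]; last by exists (x, v).
by move=> /(congr1 val)[/= <- wv]; rewrite (_ : v = w)//; exact/val_inj.
Qed.

HB.instance Definition _ := Measure_isSigmaFinite.Build _ _ _ step
  step_sigma_finite.

Lemma sigma_finite_pushforward_tcons :
  exists m' : {sigma_finite_measure set (n.+1.-tuple R) -> \bar R},
    pushforward (@lebesgue_measure R \x m) (@tcons n) = m'.
Proof. by exists step. Qed.

End step.

Lemma sigma_finite_measure_lebesgue_tuple n :
  exists m : {sigma_finite_measure set (n.-tuple R) -> \bar R},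
    @lebesgue_tuple n = m.
Proof.
elim: n => [|n [m IH]]; first by exists (\d_([tuple] : 0.-tuple R)).
by rewrite /= IH; exact: sigma_finite_pushforward_tcons.
Qed.

Section instances.
Variable n : nat.

Let lebesgue_tuple0 : @lebesgue_tuple n set0 = 0.
Proof. by have [m ->] := sigma_finite_measure_lebesgue_tuple n. Qed.

Let lebesgue_tuple_ge0 A : 0 <= @lebesgue_tuple n A.
Proof. by have [m ->] := sigma_finite_measure_lebesgue_tuple n. Qed.

Let lebesgue_tuple_sigma_additive : semi_sigma_additive (@lebesgue_tuple n).
Proof.
have [m ->] := sigma_finite_measure_lebesgue_tuple n.
exact: measure_semi_sigma_additive.
Qed.

HB.instance Definition _ := isMeasure.Build _ _ _ (@lebesgue_tuple n)
  lebesgue_tuple0 lebesgue_tuple_ge0 lebesgue_tuple_sigma_additive.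

Let lebesgue_tuple_sigma_finite : sigma_finite setT (@lebesgue_tuple n).
Proof.
by have [m ->] := sigma_finite_measure_lebesgue_tuple n; exact: sigma_finiteT.
Qed.

HB.instance Definition _ := Measure_isSigmaFinite.Build _ _ _
  (@lebesgue_tuple n) lebesgue_tuple_sigma_finite.

End instances.
End lebesgue_tuple.

Section noise.
Context {R : realType} (d : nat).
Local Notation space := (d.-tuple R).
Local Notation spacetime := (R * space)%type.
Local Notation points := (spacetime * R)%type.

Definition enorm (x : space) : R := Num.sqrt (\sum_(i < d) tnth x i ^+ 2).

Definition tsub (x y : space) : space := [tuple tnth x i - tnth y i | i < d].

Definition torigin : space := [tuple 0 | i < d].

Definition heat_kernel (t : R) (x : space) : R :=
  if 0 < t then
    (4 * pi * t) `^ (- (d%:R / 2)) * expR (- (enorm x ^+ 2 / (4 * t)))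
  else 0.

Local Open Scope ereal_scope.

Definition levy_measure (lambda : {measure set R -> \bar R}) : Prop :=
  lambda [set 0%R] = 0 /\
  \int[lambda]_z (Num.min 1 (z ^+ 2))%:E < +oo.

Definition spacetime_lebesgue : set spacetime -> \bar R :=
  @lebesgue_measure R \x @lebesgue_tuple R d.

Let spacetime_lebesgue0 : spacetime_lebesgue set0 = 0.
Proof. by rewrite /spacetime_lebesgue measure0. Qed.

Let spacetime_lebesgue_ge0 A : 0 <= spacetime_lebesgue A.
Proof. by rewrite /spacetime_lebesgue. Qed.

Let spacetime_lebesgue_sigma_additive : semi_sigma_additive spacetime_lebesgue.
Proof.
move=> F mF tF mUF; rewrite /spacetime_lebesgue.
exact: measure_semi_sigma_additive.
Qed.

(* Not inherited from [\x]: the library's [lebesgue_measure] is displayed on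
   [measurableTypeR R] rather than on [R]. *)
HB.instance Definition _ := isMeasure.Build _ _ _ spacetime_lebesgue
  spacetime_lebesgue0 spacetime_lebesgue_ge0 spacetime_lebesgue_sigma_additive.

Let spacetime_lebesgue_sigma_finite : sigma_finite setT spacetime_lebesgue.
Proof.
have /sigma_finiteP[F [FT ndF Foo]] := sigma_finiteT (@lebesgue_measure R).
have /sigma_finiteP[G [GT ndG Goo]] := sigma_finiteT (@lebesgue_tuple R d).
exists (fun k => F k `*` G k).
  apply/esym; rewrite -subTset => -[t x] _.
  have : setT t by [].
  rewrite FT => -[i _ Fi].
  have : setT x by [].
  rewrite GT => -[j _ Gj]; exists (maxn i j) => //.
  split; first by move: Fi; exact/subsetPset/ndF/leq_maxl.
  by move: Gj; exact/subsetPset/ndG/leq_maxr.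
move=> k; have [mF Fk] := Foo k; have [mG Gk] := Goo k.
split; first exact: measurableX.
by rewrite /spacetime_lebesgue product_measure1E// lte_mul_pinfty// ge0_fin_numE.
Qed.

HB.instance Definition _ := Measure_isSigmaFinite.Build _ _ _
  spacetime_lebesgue spacetime_lebesgue_sigma_finite.

(* [dt dx lambda(dz)] on [(0, oo) x R^d x R], as a set function on
   [R x R^d x R] carried by [t > 0]. The iterated integral defining [\x] is the
   product measure because a Levy measure is sigma-finite. *)
Definition noise_intensity (lambda : {measure set R -> \bar R}) :
    set points -> \bar R :=
  fun A => (spacetime_lebesgue \x lambda) (A `&` [set p | (0 < p.1.1)%R]).

Context {d0 : measure_display} {Omega : measurableType d0}
  (P : probability Omega R).

(* The second argument of [poisson_prob] is a dummy. *)
Record poisson_random_measure {d1 : measure_display} {E : measurableType d1}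
    (nu : set E -> \bar R) (mu : Omega -> {measure set E -> \bar R}) : Prop := {
  prm_measurable : forall A, measurable A ->
    measurable_fun setT (mu ^~ A) ;
  prm_poisson : forall A, measurable A -> nu A < +oo ->
    forall k : nat, P [set w | mu w A = k%:R%:E] =
      poisson_prob (fine (nu A)) 0%N [set k] ;
  prm_infinite : forall A, measurable A -> nu A = +oo ->
    {ae P, forall w, mu w A = +oo} ;
  prm_independent : forall (n : nat) (A : 'I_n -> set E),
    (forall i, measurable (A i)) -> trivIset setT A ->
    forall B : 'I_n -> set (\bar R), (forall i, measurable (B i)) ->
    P (\bigcap_(i in setT) [set w | B i (mu w (A i))]) =
      \prod_(i < n) P [set w | B i (mu w (A i))] }.

Definition has_points (mu : Omega -> {measure set points -> \bar R})
    (tau : nat -> Omega -> R) (eta : nat -> Omega -> space)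
    (zeta : nat -> Omega -> R) : Prop :=
  [/\ forall i, measurable_fun setT (tau i),
      forall i, measurable_fun setT (eta i),
      forall i, measurable_fun setT (zeta i) &
      {ae P, forall w, forall A, measurable A ->
        mu w A = \sum_(i <oo) \d_((tau i w, eta i w, zeta i w)) A}].

Variables (lambda : {measure set R -> \bar R}) (m : R)
  (mu : Omega -> {measure set points -> \bar R}).

Definition drift : R := (m - \int[lambda]_z z)%R.

(* The integral over D of phi against
   Lambda(dt, dx) = m_0 dt dx + \int_R z mu(dt, dx, dz). *)
Definition noise_integral (D : set spacetime) (phi : spacetime -> R)
    (w : Omega) : \bar R :=
  drift%:E * \int[spacetime_lebesgue]_(p in D) (phi p)%:E +
  \int[mu w]_(q in D `*` setT) (phi q.1 * q.2)%:E.

Definition mild_solution (t : R) (x : space) (w : Omega) : \bar R :=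
  noise_integral (`]0%R, t] `*` setT)
    (fun p => heat_kernel (t - p.1) (tsub x p.2)) w.

End noise.

(* Main.v *)
(** At the origin, [Y_0 t = m_0 t + J^+ t - J^- t], where [J^+] and [J^-] collect
    the positive and the negative jumps, and [E (J^+ t) = t int_(z > 0) z lambda(dz)]
    because the heat kernel has total mass 1.

    (1) Let [H t = max (f t) t]. In the k-th window of time, a jump of size at
    least [e] within distance about [H^(-1/d)] of the origin makes [J^+] exceed a
    large multiple of [H] just after that window. The expected numbers of such
    jumps add up to a multiple of the integral of [1/H], which diverges together
    with that of [1/f], so such a jump occurs a.s. Its first occurrence is
    independent of the negative jumps, and by Markov's inequality [J^-] is at
    most [C t] at that time, with probability close to 1.

    (2) Jumps with [|y|^d f(tau - 2) <= K |z|] have finite expected number, hence do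
    not matter eventually. The contribution of the others at a time in
    [[n, n + 1]] is at most [delta f(n)]. Those born before [n - 1] and those born
    later are dominated by sums that do not depend on the time in [[n, n + 1]]
    (for the latter, the kernel is dominated by its values at dyadic times,
    which is where [|z log |z||] comes from), and Chernoff bounds for Poisson
    integrals give probabilities of order [n^-2] that these exceed [eta f(n)].

    (3) [J^- t >= (int_(z < 0) |z| lambda(dz) - eps) t] eventually, by a Chernoff
    bound for the old truncated jumps. As this lower bound equals the mean of
    [J^- t] up to [eps t], Fatou's lemma shows that [J^-] cannot stay above
    [(int_(z < 0) |z| lambda(dz) + eps) t]. *)

(* The drift and the jumps of the opposite sign are of order t, which is why in (1) a peak must beat
   t as well as f. The kernel obeys parabolic scaling: at age of order r^2 and distance of order r
   it is of order r^(-d). With r^(-d) = K H, a window of length r^2 and a box of side r form a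
   target of volume r^2 / (K H), so the intensities of the targets are a Riemann sum of the integral
   of 1/H. In (2) all t in [n, n + 1] must be controlled at once. No path regularity is invoked:
   each jump is dominated by a function free of t, and only integers n enter the Borel-Cantelli
   argument. The Laplace parameter 8 log n / (eta f(n)) at level eta f(n) / 2 yields a factor
   n^(-4), while the logarithm of the exponential moment is at most 2 log n + C. Capping each
   contribution at delta f(n), with delta = s eta / 16, keeps its exponential below n^(s/2), which
   the moment of order 1 + s absorbs. The sign [sg] of the jumps is a parameter, so that the two
   halves of (1) and of (3) share their proofs. *)
Require Import Defs.
From HB Require Import structures.
From mathcomp Require Import all_boot all_order all_algebra.
From mathcomp Require Import all_classical all_reals all_analysis.
From mathcomp Require Import measurable_realfun.
From mathcomp Require Import ring lra.
Set Implicit Arguments.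
Unset Strict Implicit.
Unset Printing Implicit Defensive.
Import Order.TTheory GRing.Theory Num.Theory.
Import numFieldNormedType.Exports HBNNSimple.
Local Open Scope classical_set_scope.
Local Open Scope ring_scope.
Local Open Scope ereal_scope.

(** * Poisson random measures: moments and Laplace functionals *)

(* No measurability is needed, unlike in [ge0_le_integral]. *)
Lemma ge0_integral_mono {d} {T : measurableType d} {R : realType}
    (m : {measure set T -> \bar R}) (D : set T) (g h : T -> \bar R) :
  (forall x, D x -> 0 <= g x) -> (forall x, D x -> g x <= h x) ->
  \int[m]_(x in D) g x <= \int[m]_(x in D) h x.
Proof.
move=> g0 gh; have h0 x : D x -> 0 <= h x by move=> Dx; exact: le_trans (g0 x Dx) (gh x Dx).
rewrite !ge0_integralE//; apply: le_ereal_sup => _ [k kg <-].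
exists k => // x; apply: le_trans (kg x) _; rewrite !patchE; case: ifPn => //.
by rewrite inE => /gh.
Qed.

Lemma emeasurable_prod {d} {T : measurableType d} {R : realType} (D : set T)
    (I : Type) (s : seq I) (Q : pred I) (h : I -> T -> \bar R) :
  measurable D -> (forall i, measurable_fun D (h i)) ->
  measurable_fun D (fun x => \prod_(i <- s | Q i) h i x).
Proof.
move=> mD mh; elim: s => [|i s IH].
  apply: (eq_measurable_fun (cst 1)); last exact: measurable_cst.
  by move=> x _; rewrite big_nil.
apply: (eq_measurable_fun (fun x => if Q i
    then h i x * \prod_(j <- s | Q j) h j x else \prod_(j <- s | Q j) h j x)).
  by move=> x _; rewrite big_cons.
by case: (Q i) => //; exact: emeasurable_funM.
Qed.

Lemma nneseriesZle {R : realType} (c : \bar R) (u : nat -> \bar R) :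
  0 <= c -> (forall k, 0 <= u k) ->
  \sum_(k <oo) c * u k = c * \sum_(k <oo) u k.
Proof.
move=> c0 u0; rewrite -!ge0_integral_count//; last by move=> k; exact: mule_ge0.
by rewrite ge0_integralZl.
Qed.

Lemma measurable_expeR {R : realType} : measurable_fun setT (@expeR R).
Proof.
rewrite (_ : expeR = fun x : \bar R => if x == +oo then +oo else
    if x == -oo then 0 else (expR (fine x))%:E); last first.
  by apply/funext => -[].
have meq (y : \bar R) : measurable_fun setT (fun x : \bar R => x == y).
  by apply: measurable_fun_eqe => //; exact: measurable_id.
apply: measurable_fun_ifT => //; apply: measurable_fun_ifT => //.
by apply/measurable_EFinP; apply: measurableT_comp.
Qed.

Section countably_valued.
Context {d} {T : measurableType d} {R : realType} (P : {measure set T -> \bar R}).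
Variables (c : nat -> \bar R) (X : T -> \bar R).
Hypotheses (cinj : injective c) (mX : measurable_fun setT X).
Hypothesis Xc : {ae P, forall w, exists j, X w = c j}.

(** Splitting along the values of X makes [h (X w)] a series of indicators. Independence known for
    events thus passes to functions of a count without any approximation of h. *)
Lemma integral_countably_valued (F : T -> \bar R) (h : \bar R -> \bar R) :
  measurable_fun setT F -> (forall w, 0 <= F w) ->
  measurable_fun setT h -> (forall x, 0 <= h x) ->
  \int[P]_w (F w * h (X w)) =
  \sum_(j <oo) h (c j) * \int[P]_w (F w * (\1_[set c j] (X w))%:E).
Proof.
move=> mF F0 mh h0.
have mI j : measurable_fun setT (fun w => (\1_[set c j] (X w))%:E : \bar R).
  apply/measurable_EFinP; apply: measurableT_comp => //.
have I0 j w : 0 <= F w * (\1_[set c j] (X w))%:E.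
  by rewrite mule_ge0// lee_fin indicE.
transitivity
  (\int[P]_w \sum_(j <oo) h (c j) * (F w * (\1_[set c j] (X w))%:E)).
  apply: ge0_ae_eq_integral => //.
  - apply: emeasurable_funM => //; exact: measurableT_comp.
  - apply: ge0_emeasurable_sum => [k w _ _|k _]; first by rewrite mule_ge0.
    by apply: measurable_funeM; exact: emeasurable_funM.
  - by move=> w _; rewrite mule_ge0.
  - by move=> w _; apply: nneseries_ge0 => n _ _; rewrite mule_ge0.
  - apply: filterS Xc => w [j Xj] _; rewrite (nneseriesD1 (n := j))//; last first.
      by move=> k _; rewrite mule_ge0.
    rewrite eseries0 ?adde0; last first.
      move=> i _ /andP[_ ij]; rewrite indicE Xj memNset/= ?mule0//.
      by move=> /cinj ji; rewrite ji eqxx in ij.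
    by rewrite indicE Xj mem_set// mule1 muleC.
rewrite integral_nneseries//; last 2 first.
- by move=> k; apply: measurable_funeM; exact: emeasurable_funM.
- by move=> k w _; rewrite mule_ge0.
apply: eq_eseriesr => j _; rewrite ge0_integralZl//.
exact: emeasurable_funM.
Qed.

End countably_valued.

(* The values of a point measure on a set: [+oo], then the integers. *)
Definition count_value {R : realType} (j : nat) : \bar R :=
  if j is k.+1 then k%:R%:E else +oo.

Lemma count_value_inj {R : realType} : injective (@count_value R).
Proof.
by move=> [|i] [|j] //=; case=> /eqP; rewrite eqr_nat => /eqP ->.
Qed.

Section poisson_random_measure_theory.
Context {R : realType} {d0 : measure_display} {Omega : measurableType d0}
  {P : probability Omega R} {d1 : measure_display} {E : measurableType d1}
  {nu : {measure set E -> \bar R}} {mu : Omega -> {measure set E -> \bar R}}.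
Hypothesis prm : poisson_random_measure P nu mu.

Lemma poisson_prob1 (r : R) k : (0 < r)%R ->
  poisson_prob r 0 [set k] = (r ^+ k / k`!%:R * expR (- r))%:E.
Proof.
move=> r0; rewrite /poisson_prob r0 esum_set1 ?lee_fin ?poisson_pmf_ge0//.
by rewrite /poisson_pmf r0.
Qed.

Lemma nneseries_poisson_prob (r : R) :
  \sum_(k <oo) poisson_prob r 0%N [set k] = 1.
Proof.
have := @measure_bigcup _ _ _ (poisson_prob r 0%N) setT (fun k => [set k]).
rewrite (eq_eseriesl (Q := xpredT)); last by move=> k; rewrite in_setT.
move=> <-//; last first.
  by apply/trivIsetP => i j _ _ ij; apply/seteqP; split=> // k /= [-> /eqP];
    rewrite (negPf ij).
rewrite -[RHS](@probability_setT _ _ _ (poisson_prob r 0%N)).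
by congr (poisson_prob _ _ _); apply/seteqP; split => // k _; exists k.
Qed.

(** The events [mu w A = k] are disjoint, and their probabilities are the weights of a Poisson law,
    which add up to 1. *)
Lemma prm_ae_finite A : measurable A -> nu A < +oo ->
  {ae P, forall w, exists k : nat, mu w A = k%:R%:E}.
Proof.
move=> mA nuA; have mX := prm_measurable prm mA.
have mk k : measurable [set w | mu w A = k%:R%:E].
  rewrite (_ : [set _ | _] = (mu ^~ A) @^-1` [set k%:R%:E]) //.
  by rewrite -[X in measurable X]setTI; exact: mX.
have PU : P (\bigcup_k [set w | mu w A = k%:R%:E]) = 1.
  rewrite measure_bigcup//; last first.
    apply/trivIsetP => i j _ _ ij; apply/seteqP; split => // w /= [-> []].
    by move=> /eqP; rewrite eqr_nat; exact/negP.
  rewrite -[RHS](nneseries_poisson_prob (fine (nu A))).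
  rewrite (eq_eseriesl (Q := xpredT)); last by move=> k; rewrite in_setT.
  by apply: eq_eseriesr => k _; exact: (prm_poisson prm).
exists (~` \bigcup_k [set w | mu w A = k%:R%:E]); split.
- by apply: measurableC; exact: bigcup_measurable.
- rewrite probability_setC; last exact: bigcup_measurable.
  by rewrite PU subee.
- by apply: subsetC => w [k _ /= wk]; exists k.
Qed.

Lemma prm_ae_count_value A : measurable A ->
  {ae P, forall w, exists j, mu w A = count_value j}.
Proof.
move=> mA; have [nuA|nuA] := ltP (nu A) +oo.
  by have := prm_ae_finite mA nuA; apply: filterS => w [k ->]; exists k.+1.
have /eqP : nu A = +oo by apply/eqP; rewrite eq_le nuA leey.
by move=> /eqP /(prm_infinite prm mA); apply: filterS => w ->; exists 0%N.
Qed.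

(** Independence is given for events only. The induction on j allows the factors of index below j to
    be arbitrary while the others are still indicators; one more factor is freed by summing over the
    values of its count. *)
Lemma prm_integral_prod n (A : 'I_n -> set E) (h : 'I_n -> \bar R -> \bar R) :
  (forall i, measurable (A i)) -> trivIset setT A ->
  (forall i, measurable_fun setT (h i)) -> (forall i x, 0 <= h i x) ->
  \int[P]_w (\prod_(i < n) h i (mu w (A i))) =
  \prod_(i < n) \int[P]_w h i (mu w (A i)).
Proof.
move=> mA tA mh h0.
have mX i := prm_measurable prm (mA i).
suff : forall (j : nat) (h : 'I_n -> \bar R -> \bar R),
    (forall i, measurable_fun setT (h i)) -> (forall i x, 0 <= h i x) ->
    (forall i : 'I_n, (j <= i)%N ->
      exists2 B, measurable B & h i = fun x => (\1_B x)%:E) ->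
  \int[P]_w (\prod_(i < n) h i (mu w (A i))) =
  \prod_(i < n) \int[P]_w h i (mu w (A i)).
  by move=> /(_ n h); apply => // i; rewrite leqNgt ltn_ord.
elim => [|j IH] {mh h0}h mh h0 hB.
  have {}hB i : exists B, measurable B /\ h i = fun x => (\1_B x)%:E.
    by have [B] := hB i (leq0n _); exists B.
  have [B /all_and2[mB hE]] := choice hB.
  have mBX i : measurable [set w | B i (mu w (A i))].
    by rewrite -[X in measurable X]setTI; exact: mX.
  have prod_indic w : \prod_(i < n) h i (mu w (A i)) =
      (\1_(\bigcap_(i in setT) [set w | B i (mu w (A i))]) w)%:E.
    rewrite indicE; have [|] := boolP (w \in _).
      by rewrite inE => /= Bw; apply: big1 => i _; rewrite hE indicE mem_set//; exact: Bw.
    rewrite notin_setE /= => /existsNP[i /not_implyP[_ nBi]].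
    by rewrite (bigD1 i)//= hE indicE memNset// mul0e.
  under eq_integral do rewrite prod_indic.
  rewrite integral_indic//; last by apply: fin_bigcap_measurable.
  rewrite setIT [LHS](prm_independent prm mA tA mB); apply: eq_bigr => i _.
  rewrite hE -[in LHS](setIT [set w | _]) -integral_indic//.
have [nj|jn] := leqP n j.
  by apply: IH => // i ji; exfalso; have := ltn_ord i; rewrite ltnNge (leq_trans nj ji).
pose i0 := Ordinal jn.
pose H c i := if i == i0 then fun x : \bar R => (\1_[set c] x)%:E else h i.
pose F w := \prod_(i < n | i != i0) h i (mu w (A i)).
have mF : measurable_fun setT F.
  by apply: emeasurable_prod => // i; exact: measurableT_comp.
have F0 w : 0 <= F w by apply: prode_ge0.
have E0 : 0 <= \prod_(i < n | i != i0) \int[P]_w h i (mu w (A i)).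
  by apply: prode_ge0 => i _; apply: integral_ge0.
(* Fixing the value c of the count of index j turns that factor into an indicator, so the induction
   hypothesis applies. *)
have IHc c : \int[P]_w (F w * (\1_[set c] (mu w (A i0)))%:E) =
    (\prod_(i < n | i != i0) \int[P]_w h i (mu w (A i))) *
    \int[P]_w (\1_[set c] (mu w (A i0)))%:E.
  transitivity (\prod_(i < n) \int[P]_w H c i (mu w (A i))); last first.
    rewrite (bigD1 i0)//= muleC /H eqxx; congr (_ * _).
    by apply: eq_bigr => i /negPf ->.
  rewrite -IH => [|i|i x|i ji].
  - apply: eq_integral => w _; rewrite (bigD1 i0)//= muleC /H eqxx; congr (_ * _).
    by apply: eq_bigr => i /negPf ->.
  - rewrite /H; case: ifPn => // _; apply/measurable_EFinP => //.
  - by rewrite /H; case: ifPn => // _; rewrite lee_fin indicE.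
  - rewrite /H; case: ifPn => [_|ii0]; first by exists [set c].
    apply: hB; rewrite ltn_neqAle ji andbT; apply: contra ii0 => /eqP ij.
    by apply/eqP/val_inj.
have disc F' : measurable_fun setT F' -> (forall w, 0 <= F' w) ->
    \int[P]_w (F' w * h i0 (mu w (A i0))) =
    \sum_(k <oo) h i0 (count_value k) *
      \int[P]_w (F' w * (\1_[set count_value k] (mu w (A i0)))%:E).
  move=> mF' F'0; apply: integral_countably_valued => //.
  - exact: count_value_inj.
  - exact: prm_ae_count_value.
rewrite [RHS](bigD1 i0)//= muleC.
under eq_integral do rewrite (bigD1 i0)//= muleC.
rewrite disc//.
under eq_eseriesr do rewrite IHc muleCA.
rewrite nneseriesZle//; last by move=> k; rewrite mule_ge0// integral_ge0.
congr (_ * _); under [in RHS]eq_integral do rewrite -[h i0 _]mul1e.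
rewrite (disc (cst 1))//; apply: eq_eseriesr => k _.
by under [in RHS]eq_integral do rewrite mul1e.
Qed.

Lemma prm_expectation A (h : \bar R -> \bar R) : measurable A ->
  nu A < +oo -> measurable_fun setT h -> (forall x, 0 <= h x) ->
  \int[P]_w h (mu w A) =
  \sum_(k <oo) h k%:R%:E * poisson_prob (fine (nu A)) 0%N [set k].
Proof.
move=> mA nuA mh h0; have mX := prm_measurable prm mA.
under eq_integral do rewrite -[h _]mul1e.
rewrite (@integral_countably_valued _ _ _ _ (fun k => k%:R%:E) _ _ mX _ (cst 1))//.
- apply: eq_eseriesr => k _; congr (_ * _).
  rewrite -(prm_poisson prm)//.
  under eq_integral do rewrite mul1e.
  rewrite (_ : (fun w => _) = fun w => (\1_[set w | mu w A = k%:R%:E] w)%:E)//.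
  rewrite integral_indic// ?setIT//.
  rewrite (_ : [set w | _] = (mu ^~ A) @^-1` [set k%:R%:E]) //.
  by rewrite -[X in measurable X]setTI; exact: mX.
- by move=> i j [] /eqP; rewrite eqr_nat => /eqP.
- exact: prm_ae_finite.
Qed.

Lemma prm_mean A : measurable A -> \int[P]_w mu w A = nu A.
Proof.
move=> mA; have [nuA|nuA] := ltP (nu A) +oo; last first.
  have {nuA}nuA : nu A = +oo by apply/eqP; rewrite eq_le nuA leey.
  rewrite nuA -[RHS]mule1 -(@probability_setT _ _ _ P) -integral_cst//.
  apply: ge0_ae_eq_integral => //; first exact: (prm_measurable prm mA).
    by move=> x _ /=; exact: leey.
  by have muoo := prm_infinite prm mA nuA; apply: filterS muoo => w ->.
have -> : \int[P]_w mu w A = \int[P]_w (fun x => `|x|) (mu w A).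
  by apply: eq_integral => w _; rewrite gee0_abs.
rewrite prm_expectation//.
have nuAfin : nu A \is a fin_num by rewrite ge0_fin_numE.
rewrite -[in RHS](fineK nuAfin).
have : (0 <= fine (nu A))%R by rewrite fine_ge0.
set r := fine (nu A); rewrite le_eqVlt => /predU1P[<-|r0].
  (* At rate 0 [poisson_prob] takes its default branch, the Dirac mass at 0, which is indeed the law
     of an empty count. *)
  apply: eseries0 => k _ _; rewrite /poisson_prob ltxx diracE.
  have [->|k0] := eqVneq k 0%N; first by rewrite mulr0n abse0 mul0e.
  by rewrite memNset ?mule0//= => k0'; rewrite -k0' eqxx in k0.
rewrite nneseries_recl//; last by move=> k _; rewrite mule_ge0.
rewrite mulr0n abse0 mul0e add0e -(nneseries_addn 1); last first.
  by move=> k; rewrite mule_ge0.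
rewrite -[RHS]mule1 -(nneseries_poisson_prob r) -nneseriesZle//; last first.
  by rewrite lee_fin ltW.
apply: eq_eseriesr => k _; rewrite !poisson_prob1// abse_EFin ger0_norm//.
rewrite -!EFinM addn1 factS natrM exprS; congr EFin.
have kf : (k`!%:R != 0 :> R)%R by rewrite pnatr_eq0 -lt0n fact_gt0.
have k1 : (k.+1%:R != 0 :> R)%R by rewrite pnatr_eq0.
by field; rewrite kf ?nat1r ?natr1 k1.
Qed.

(** Tilting by exp(a k) turns the weights of rate r into a multiple of those of rate [r * expR a],
    whose sum is 1. For infinite intensity the count is infinite a.s., and the three signs of a are
    checked in the extended reals. *)
Lemma prm_mgf (a : R) A : measurable A ->
  \int[P]_w expeR (a%:E * mu w A) = expeR ((expR a - 1)%:E * nu A).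
Proof.
move=> mA; have mX := prm_measurable prm mA.
have mexp : measurable_fun setT (fun x => expeR (a%:E * x)).
  by apply: measurableT_comp; [exact: measurable_expeR|exact: measurable_funeM].
have [nuA|nuA] := ltP (nu A) +oo; last first.
  have {nuA}nuA : nu A = +oo by apply/eqP; rewrite eq_le nuA leey.
  transitivity (\int[P]_w cst (expeR (a%:E * +oo)) w).
    apply: ge0_ae_eq_integral => //.
    - by apply: (measurableT_comp mexp).
    - by move=> ? _; exact: expeR_ge0.
    - by move=> ? _; exact: expeR_ge0.
    - by have muoo := prm_infinite prm mA nuA; apply: filterS muoo => w ->.
  rewrite integral_cst// (_ : _ [set: Omega] = 1); last exact: (@probability_setT _ _ _ P).
  rewrite mule1 nuA.
  have [a0|a0|<-] := ltgtP 0%R a.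
  - by rewrite !gt0_muley// ?lte_fin// subr_gt0 expR_gt1.
  - by rewrite !lt0_muley// ?lte_fin// subr_lt0 expR_lt1.
  - by rewrite expR0 subrr.
rewrite (prm_expectation mA nuA mexp); last by move=> x; exact: expeR_ge0.
have nuAfin : nu A \is a fin_num by rewrite ge0_fin_numE.
rewrite -[in RHS](fineK nuAfin).
have : (0 <= fine (nu A))%R by rewrite fine_ge0.
set r := fine (nu A); rewrite le_eqVlt => /predU1P[<-|r0].
  rewrite (nneseriesD1 (n := 0%N))//; last by move=> k _; rewrite mule_ge0// expeR_ge0.
  rewrite eseries0; last first.
    move=> k _ /= k0; rewrite /poisson_prob ltxx diracE.
    by rewrite memNset ?mule0//= => k0'; rewrite -k0' eqxx in k0.
  by rewrite !mule0 /poisson_prob ltxx diracE mem_set// adde0 mule1.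
have s0 : (0 < r * expR a)%R by rewrite mulr_gt0 ?expR_gt0.
rewrite -[RHS]mule1 -(nneseries_poisson_prob (r * expR a)) -nneseriesZle//; last first.
  exact: expeR_ge0.
apply: eq_eseriesr => k _; rewrite !poisson_prob1//=.
rewrite -!EFinM; congr EFin.
rewrite exprMn -expRM_natl mulrBl mul1r expRD [(expR a * r)%R]mulrC !expRN.
rewrite [(k%:R * a)%R]mulrC.
have kf : (k`!%:R != 0 :> R)%R by rewrite pnatr_eq0 -lt0n fact_gt0.
have e0 := expR_gt0 r; have e1 := expR_gt0 (expR a * r).
by field; rewrite kf !gt_eqF ?expR_gt0.
Qed.

End poisson_random_measure_theory.

(** * Integrals of functions against a Poisson random measure *)

Lemma cvg_integral_nnsfun_approx {d} {T : measurableType d} {R : realType}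
    (m : {measure set T -> \bar R}) (phi : T -> \bar R)
    (mphi : measurable_fun setT phi) : (forall x, 0 <= phi x) ->
  \int[m]_x (nnsfun_approx measurableT mphi n x)%:E @[n --> \oo] -->
  \int[m]_x phi x.
Proof.
move=> phi0; have -> : \int[m]_x phi x =
    \int[m]_x limn (fun n => (nnsfun_approx measurableT mphi n x)%:E).
  by apply: eq_integral => x _; apply/esym/cvg_lim => //;
    exact: cvg_nnsfun_approx.
apply: cvg_monotone_convergence => //.
- by move=> n; exact/measurable_EFinP.
- by move=> n x _; rewrite lee_fin.
- by move=> x _ i j ij; rewrite lee_fin; exact/lefP/nd_nnsfun_approx.
Qed.

Lemma cvg_expeR {R : realType} (u : (\bar R)^nat) (l : \bar R) : l != -oo ->
  u n @[n --> \oo] --> l -> expeR (u n) @[n --> \oo] --> expeR l.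
Proof.
case: l => [r| |]// _.
  move=> /fine_cvgP[ufin ur]; apply/fine_cvgP; split => /=.
    by apply: filterS ufin => n un; rewrite -(fineK un).
  have : expR ((fine \o u) n) @[n --> \oo] --> expR r.
    by apply: (cvg_comp _ _ ur); exact: continuous_expR.
  apply: cvg_trans; apply: near_eq_cvg.
  by apply: filterS ufin => n un /=; rewrite -[in RHS](fineK un).
move=> /cvgeyPge uy; apply/cvgeyPge => A; near=> n.
have : A%:E <= u n by near: n; exact: uy.
move=> /le_trans; apply; rewrite (le_trans _ (expeR_ge1Dx _))//.
by rewrite leeDr.
Unshelve. all: by end_near. Qed.

Lemma nnsfun_sum_integral {d} {T : measurableType d} {R : realType}
    (m : {measure set T -> \bar R}) (f : {nnsfun T >-> R}) (g : R -> R) :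
  measurable_fun setT g -> (forall x, (0 <= x)%R -> (0 <= g x)%R) ->
  \sum_(x \in range f) (g x)%:E * m (f @^-1` [set x]) = \int[m]_t (g (f t))%:E.
Proof.
move=> mg g0.
(* The absolute value makes the terms nonnegative for every x; on the range of f it changes
   nothing. *)
transitivity (\int[m]_t \sum_(x \in range f)
    ((`|g x|)%:E * (\1_(f @^-1` [set x]) t)%:E)).
  rewrite ge0_integral_fsum//.
  - apply: eq_fsbigr => x; rewrite inE => -[t _ ftx].
    rewrite ge0_integralZl_EFin//; last by apply/measurable_EFinP.
    by rewrite integral_indic// setIT ger0_norm// g0// -ftx.
  - move=> x; apply: measurable_funeM; exact/measurable_EFinP.
apply: eq_integral => t _.
rewrite (fsbigD1 (f t))//=; last by exists t.
rewrite fsbig1 ?adde0; last first.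
  by move=> x [_ /= xft]; rewrite indicE memNset ?mule0//= => /esym.
by rewrite indicE mem_set// mule1 ger0_norm// g0.
Qed.

Section laplace_functional.
Context {R : realType} {d0 : measure_display} {Omega : measurableType d0}
  {P : probability Omega R} {d1 : measure_display} {E : measurableType d1}
  {nu : {measure set E -> \bar R}} {mu : Omega -> {measure set E -> \bar R}}.
Hypothesis prm : poisson_random_measure P nu mu.

Lemma measurable_prm_integral (D : set E) (phi : E -> \bar R) :
  measurable D -> measurable_fun setT phi ->
  (forall x, 0 <= phi x) -> measurable_fun setT (fun w => \int[mu w]_(x in D) phi x).
Proof.
move=> mD mphi phi0; under eq_fun do rewrite integral_mkcond.
apply: measurable_fun_integral_kernel => //.
- by move=> U mU; exact: (prm_measurable prm).
- by move=> x; rewrite patchE; case: ifP.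
- by apply/(measurable_restrictT _ mD); exact: measurable_funTS.
Qed.

(* The event on the left is independent of [mu] on sets disjoint from all the
   [A i]. *)
Lemma prm_mean_indep n (A : 'I_n -> set E) (B : 'I_n -> set (\bar R)) (S : set E) :
  (forall i, measurable (A i)) -> trivIset setT A ->
  (forall i, measurable (B i)) -> measurable S ->
  (forall i, A i `&` S = set0) ->
  \int[P]_(w in \bigcap_(i in setT) [set w | B i (mu w (A i))]) mu w S =
  P (\bigcap_(i in setT) [set w | B i (mu w (A i))]) * nu S.
Proof.
move=> mA tA mB mS AS.
(* The set S is put in front of the [A i]; its factor is [abse], which is nonnegative on all
   extended reals and the identity on counts. *)
pose A' i := oapp A S (unlift ord0 i).
pose h' (i : 'I_n.+1) := oapp (fun i x => (\1_(B i) x)%:E) (@abse R)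
  (unlift ord0 i).
have mBX i : measurable [set w | B i (mu w (A i))].
  by rewrite -[X in measurable X]setTI; apply: (prm_measurable prm (mA i)).
have := @prm_integral_prod _ _ _ _ _ _ _ _ prm _ A' h'.
have prodI w : \prod_(i < n) (\1_(B i) (mu w (A i)))%:E =
    (\1_(\bigcap_(i in setT) [set w | B i (mu w (A i))]) w)%:E :> \bar R.
  rewrite indicE; have [|] := boolP (w \in _).
    by rewrite inE => /= Bw; apply: big1 => i _; rewrite indicE mem_set//; exact: Bw.
  rewrite notin_setE /= => /existsNP[i /not_implyP[_ nBi]].
  by rewrite (bigD1 i)//= indicE memNset// mul0e.
have -> : \int[P]_w \prod_(i < n.+1) h' i (mu w (A' i)) =
    \int[P]_(w in \bigcap_(i in setT) [set w | B i (mu w (A i))]) mu w S.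
  rewrite [RHS]integral_mkcond; apply: eq_integral => w _.
  rewrite big_ord_recl /h' /A' unlift_none/= gee0_abs//.
  under eq_bigr do rewrite liftK/=.
  rewrite prodI patchE indicE; case: ifP => _; first by rewrite mule1.
  by rewrite mule0.
move=> ->.
- rewrite big_ord_recl /h' /A' unlift_none/= muleC; congr (_ * _).
    under eq_bigr do rewrite liftK/=.
    rewrite [RHS](prm_independent prm mA tA mB); apply: eq_bigr => i _.
    by rewrite -[in RHS](setIT [set w | _]) -integral_indic.
  rewrite -(prm_mean prm mS); apply: eq_integral => w _; exact: gee0_abs.
- by move=> i; rewrite /A'; case: unliftP => //= j _; exact: mA.
- apply/trivIsetP => i j _ _; rewrite /A'.
  case: unliftP => [i' ->|->]; case: unliftP => [j' ->|->]//=.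
  + rewrite (inj_eq lift_inj); move/trivIsetP: tA; exact.
  + by move=> _; rewrite setIC.
- move=> i; rewrite /h'; case: unliftP => /= [i' _|_]; last exact: abse_measurable.
  by apply/measurable_EFinP; exact: measurable_indic.
- by move=> i x; rewrite /h'; case: unliftP => //= *; rewrite lee_fin indicE.
Qed.

(** Campbell's formula localized to an event G that does not bias the mean of the measure on subsets
    of S. It extends from indicators through simple functions by monotone convergence, once phi is
    set to 0 off S. *)
Lemma campbell (G : set Omega) (S : set E) (phi : E -> \bar R) :
  measurable G -> measurable S ->
  (forall B, measurable B -> B `<=` S ->
    \int[P]_(w in G) mu w B = P G * nu B) ->
  measurable_fun setT phi -> (forall x, 0 <= phi x) ->
  \int[P]_(w in G) \int[mu w]_(x in S) phi x = P G * \int[nu]_(x in S) phi x.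
Proof.
move=> mG mS H mphi phi0.
transitivity (\int[P]_(w in G) \int[mu w]_x (phi \_ S) x).
  by apply: eq_integral => w _; rewrite integral_mkcond.
rewrite [in RHS]integral_mkcond.
have {mphi} : measurable_fun setT (phi \_ S).
  by apply/(measurable_restrictT _ mS); exact: measurable_funTS.
have : forall x, ~ S x -> (phi \_ S) x = 0.
  by move=> x Sx; rewrite patchE memNset.
have {phi0} : forall x, 0 <= (phi \_ S) x by move=> x; rewrite patchE; case: ifP.
move: (phi \_ S) => {}phi phi0 phiS mphi.
pose f := nnsfun_approx measurableT mphi.
have fphi n x : (f n x)%:E <= phi x.
  by rewrite /f nnsfun_approxE; exact: le_approx.
have cvgf (m : {measure set E -> \bar R}) := cvg_integral_nnsfun_approx (m := m) mphi phi0.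
have ndf (m : {measure set E -> \bar R}) :
    nondecreasing_seq (fun n => \int[m]_x (f n x)%:E).
  move=> i j ij; apply: ge0_le_integral => //.
  - by move=> x _; rewrite lee_fin.
  - exact/measurable_EFinP.
  - exact/measurable_EFinP.
  - by move=> x _; rewrite lee_fin; exact/lefP/nd_nnsfun_approx.
have simple n : \int[P]_(w in G) \int[mu w]_x (f n x)%:E =
    P G * \int[nu]_x (f n x)%:E.
  rewrite integralT_nnsfun sintegralE.
  transitivity (\int[P]_(w in G)
      \sum_(x \in range (f n)) x%:E * mu w (f n @^-1` [set x])).
    by apply: eq_integral => w _; rewrite integralT_nnsfun sintegralE.
  rewrite ge0_integral_fsum//; last 2 first.
  - move=> x; apply: measurable_funTS; apply: measurable_funeM.
    exact: (prm_measurable prm).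
  - by move=> x w _; exact: nnsfun_mulemu_ge0.
  rewrite ge0_mule_fsumr; last by move=> x; exact: nnsfun_mulemu_ge0.
  apply: eq_fsbigr => x; rewrite inE => -[t _ ftx].
  have x0 : (0 <= x)%R by rewrite -ftx.
  have mfx : measurable (f n @^-1` [set x]) by exact: measurable_sfunP.
  (* The level set of 0 may leave S, where the hypothesis says nothing, but its coefficient
     vanishes; the other level sets lie in S. *)
  have [->|xn0] := eqVneq x 0%R.
    by under eq_integral do rewrite mul0e; rewrite integral0 mul0e mule0.
  rewrite ge0_integralZl//; last first.
    by apply: measurable_funTS; exact: (prm_measurable prm).
  rewrite H//; first by rewrite muleCA.
  move=> y /= fyx; apply: contrapT => /phiS phiy.
  have := fphi n y; rewrite phiy lee_fin fyx leNgt lt_neqAle eq_sym xn0.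
  by rewrite x0.
have mf n : measurable_fun setT (fun w => \int[mu w]_x (f n x)%:E).
  apply: measurable_prm_integral => //; first exact/measurable_EFinP.
  by move=> x; rewrite lee_fin.
have c1 : \int[P]_(w in G) \int[mu w]_x (f n x)%:E @[n --> \oo] -->
    \int[P]_(w in G) \int[mu w]_x phi x.
  have -> : \int[P]_(w in G) \int[mu w]_x phi x =
     \int[P]_(w in G) limn (fun n => \int[mu w]_x (f n x)%:E).
    by apply: eq_integral => w _; apply/esym/cvg_lim => //; exact: cvgf.
  apply: cvg_monotone_convergence => //.
  - by move=> n; exact: measurable_funTS.
  - by move=> n w _; apply: integral_ge0 => x _; rewrite lee_fin.
have c2 : P G * \int[nu]_x (f n x)%:E @[n --> \oo] --> P G * \int[nu]_x phi x.
  by apply: cvgeZl; [exact: fin_num_measure|exact: cvgf].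
rewrite -(cvg_lim _ c1)// -(cvg_lim _ c2)//.
by congr (lim (_ @ \oo)); apply/funext => n; exact: simple.
Qed.

(** The fibres of f are disjoint, so the exponential of the integral is a product of independent
    factors, each given by [prm_mgf]. *)
Lemma prm_laplace_nnsfun (a : R) (f : {nnsfun E >-> R}) :
  \int[P]_w expeR (a%:E * \int[mu w]_x (f x)%:E) =
  expeR (\sum_(x \in range f) (expR (a * x) - 1)%:E * nu (f @^-1` [set x])).
Proof.
have finf : finite_set (range f) by exact: fimfunP.
set s := finmap.enum_fset (fset_set (range f)).
have us : uniq s by exact: finmap.fset_uniq.
pose A (i : 'I_(size s)) := f @^-1` [set tnth (in_tuple s) i].
pose h (i : 'I_(size s)) x := expeR ((a * tnth (in_tuple s) i)%:E * x).
have mA i : measurable (A i) by exact: measurable_sfunP.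
transitivity (\int[P]_w \prod_(i < size s) h i (mu w (A i))).
  apply: eq_integral => w _.
  rewrite integralT_nnsfun sintegralE fsbig_finite// -/s big_tnth.
  rewrite ge0_sume_distrr; last by move=> i _; exact: nnsfun_mulemu_ge0.
  rewrite (big_morph expeR (@expeRD R) (@expeR0 R)); apply: eq_bigr => i _.
  by rewrite muleA.
rewrite (prm_integral_prod prm)//.
- rewrite [in RHS]fsbig_finite// -/s big_tnth.
  rewrite [in RHS](big_morph expeR (@expeRD R) (@expeR0 R)).
  by apply: eq_bigr => i _; rewrite (prm_mgf prm).
- apply/trivIsetP => i j _ _ ij; apply/seteqP; split => // x [] /=.
  rewrite /A /= => -> /eqP.
  rewrite !(tnth_nth 0%R) nth_uniq//.
  by move=> /eqP ij'; move: ij; rewrite (val_inj ij') eqxx.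
- move=> i; apply: measurableT_comp; first exact: measurable_expeR.
  exact: measurable_funeM.
- by move=> i x; exact: expeR_ge0.
Qed.

(** Simple functions increase to phi, so the left side is a monotone limit, and each approximant is
    already below the right side. The upper bound is the direction that Chernoff's method uses. *)
Lemma prm_laplace_pos (phi : E -> R) :
  measurable_fun setT phi -> (forall x, (0 <= phi x)%R) ->
  \int[P]_w expeR (\int[mu w]_x (phi x)%:E) <=
  expeR (\int[nu]_x (expR (phi x) - 1)%:E).
Proof.
move=> mphi phi0.
have mphi' : measurable_fun setT (EFin \o phi) by exact/measurable_EFinP.
have phi0' x : 0 <= (EFin \o phi) x by rewrite lee_fin.
pose f := nnsfun_approx measurableT mphi'.
have cvgf (m : {measure set E -> \bar R}) :
  \int[m]_x (f n x)%:E @[n --> \oo] --> \int[m]_x (phi x)%:E :=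
  cvg_integral_nnsfun_approx (m := m) mphi' phi0'.
have mf n : measurable_fun setT (fun w => \int[mu w]_x (f n x)%:E).
  apply: measurable_prm_integral => //; first exact/measurable_EFinP.
  by move=> x; rewrite lee_fin.
have -> : \int[P]_w expeR (\int[mu w]_x (phi x)%:E) =
    \int[P]_w limn (fun n => expeR (\int[mu w]_x (f n x)%:E)).
  apply: eq_integral => w _; apply/esym/cvg_lim => //; apply: cvg_expeR => //.
  rewrite gt_eqF// (lt_le_trans ltNy0)//.
  by apply: integral_ge0 => x _; rewrite lee_fin.
rewrite monotone_convergence//; last 3 first.
- by move=> n; apply: measurableT_comp => //; exact: measurable_expeR.
- by move=> n w _; exact: expeR_ge0.
- move=> w _ i j ij; rewrite lee_expeR; apply: ge0_le_integral => //.
  + by move=> x _; rewrite lee_fin.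
  + exact/measurable_EFinP.
  + exact/measurable_EFinP.
  + by move=> x _; rewrite lee_fin; exact/lefP/nd_nnsfun_approx.
apply: lime_le.
  apply: ereal_nondecreasing_is_cvgn => i j ij; apply: ge0_le_integral => //.
  - by move=> w _; exact: expeR_ge0.
  - by apply: measurableT_comp => //; exact: measurable_expeR.
  - by apply: measurableT_comp => //; exact: measurable_expeR.
  - move=> w _; rewrite lee_expeR; apply: ge0_le_integral => //.
    + by move=> x _; rewrite lee_fin.
    + exact/measurable_EFinP.
    + exact/measurable_EFinP.
    + by move=> x _; rewrite lee_fin; exact/lefP/nd_nnsfun_approx.
apply: nearW => n.
rewrite [leLHS](_ : _ = \int[P]_w expeR (1%:E * \int[mu w]_x (f n x)%:E)); last first.
  by apply: eq_integral => w _; rewrite mul1e.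
rewrite prm_laplace_nnsfun lee_expeR.
under eq_fsbigr do rewrite mul1r.
rewrite (@nnsfun_sum_integral _ _ _ nu (f n) (fun x => expR x - 1)%R)//; last 2 first.
- by apply: measurable_funB => //; exact: measurable_expR.
- by move=> x x0; rewrite subr_ge0 -expR0 ler_expR.
apply: ge0_le_integral => //.
- by move=> x _; rewrite lee_fin subr_ge0 -expR0 ler_expR.
- by apply/measurable_EFinP; apply: measurable_funB => //; exact: measurableT_comp.
- by apply/measurable_EFinP; apply: measurable_funB => //; exact: measurableT_comp.
- move=> x _; rewrite lee_fin lerD2r ler_expR -lee_fin /f nnsfun_approxE.
  exact: le_approx.
Qed.

(** Contrary to the positive exponent, the left side is now below each approximant and the limit is
    taken on the right; finiteness of the integral keeps the exponent away from [-oo], where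
    [cvg_expeR] does not apply. *)
Lemma prm_laplace_neg (phi : E -> R) :
  measurable_fun setT phi -> (forall x, (0 <= phi x)%R) ->
  \int[nu]_x (1 - expR (- phi x))%:E < +oo ->
  \int[P]_w expeR (- \int[mu w]_x (phi x)%:E) <=
  expeR (- \int[nu]_x (1 - expR (- phi x))%:E).
Proof.
move=> mphi phi0 nufin.
have mphi' : measurable_fun setT (EFin \o phi) by exact/measurable_EFinP.
have phi0' x : 0 <= (EFin \o phi) x by rewrite lee_fin.
pose f := nnsfun_approx measurableT mphi'.
have fphi n x : (f n x <= phi x)%R.
  by rewrite -lee_fin /f nnsfun_approxE; exact: le_approx.
have mI (g : E -> R) : measurable_fun setT g -> (forall x, 0 <= g x)%R ->
    measurable_fun setT (fun w => expeR (- \int[mu w]_x (g x)%:E)).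
  move=> mg g0; apply: measurableT_comp; first exact: measurable_expeR.
  apply: measurableT_comp => //; apply: measurable_prm_integral => //.
  exact/measurable_EFinP.
have m1 (g : E -> R) : measurable_fun setT g ->
    measurable_fun setT (fun x => (1 - expR (- g x))%:E).
  move=> mg; apply/measurable_EFinP; apply: measurable_funB => //.
  by apply: measurableT_comp => //; exact: measurableT_comp.
have ge01 (x : R) : (0 <= x)%R -> (0 <= 1 - expR (- x))%R.
  by move=> x0; rewrite subr_ge0 -expR0 ler_expR oppr_le0.
have le1 n : \int[P]_w expeR (- \int[mu w]_x (phi x)%:E) <=
    expeR (- \int[nu]_x (1 - expR (- f n x))%:E).
  apply: (@le_trans _ _ (\int[P]_w expeR (- \int[mu w]_x (f n x)%:E))).
    apply: ge0_le_integral => //.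
    - by move=> w _; exact: expeR_ge0.
    - exact: mI.
    - exact: mI.
    - move=> w _; rewrite lee_expeR leeN2; apply: ge0_le_integral => //.
      + by move=> x _; rewrite lee_fin.
      + exact/measurable_EFinP.
      + by move=> x _; rewrite lee_fin.
  rewrite [leLHS](_ : _ = \int[P]_w expeR ((-1)%:E * \int[mu w]_x (f n x)%:E)); last first.
    by apply: eq_integral => w _; rewrite mulN1e.
  rewrite prm_laplace_nnsfun lee_expeR -(@nnsfun_sum_integral _ _ _ nu (f n) (fun x => 1 - expR (- x))%R)//; last first.
    apply: measurable_funB => //.
    by apply: measurableT_comp => //; exact: measurableT_comp.
  have F0 x : 0 <= (1 - expR (- x))%:E * nu (f n @^-1` [set x]).
    have [x0|x0] := leP 0%R x; first by rewrite mule_ge0// lee_fin ge01.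
    by rewrite preimage_nnfun0// measure0 mule0.
  rewrite !fsbig_finite//= -sumeN; last first.
    by move=> x y _ _; apply: ge0_adde_def; rewrite inE.
  apply: lee_sum => x _; rewrite mulN1r -[(expR _ - 1)%R]opprB EFinN mulNe.
  by [].
have cvgv : (- \int[nu]_x (1 - expR (- f n x))%:E) @[n --> \oo] -->
    (- \int[nu]_x (1 - expR (- phi x))%:E).
  apply: cvgeN.
  have -> : \int[nu]_x (1 - expR (- phi x))%:E =
      \int[nu]_x limn (fun n => (1 - expR (- f n x))%:E).
    apply: eq_integral => x _; apply/esym/cvg_lim => //.
    apply: cvg_EFin; first exact: nearW.
    have /fine_cvgP[_ fx] : (f n x)%:E @[n --> \oo] --> (phi x)%:E.
      exact: cvg_nnsfun_approx.
    apply: cvgB; first exact: cvg_cst.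
    apply: (cvg_comp (fun n => - f n x)%R expR); last exact: continuous_expR.
    exact: cvgN.
  apply: cvg_monotone_convergence => //.
  - by move=> n; exact: m1.
  - by move=> n x _; rewrite lee_fin ge01.
  - move=> x _ i j ij; rewrite lee_fin lerD2l lerN2 ler_expR lerN2.
    exact/lefP/nd_nnsfun_approx.
have nuf : (- \int[nu]_x (1 - expR (- phi x))%:E) != -oo.
  by rewrite eqe_oppLR/= lt_eqF.
by apply: (cvge_ge _ (cvg_expeR nuf cvgv)); exact: nearW.
Qed.

End laplace_functional.

(** * The heat kernel *)

Section lebesgue_tuple_theory.
Context {R : realType}.
Notation leb := (@lebesgue_measure R).

Lemma ge0_integral_lebesgue_tupleS n (phi : n.+1.-tuple R -> \bar R) :
  measurable_fun setT phi -> (forall x, 0 <= phi x) ->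
  \int[@lebesgue_tuple R n.+1]_v phi v =
  \int[leb]_x \int[@lebesgue_tuple R n]_v phi (tcons (x, v)).
Proof.
move=> mphi phi0.
have mt : measurable_fun [set: (measurableTypeR R * n.-tuple R)%type]
  (@tcons R n : measurableTypeR R * n.-tuple R -> n.+1.-tuple R).
  exact: measurable_tcons.
transitivity (\int[pushforward (leb \x @lebesgue_tuple R n) (@tcons R n)]_v phi v) => //.
rewrite (ge0_integral_pushforward mt)//=.
rewrite fubini_tonelli1//.
exact: measurableT_comp.
Qed.

Lemma lebesgue_tuple_box n (A : set R) : measurable A ->
  @lebesgue_tuple R n [set v | forall i, A (tnth v i)] = leb A ^+ n.
Proof.
move=> mA; elim: n => [|n IH].
  by rewrite expe0/= diracE mem_set// => -[].
rewrite expeS -IH /= /pushforward -product_measure1E//; last first.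
  rewrite (_ : [set v | _] = \bigcap_(i in setT) ((fun v => tnth v i) @^-1` A)); last first.
    by apply/seteqP; split => [v /= Av i _|v /= Av i]; exact: Av.
  apply: fin_bigcap_measurable => // i _; rewrite -[X in measurable X]setTI.
  exact: (measurable_tnth i).
congr (_ _); apply/seteqP; split => [[x v]/= H|[x v]/= [Ax Av] i].
  by split => [|i]; [have := H ord0; rewrite tnth0|have := H (lift ord0 i); rewrite tnthS].
by case: (unliftP ord0 i) => [j ->|->]; rewrite ?tnth0 ?tnthS.
Qed.

End lebesgue_tuple_theory.

Section heat_kernel_theory.
Context {R : realType}.
Local Open Scope ring_scope.

Lemma enorm_sqr n (x : n.-tuple R) : enorm x ^+ 2 = \sum_(i < n) tnth x i ^+ 2.
Proof. by rewrite sqr_sqrtr// sumr_ge0// => i _; exact: sqr_ge0. Qed.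

Lemma enorm_ge0 n (x : n.-tuple R) : 0 <= enorm x.
Proof. exact: sqrtr_ge0. Qed.

Lemma enorm_tsub0 n (x : n.-tuple R) : enorm (tsub (torigin n) x) = enorm x.
Proof.
congr Num.sqrt; apply: eq_bigr => i _.
by rewrite !tnth_mktuple sub0r sqrrN.
Qed.

Lemma heat_kernel_tsub0 n t (x : n.-tuple R) :
  heat_kernel t (tsub (torigin n) x) = heat_kernel t x.
Proof. by rewrite /heat_kernel enorm_tsub0. Qed.

Lemma heat_kernel_ge0 n t (x : n.-tuple R) : 0 <= heat_kernel t x.
Proof.
by rewrite /heat_kernel; case: ifP => // _; rewrite mulr_ge0 ?powR_ge0 ?expR_ge0.
Qed.

Lemma measurable_enorm n : measurable_fun setT (@enorm R n).
Proof.
apply: measurableT_comp; first exact: (continuous_measurable_fun (@sqrt_continuous R)).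
apply: measurable_sum => i; apply: measurable_funX; exact: measurable_tnth.
Qed.

Lemma measurable_heat_kernel n :
  measurable_fun setT (fun p : R * n.-tuple R => heat_kernel p.1 p.2).
Proof.
rewrite (_ : (fun _ => _) = fun p : R * n.-tuple R => if 0 < p.1 then
  (4 * pi * p.1) `^ (- (n%:R / 2)) *
  expR (- (enorm p.2 ^+ 2 * (4 * p.1) `^ (- 1))) else 0); last first.
  apply/funext => p; rewrite /heat_kernel; case: ifP => // p0.
  by rewrite powR_inv1// mulr_ge0// ltW.
apply: measurable_fun_ifT => //.
- by apply: measurable_fun_ltr.
- apply: measurable_funM.
    apply: (measurableT_comp (measurable_powR _)).
    by apply: measurable_funM => //.
  apply: measurableT_comp => //; apply: measurableT_comp => //.
  apply: measurable_funM.
    apply: measurable_funX; apply: measurableT_comp => //; exact: measurable_enorm.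
  apply: (measurableT_comp (measurable_powR _)).
  exact: measurable_funM.
Qed.

Lemma measurable_heat_kernel1 n t :
  measurable_fun setT (fun x : n.-tuple R => heat_kernel t x).
Proof. exact: (measurableT_comp (@measurable_heat_kernel n) (measurable_pair1 t)). Qed.

(** Induction on the dimension: the kernel factors through one coordinate, whose factor is the
    centred normal density of variance 2 t. *)
Lemma integral_heat_kernel n t : 0 < t ->
  (\int[@lebesgue_tuple R n]_x (heat_kernel t x)%:E = 1)%E.
Proof.
move=> t0; elim: n => [|n IH].
  rewrite (_ : @lebesgue_tuple R 0%N = \d_([tuple] : 0.-tuple R))//.
  rewrite integral_dirac//; last first.
    by apply/measurable_EFinP; exact: measurable_heat_kernel1.
  rewrite diracT mul1e /heat_kernel t0 enorm_sqr big_ord0 !mul0r !oppr0 powRr0.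
  by rewrite expR0 mulr1.
rewrite ge0_integral_lebesgue_tupleS//; last 2 first.
- by apply/measurable_EFinP; exact: measurable_heat_kernel1.
- by move=> x; rewrite lee_fin heat_kernel_ge0.
pose s := Num.sqrt (2 * t).
have s0 : s != 0 by rewrite gt_eqF// sqrtr_gt0 mulr_gt0.
rewrite -(integral_normal_pdf 0 s); apply: eq_integral => x _.
rewrite -[RHS]mule1 -IH -ge0_integralZl//; last 3 first.
- by apply/measurable_EFinP; exact: measurable_heat_kernel1.
- by move=> v _; rewrite lee_fin heat_kernel_ge0.
- by rewrite lee_fin normal_pdf_ge0.
apply: eq_integral => v _; rewrite -EFinM; congr EFin.
rewrite normal_pdfE// /heat_kernel t0 !enorm_sqr big_ord_recl tnth0.
rewrite [in RHS]/normal_peak [in RHS]/normal_fun subr0 sqr_sqrtr; last by rewrite mulr_ge0// ltW.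
have pt : 0 < 4 * pi * t by rewrite !mulr_gt0// pi_gt0.
have -> : 2 * t * pi *+ 2 = 4 * pi * t by rewrite -mulr_natl; ring.
have -> : 2 * t *+ 2 = 4 * t by rewrite -mulr_natl; ring.
rewrite -powR12_sqrt ?ltW// -powRN mulrACA -powRD; last by rewrite (gt_eqF pt) implybT.
rewrite -expRD.
under eq_bigr do rewrite tnthS.
congr (_ `^ _ * expR _); last by rewrite mulrDl opprD mulNr.
by rewrite -natr1; field.
Qed.

End heat_kernel_theory.

Section heat_kernel_bounds.
Context {R : realType} {n : nat}.
Local Open Scope ring_scope.
Implicit Types (x : n.-tuple R) (t : R).

Lemma heat_kernelE t x : 0 < t -> heat_kernel t x =
  (4 * pi * t) `^ (- (n%:R / 2)) * expR (- (enorm x ^+ 2 / (4 * t))).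
Proof. by rewrite /heat_kernel => ->. Qed.

Lemma heat_kernel_le0 t x : t <= 0 -> heat_kernel t x = 0.
Proof. by rewrite /heat_kernel leNgt => /negPf ->. Qed.

Let fourpi_gt0 t : 0 < t -> 0 < 4 * pi * t.
Proof. by move=> t0; rewrite !mulr_gt0// pi_gt0. Qed.

Lemma heat_kernel_le_peak t x : 0 < t ->
  heat_kernel t x <= (4 * pi * t) `^ (- (n%:R / 2)).
Proof.
move=> t0; rewrite heat_kernelE// ler_piMr ?powR_ge0// -expR0 ler_expR.
by rewrite oppr_le0 divr_ge0 ?sqr_ge0// mulr_ge0// ltW.
Qed.

Lemma heat_kernel_le1 t x : 1 <= t -> heat_kernel t x <= 1.
Proof.
move=> t1; have t0 : 0 < t by rewrite (lt_le_trans _ t1).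
apply: (le_trans (heat_kernel_le_peak _ t0)).
rewrite powRN invf_le1 ?powR_gt0 ?fourpi_gt0//.
have /(ler_powR (a := 4 * pi * t)) : (0 : R) <= n%:R / 2 by rewrite divr_ge0.
rewrite powRr0; apply.
rewrite -[leLHS]mulr1 ler_pM// (@le_trans _ _ (4 * 2))//; first lra.
by rewrite ler_pM2l// pi_ge2.
Qed.

(** The exponential factor increases with time and only the prefactor decreases. This bounds the
    kernel over an interval of times by its value at the last one. *)
Lemma heat_kernel_time (a b : R) x : 0 < a -> a <= b ->
  heat_kernel a x <= (b / a) `^ (n%:R / 2) * heat_kernel b x.
Proof.
move=> a0 ab; have b0 : 0 < b by rewrite (lt_le_trans a0).
rewrite !heat_kernelE// mulrA; apply: ler_pM.
- exact: powR_ge0.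
- exact: expR_ge0.
- have -> : 4 * pi * b = (b / a) * (4 * pi * a) by field; rewrite gt_eqF.
  rewrite (@powRM _ (b / a) (4 * pi * a)); last 2 first.
  - by rewrite divr_ge0 ?ltW.
  - by rewrite ltW// fourpi_gt0.
  rewrite mulrA.
  have ba0 : (b / a) `^ (n%:R / 2) != 0 by rewrite gt_eqF// powR_gt0// divr_gt0.
  by rewrite !powRN (mulfV ba0) mul1r.
- rewrite ler_expR lerN2; apply: ler_wpM2l; first exact: sqr_ge0.
  by rewrite lef_pV2 ?posrE ?mulr_gt0// ler_pM2l.
Qed.

(** With v = |x|^2 / (4 t) the product equals (v / pi)^(n/2) exp(-v), hence is at most (1 + v)^n
    exp(-v), and 1 + v <= n exp(v / n). Being uniform in t, the bound gives a condition on position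
    and size under which a jump never makes a peak. *)
Lemma heat_kernel_enorm t x : (0 < n)%N ->
  heat_kernel t x * enorm x ^+ n <= n%:R ^+ n.
Proof.
move=> n0; have [t0|t0] := leP t 0.
  by rewrite heat_kernel_le0// mul0r exprn_ge0.
rewrite heat_kernelE//; set v := enorm x ^+ 2 / (4 * t).
have v0 : 0 <= v by rewrite divr_ge0 ?sqr_ge0// mulr_ge0// ltW.
have -> : enorm x ^+ n = (enorm x ^+ 2) `^ (n%:R / 2).
  by rewrite -powR_mulrn ?enorm_ge0// -[_ ^+ 2]powR_mulrn ?enorm_ge0// -powRrM mulrC divfK.
have -> : enorm x ^+ 2 = v / pi * (4 * pi * t).
  have := @pi_gt0 R; rewrite /v; move: pi => p p0; field.
  by rewrite (gt_eqF p0) (gt_eqF t0).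
rewrite (@powRM _ (v / pi) (4 * pi * t)); last 2 first.
- exact: divr_ge0 v0 (pi_ge0 _).
- by rewrite ltW// fourpi_gt0.
have A0 : (4 * pi * t) `^ (n%:R / 2) != 0 by rewrite gt_eqF// powR_gt0// fourpi_gt0.
rewrite powRN; move: (_ `^ _) A0 => A A0.
rewrite mulrAC mulrCA mulVf// mulr1.
clearbody v.
have v1 : v / pi <= (1 + v) ^+ 2.
  rewrite (@le_trans _ _ v)//; last by nra.
  by rewrite ler_pdivrMr ?pi_gt0// ler_peMr// (le_trans _ (@pi_ge2 R))// ler1n.
have vn : (v / pi) `^ (n%:R / 2) <= (1 + v) ^+ n.
  rewrite (@le_trans _ _ (((1 + v) ^+ 2) `^ (n%:R / 2)))//.
    apply: ge0_ler_powR => //.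
      by rewrite nnegrE; exact: divr_ge0 v0 (pi_ge0 _).
    by rewrite nnegrE sqr_ge0.
  rewrite -[_ ^+ 2]powR_mulrn; last by rewrite addr_ge0.
  by rewrite -powRrM mulrC divfK// powR_mulrn// addr_ge0.
rewrite expRN ler_pdivrMr ?expR_gt0// (le_trans vn)//.
have -> : v = n%:R * (v / n%:R) by rewrite mulrC divfK// pnatr_eq0 -lt0n.
rewrite expRM_natl -exprMn lerXn2r ?nnegrE ?addr_ge0 ?mulr_ge0 ?expR_ge0 ?divr_ge0//.
have n1 : (1 : R) <= n%:R by rewrite ler1n.
rewrite (@le_trans _ _ (n%:R * (1 + v / n%:R)))//.
  by rewrite mulrDr mulr1; apply: lerD.
by rewrite ler_pM2l ?ltr0n// expR_ge1Dx.
Qed.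

(** Halving the exponent doubles the time. Hence the root has an explicit integral, of order
    t^(n/4), which decays geometrically along dyadic times. *)
Lemma sqrt_heat_kernel t x : 0 < t -> Num.sqrt (heat_kernel t x) =
  (4 * pi * t) `^ (n%:R / 4) * 2 `^ (n%:R / 2) * heat_kernel (2 * t) x.
Proof.
move=> t0; have t20 : 0 < 2 * t by rewrite mulr_gt0.
rewrite !heat_kernelE// sqrtrM ?powR_ge0//.
have -> : Num.sqrt (expR (- (enorm x ^+ 2 / (4 * t)))) =
    expR (- (enorm x ^+ 2 / (4 * (2 * t)))).
  have -> : - (enorm x ^+ 2 / (4 * t)) =
      - (enorm x ^+ 2 / (4 * (2 * t))) - enorm x ^+ 2 / (4 * (2 * t)).
    by field; rewrite gt_eqF.
  by rewrite expRD -expr2 sqrtr_sqr ger0_norm ?expR_ge0.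
rewrite [RHS]mulrA; congr (_ * _).
have -> : 4 * pi * (2 * t) = 2 * (4 * pi * t) by ring.
rewrite (@powRM _ 2 (4 * pi * t))//; last by rewrite ltW// fourpi_gt0.
rewrite -powR12_sqrt ?powR_ge0// -powRrM [2 `^ (- _) * _]mulrC mulrACA -!powRD; last 2 first.
- by rewrite pnatr_eq0 implybT.
- by rewrite (gt_eqF (fourpi_gt0 t0)) implybT.
by rewrite subrr powRr0 mulr1; congr (_ `^ _); field.
Qed.

(** Parabolic scaling: the prefactor is of order r^(-n), and the exponent is at most n (2 r)^2 / (4
    r^2) = n. *)
Lemma heat_kernel_lower (r t : R) x : 0 < r -> r ^+ 2 <= t -> t <= 2 * r ^+ 2 ->
  (forall i, `|tnth x i| <= 2 * r) ->
  (8 * pi) `^ (- (n%:R / 2)) * expR (- n%:R) / r ^+ n <= heat_kernel t x.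
Proof.
move=> r0 rt tr xr; have t0 : 0 < t by rewrite (lt_le_trans _ rt)// exprn_gt0.
rewrite heat_kernelE// mulrAC; apply: ler_pM.
- by rewrite divr_ge0 ?powR_ge0// exprn_ge0// ltW.
- exact: expR_ge0.
- have -> : r ^+ n = (r ^+ 2) `^ (n%:R / 2).
    rewrite -powR_mulrn ?ltW// -[_ ^+ 2]powR_mulrn ?ltW//.
    by rewrite -powRrM mulrC divfK.
  rewrite -powRN -powRM ?sqr_ge0//; last by rewrite mulr_ge0// pi_ge0.
  rewrite !powRN lef_pV2 ?posrE ?powR_gt0 ?fourpi_gt0//; last first.
    by rewrite !mulr_gt0 ?pi_gt0 ?exprn_gt0.
  apply: ge0_ler_powR => //; rewrite ?nnegrE.
  - by rewrite ltW// fourpi_gt0.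
  - by apply: mulr_ge0 (sqr_ge0 _); rewrite mulr_ge0// pi_ge0.
  have -> : 8 * pi * r ^+ 2 = 4 * pi * (2 * r ^+ 2) by ring.
  by rewrite ler_pM2l// mulr_gt0 ?pi_gt0.
- rewrite ler_expR lerN2 ler_pdivrMr ?mulr_gt0//.
  rewrite enorm_sqr (@le_trans _ _ (\sum_(i < n) (2 * r) ^+ 2))//.
    apply: ler_sum => i _; rewrite -real_normK ?num_real//.
    by rewrite lerXn2r ?nnegrE ?mulr_ge0// ltW.
  rewrite sumr_const card_ord -[_ *+ n]mulr_natl; apply: ler_wpM2l => //.
  by rewrite exprMn; lra.
Qed.

End heat_kernel_bounds.

(** * The intensity of the noise *)

Section sigma_finite_copy.
Context {d} {T : measurableType d} {R : realType}.

(* An alias on which the sigma-finite structure can be declared. *)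
Definition sf_copy (m : {measure set T -> \bar R})
  (sfm : sigma_finite setT m) : set T -> \bar R := m.

HB.instance Definition _ m sfm := isMeasure.Build _ _ _ (@sf_copy m sfm)
  (@measure0 _ _ _ m) (@measure_ge0 _ _ _ m) (@measure_semi_sigma_additive _ _ _ m).

HB.instance Definition _ m sfm :=
  Measure_isSigmaFinite.Build _ _ _ (@sf_copy m sfm) sfm.

Lemma sigma_finite_measureP (m : {measure set T -> \bar R}) :
  sigma_finite setT m ->
  exists l : {sigma_finite_measure set T -> \bar R}, m = l :> (set T -> \bar R).
Proof. by move=> sfm; exists (sf_copy sfm). Qed.

End sigma_finite_copy.

Section levy_sigma_finite.
Context {R : realType} (lambda : {measure set R -> \bar R}).
Hypothesis lambda0 : lambda [set 0%R] = 0.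
Hypothesis lambda1 : \int[lambda]_z `|z|%:E < +oo.

Lemma measurable_levy_tail (e : R) : measurable [set z : R | (e <= `|z|)%R].
Proof.
rewrite (_ : [set _ | _] = (fun z : R => `|z|%R) @^-1` `[e, +oo[%classic); last first.
  by apply/seteqP; split => z /=; rewrite in_itv/= andbT.
by rewrite -[X in measurable X]setTI; exact: normr_measurable.
Qed.

Lemma levy_tail_le (e : R) : (0 < e)%R ->
  e%:E * lambda [set z | (e <= `|z|)%R] <= \int[lambda]_z `|z|%:E.
Proof.
move=> e0; have mA := measurable_levy_tail e.
rewrite -[X in lambda X]setIT -integral_indic// -ge0_integralZl; last 4 first.
- by [].
- exact/measurable_EFinP.
- by move=> z _; rewrite lee_fin.
- by rewrite lee_fin ltW.
apply: ge0_le_integral => //.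
- by move=> z _; rewrite mule_ge0// lee_fin// ltW.
- by apply: measurable_funeM; exact/measurable_EFinP.
- by apply/measurable_EFinP.
- move=> z _; rewrite indicE -EFinM lee_fin; case: (boolP (z \in _)).
    by rewrite inE/= mulr1.
  by rewrite mulr0.
Qed.

Lemma levy_tail_fin (e : R) : (0 < e)%R -> lambda [set z | (e <= `|z|)%R] < +oo.
Proof.
move=> e0; have := levy_tail_le e0; rewrite -lee_pdivlMl// => /le_lt_trans; apply.
by rewrite lte_mul_pinfty// ?lee_fin ?invr_ge0 ?ltW.
Qed.

(** The tails away from 0 have finite mass by Markov's inequality, and the origin is null. This
    gives access to Tonelli's theorem for the intensity. *)
Lemma levy_sigma_finite : sigma_finite setT lambda.
Proof.
have mtail := measurable_levy_tail.
exists (fun k => [set 0%R] `|` [set z | (k.+1%:R^-1 <= `|z|)%R]).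
  apply/esym; rewrite -subTset => z _.
  have [->|z0] := eqVneq z 0%R; first by exists 0%N => //; left.
  have zp : (0 < `|z|)%R by rewrite normr_gt0.
  exists (Num.trunc (`|z|^-1)%R) => //; right => /=.
  rewrite invf_ple ?posrE// ltW//; exact: truncnS_gt.
move=> k; split; first exact: measurableU.
apply: le_lt_trans; first exact: (measureU2 _ (measurable_set1 0%R) (mtail _)).
by rewrite [X in X + _](_ : _ = 0)// add0e; exact: levy_tail_fin.
Qed.

End levy_sigma_finite.

Section noise_measure.
Context {R : realType} (d : nat) (l : {sigma_finite_measure set R -> \bar R}).
Local Notation points := (R * d.-tuple R * R)%type.

Lemma measurable_positive_time : measurable [set p : points | (0 < p.1.1)%R].
Proof.
rewrite (_ : [set _ | _] = (fun p : points => p.1.1) @^-1` `]0%R, +oo[%classic); last first.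
  by apply/seteqP; split => z /=; rewrite in_itv/= andbT.
rewrite -[X in measurable X]setTI.
suff mf : measurable_fun setT (fun p : points => p.1.1) by exact: mf.
exact: (measurableT_comp measurable_fst measurable_fst).
Qed.

(** The set function [noise_intensity], equipped with the measure structure that integration
    requires. *)
Definition noise_measure : {measure set points -> \bar R} :=
  mrestr (@spacetime_lebesgue R d \x l) measurable_positive_time.

Lemma noise_intensityE : noise_intensity (d := d) l = noise_measure.
Proof. by []. Qed.

(* The identity changes the display of the measurable structure of [R]. *)
Lemma ge0_integral_spacetime (phi : R * d.-tuple R -> \bar R) :
  measurable_fun setT phi -> (forall p, 0 <= phi p) ->
  \int[@spacetime_lebesgue R d]_p phi p =
  \int[lebesgue_measure]_t \int[@lebesgue_tuple R d]_y phi (t, y).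
Proof.
move=> mphi phi0.
pose i : measurableTypeR R * d.-tuple R -> R * d.-tuple R := idfun.
have mi : measurable_fun setT i.
  by move=> _ A mA; rewrite setTI; exact: mA.
transitivity (\int[pushforward (@lebesgue_measure R \x @lebesgue_tuple R d) i]_p phi p).
  exact: erefl.
rewrite (ge0_integral_pushforward mi)//=.
by rewrite fubini_tonelli1; [|exact: mphi|exact: phi0].
Qed.

(** The jump size is integrated last, so that estimates in time and space may keep it as a
    parameter. *)
Lemma ge0_integral_noise_measure (phi : points -> \bar R) :
  measurable_fun setT phi -> (forall p, 0 <= phi p) ->
  \int[noise_measure]_q phi q =
  \int[l]_z \int[lebesgue_measure]_(t in `]0%R, +oo[)
    \int[@lebesgue_tuple R d]_y phi (t, y, z).
Proof.
move=> mphi phi0.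
pose D := [set p : points | (0 < p.1.1)%R].
have mD : measurable D := measurable_positive_time.
have phiD0 x : 0 <= (phi \_ D) x by rewrite patchE; case: ifP.
have mphiD : measurable_fun setT (phi \_ D).
  by apply/(measurable_restrictT _ mD); exact: measurable_funTS.
transitivity (\int[@spacetime_lebesgue R d \x l]_(q in D) phi q).
  transitivity (\int[noise_measure]_(q in D) phi q).
    rewrite [RHS]integral_mkcond; apply: ge0_ae_eq_integral => //.
    exists (~` D); split; first exact: measurableC.
      by rewrite /noise_measure/= /mrestr setICl measure0.
    by move=> q /=; apply: contra_not => Dq _; rewrite patchE mem_set.
  by apply: eq_measure_integral => A mA AD; rewrite /noise_measure/= /mrestr setIidl.
rewrite integral_mkcond fubini_tonelli2//.
apply: eq_integral => z _; rewrite /fubini_G ge0_integral_spacetime//; last first.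
  exact: (measurableT_comp mphiD (measurable_pair2 z)).
rewrite [RHS]integral_mkcond; apply: eq_integral => t _.
rewrite patchE; case: ifPn => [|].
  rewrite inE/= in_itv/= andbT => t0; apply: eq_integral => y _.
  by rewrite patchE mem_set.
rewrite notin_setE/= in_itv/= andbT => t0.
by apply: integral0_eq => y _; rewrite patchE memNset.
Qed.

Lemma ge0_integral_noise_measureM (a : R * d.-tuple R -> \bar R) (b : R -> \bar R) :
  measurable_fun setT a -> (forall p, 0 <= a p) ->
  measurable_fun setT b -> (forall z, 0 <= b z) ->
  \int[noise_measure]_q (a q.1 * b q.2) =
  \int[lebesgue_measure]_(t in `]0%R, +oo[) \int[@lebesgue_tuple R d]_y a (t, y) *
  \int[l]_z b z.
Proof.
move=> ma a0 mb b0; rewrite ge0_integral_noise_measure//; last 2 first.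
- apply: emeasurable_funM; first exact: measurableT_comp.
  exact: measurableT_comp.
- by move=> p; exact: mule_ge0.
have mF : measurable_fun [set: R] (fun t => \int[@lebesgue_tuple R d]_y a (t, y)).
  exact: (measurable_fun_fubini_tonelli_F (m2 := @lebesgue_tuple R d)).
rewrite -ge0_integralZl//; last by apply: integral_ge0 => t _; exact: integral_ge0.
apply: eq_integral => z _ /=.
transitivity (\int[lebesgue_measure]_(t in `]0%R, +oo[)
    (b z * \int[@lebesgue_tuple R d]_y a (t, y))).
  apply: eq_integral => t _; rewrite -ge0_integralZl//; last first.
    exact: (measurableT_comp ma (measurable_pair1 t)).
  by apply: eq_integral => y _; rewrite muleC.
rewrite ge0_integralZl//; last 2 first.
- exact: measurable_funTS.
- by move=> t _; exact: integral_ge0.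
by rewrite muleC.
Qed.

End noise_measure.

(** * Series and integrals of monotone functions *)

Section nonincreasing_series.
Context {R : realType}.
Notation leb := (@lebesgue_measure R).

Section integral_test.
Variable g : R -> R.
Hypotheses (g0 : forall x, (0 <= g x)%R)
  (gni : forall x y, (x <= y)%R -> (g y <= g x)%R).

Let mg D : measurable D -> measurable_fun D g.
Proof. by move=> mD; apply: nonincreasing_measurable => // x y; exact: gni. Qed.

Lemma integral_nonincreasing_series (a : nat) :
  \int[leb]_(x in `[a%:R, +oo[) (g x)%:E =
  \sum_(n <oo) \int[leb]_(x in `[(a + n)%:R, (a + n.+1)%:R[) (g x)%:E.
Proof.
rewrite -ge0_integral_bigcup//.
- congr (integral _ _ _); apply/seteqP; split => [x /=|x [n _]/=].
    rewrite in_itv/= andbT => ax.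
    have x0 : (0 <= x)%R by exact: le_trans ax.
    have /andP[tx xt] := truncn_itv x0.
    have at_ : (a <= Num.trunc x)%N.
      by rewrite -ltnS -(ltr_nat R) (le_lt_trans ax).
    exists (Num.trunc x - a)%N => //=.
    by rewrite in_itv/= addnS subnKC// tx.
  rewrite !in_itv/= andbT => /andP[ax _]; apply: le_trans ax.
  by rewrite ler_nat leq_addr.
- by apply/measurable_EFinP; apply: mg; exact: bigcup_measurable.
- by move=> x _; rewrite lee_fin.
- apply: ltn_trivIset => n1 n2 n12; apply/seteqP; split => // x [/=].
  rewrite !in_itv/= => /andP[_ x1] /andP[x2 _].
  have := le_lt_trans x2 x1.
  by rewrite ltr_nat ltn_add2l ltnS leqNgt n12.
Qed.

Lemma integral_unit_bounds (a : nat) :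
  (g a.+1%:R)%:E <= \int[leb]_(x in `[a%:R, a.+1%:R[) (g x)%:E <= (g a%:R)%:E.
Proof.
have len (c : R) : \int[leb]_(x in `[a%:R, a.+1%:R[) (cst c%:E) x = c%:E.
  rewrite integral_cst//= lebesgue_measure_itv/= lte_fin ltr_nat ltnSn.
  by rewrite -EFinD -natrB// subSnn mule1.
rewrite -{1}len -[X in _ <= _ <= X]len; apply/andP; split.
- apply: ge0_le_integral => //.
  + by move=> x _; rewrite lee_fin.
  + by apply/measurable_EFinP; exact: mg.
  + move=> x /=; rewrite in_itv/= => /andP[_ /ltW xa].
    by rewrite lee_fin gni.
- apply: ge0_le_integral => //.
  + by move=> x _; rewrite lee_fin.
  + by apply/measurable_EFinP; exact: mg.
  + move=> x /=; rewrite in_itv/= => /andP[xa _].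
    by rewrite lee_fin gni.
Qed.

Lemma integral_le_series (a : nat) :
  \int[leb]_(x in `[a%:R, +oo[) (g x)%:E <= \sum_(n <oo) (g (a + n)%:R)%:E.
Proof.
rewrite integral_nonincreasing_series; apply: lee_nneseries.
  by move=> n _ _; apply: integral_ge0 => x _; rewrite lee_fin.
by move=> n _; rewrite addnS; have /andP[] := integral_unit_bounds (a + n).
Qed.

Lemma series_le_integral (a : nat) :
  \sum_(n <oo) (g (a + n).+1%:R)%:E <= \int[leb]_(x in `[a%:R, +oo[) (g x)%:E.
Proof.
rewrite integral_nonincreasing_series; apply: lee_nneseries.
  by move=> n _ _; rewrite lee_fin.
by move=> n _; rewrite addnS; have /andP[] := integral_unit_bounds (a + n).
Qed.

End integral_test.

Section reciprocal_series.
Variable F : R -> R.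
Hypotheses (F0 : forall x, (0 < F x)%R)
  (Fnd : forall x y, (x <= y)%R -> (F x <= F y)%R).

Let V0 n : 0 <= ((F n.+1%:R)^-1)%:E. Proof. by rewrite lee_fin invr_ge0 ltW. Qed.

(** The n terms of index n to 2 n - 1 are each at least 1 / F(2 n), so n / F(2 n) is bounded by a
    tail of a convergent series. *)
Lemma reciprocal_series_superlinear :
  \sum_(n <oo) ((F n.+1%:R)^-1)%:E < +oo ->
  forall M : R, exists a : R, forall t, (a <= t)%R -> (M * t <= F t)%R.
Proof.
move=> sfin M; wlog M0 : M / (0 < M)%R => [H|].
  have M1 : (0 < Num.max M 1)%R by rewrite lt_max ltr01 orbT.
  have [a Ha] := H _ M1; exists (Num.max a 0%R) => t; rewrite ge_max => /andP[at0 t0].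
  by rewrite (le_trans _ (Ha _ at0))// ler_wpM2r// le_max lexx.
(* The factor 4 comes from t < 2 (n + 1) <= 4 n, where n is the integer part of t / 2. *)
have M4 : (0 < (4 * M)^-1)%R by rewrite invr_gt0 mulr_gt0.
have tail := nneseries_tail_cvg sfin (fun k _ => V0 k).
have : \forall n \near \oo, \sum_(n <= k <oo) ((F k.+1%:R)^-1)%:E < ((4 * M)^-1)%:E.
  have /fine_cvgP[tfin tlim] := tail.
  have [N1 _ H1] := tfin; have [N2 _ H2] := cvgr_lt _ tlim _ M4.
  exists (maxn N1 N2) => // n /=; rewrite geq_max => /andP[/H1 /= nfin /H2 /=].
  by rewrite -lte_fin fineK.
move=> [N _ HN].
exists (2 * N.+1%:R)%R => t tN.
have t0 : (0 <= t / 2)%R by rewrite divr_ge0// (le_trans _ tN)// mulr_ge0.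
set n := Num.trunc (t / 2); have /andP[nt tn] := truncn_itv t0.
have Nn : (N.+1 <= n)%N.
  by rewrite -ltnS -(ltr_nat R) (le_lt_trans _ tn)// ler_pdivlMr// mulrC.
have : (n%:R * (F t)^-1)%:E < ((4 * M)^-1)%:E.
  apply: le_lt_trans (HN n (ltnW Nn)).
  apply: le_trans (nneseries_lim_ge (n + n) _); last by move=> k _ _.
  rewrite [leLHS](_ : _ = \sum_(n <= k < n + n) ((F t)^-1)%:E); last first.
    by rewrite sumEFin sumr_const_nat addnK mulr_natl.
  rewrite !big_nat; apply: lee_sum => k /andP[_ kn]; rewrite lee_fin lef_pV2 ?posrE//.
  apply: Fnd; rewrite (@le_trans _ _ (n + n)%:R)// ?ler_nat//.
  by rewrite natrD -mulr2n -mulr_natl; lra.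
rewrite lte_fin ltr_pdivrMr// mulrC ltr_pdivlMr ?mulr_gt0// => /ltW; apply: le_trans.
have n1 : (1 <= n%:R :> R)%R by rewrite ler1n (leq_ltn_trans _ Nn).
move: tn; rewrite -/n -[n.+1%:R]natr1; clearbody n => tn.
have -> : (n%:R * (4 * M) = M * (4 * n%:R))%R by ring.
by rewrite ler_pM2l//; lra.
Qed.

End reciprocal_series.

(** If the series converged, the maximum would be at least 2 t eventually; there it equals F, so the
    series of 1 / F would converge too. *)
Lemma reciprocal_series_max (F : R -> R) : (forall x, (0 < F x)%R) ->
  (forall x y, (x <= y)%R -> (F x <= F y)%R) ->
  \sum_(n <oo) ((F n.+1%:R)^-1)%:E = +oo ->
  \sum_(n <oo) ((Num.max (F n.+1%:R) n.+1%:R)^-1)%:E = +oo.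
Proof.
move=> F0 Fnd sF; apply/eqP; rewrite eq_le leey/= leNgt; apply/negP => sG.
pose G t := Num.max (F t) t.
have G0 x : (0 < G x)%R by rewrite lt_max F0.
have Gnd x y : (x <= y)%R -> (G x <= G y)%R.
  by move=> xy; rewrite ge_max !le_max Fnd//= xy orbT.
have [a Ga] := reciprocal_series_superlinear G0 Gnd sG 2.
pose n := (Num.trunc (`|a|)).+1.
have GF k : (n <= k)%N -> G k.+1%:R = F k.+1%:R.
  move=> nk; have k0 : (0 < k.+1%:R :> R)%R by [].
  have : (2 * k.+1%:R <= G k.+1%:R)%R.
    apply: Ga; rewrite (le_trans (ler_norm _))// ltW// (lt_le_trans (truncnS_gt _))//.
    by rewrite ler_nat leqW.
  by rewrite /G; case: (leP (F k.+1%:R) k.+1%:R) => // _; lra.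
have V0 (H : R -> R) k : (forall x, 0 < H x)%R -> 0 <= ((H k.+1%:R)^-1)%:E.
  by move=> H0; rewrite lee_fin invr_ge0 ltW.
have : \sum_(n <oo) ((F n.+1%:R)^-1)%:E < +oo.
  rewrite (nneseries_split 0 n)//; last by move=> k _; exact: V0.
  rewrite lte_add_pinfty//; first by rewrite sumEFin ltry.
  rewrite add0n.
  rewrite [ltLHS](_ : _ = \sum_(n <= k <oo) ((G k.+1%:R)^-1)%:E).
    apply: le_lt_trans sG; rewrite [leRHS](nneseries_split 0 n)//; last first.
      by move=> k _; exact: (V0 G).
    by rewrite add0n leeDr// sume_ge0// => k _; exact: (V0 G).
  rewrite -!(nneseries_addn n) => [|i|i]; [|exact: (V0 G)|exact: V0].
  by apply: eq_eseriesr => k _; rewrite GF// leq_addl.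
by rewrite sF ltxx.
Qed.

End nonincreasing_series.

(** * First hitting of a sequence of sets *)

Section first_hit.
Context {R : realType} {d0 : measure_display} {Omega : measurableType d0}
  {P : probability Omega R} {d1 : measure_display} {E : measurableType d1}
  {nu : {measure set E -> \bar R}} {mu : Omega -> {measure set E -> \bar R}}.
Hypothesis prm : poisson_random_measure P nu mu.

(* Decompose along the first [k] such that [A k] is hit: this event only
   depends on [mu] off [S], hence does not bias the integral over [S]. *)
Lemma prm_first_hit (A : (set E)^nat) (S : set E) (phi : nat -> E -> \bar R)
    (c : nat -> R) (rho : R) :
  (forall k, measurable (A k)) -> trivIset setT A -> measurable S ->
  (forall k, A k `&` S = set0) ->
  (forall k, measurable_fun setT (phi k)) -> (forall k x, 0 <= phi k x) ->
  (forall k, (0 < c k)%R) -> (0 <= rho)%R ->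
  (forall k, \int[nu]_(x in S) phi k x <= (rho * c k)%:E) ->
  \sum_(k <oo) nu (A k) = +oo ->
  1 - rho%:E <= P (\bigcup_k ([set w | mu w (A k) != 0] `&`
    [set w | \int[mu w]_(x in S) phi k x < (c k)%:E])).
Proof.
move=> mA tA mS AS mphi phi0 c0 rho0 nuphi nuA.
have mX k := prm_measurable prm (mA k).
have mI k : measurable_fun setT (fun w => \int[mu w]_(x in S) phi k x).
  exact: (measurable_prm_integral prm mS (mphi k) (phi0 k)).
(* [kappa k] is the event that [A k] is the first set to be hit: the earlier counts are 0 and the
   last one is not. *)
pose B k (i : 'I_k.+1) : set (\bar R) := if (i < k)%N then [set 0] else ~` [set 0].
pose kappa k := \bigcap_(i in [set: 'I_k.+1]) [set w | B k i (mu w (A i))].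
pose bad k := [set w | (c k)%:E <= \int[mu w]_(x in S) phi k x].
have mB k i : measurable (B k i).
  by rewrite /B; case: ifP => // _; exact: measurableC.
have mkappa k : measurable (kappa k).
  apply: fin_bigcap_measurable => // i _; rewrite -[X in measurable X]setTI.
  exact: (mX i).
have mbad k : measurable (bad k).
  by rewrite -[X in measurable X]setTI; exact: emeasurable_fun_c_infty.
have kappaP k w : kappa k w -> mu w (A k) != 0.
  by move=> /(_ ord_max I) /=; rewrite /B ltnn => /eqP.
have kappa0 k i w : kappa k w -> (i < k)%N -> mu w (A i) = 0.
  move=> kw ik; have := kw (Ordinal (ltnW (ik : (i.+1 < k.+1)%N))) I.
  by rewrite /B /= ik.
have tkappa : trivIset setT kappa.
  apply: ltn_trivIset => i j ji; apply/seteqP; split => // w [] kj ki.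
  by have := kappaP _ _ kj; rewrite (kappa0 _ _ _ ki ji) eqxx.
(* Markov's inequality on [kappa k], the restricted mean being computed by [campbell]. *)
have Pbad k : P (kappa k `&` bad k) <= rho%:E * P (kappa k).
  have camp : \int[P]_(w in kappa k) \int[mu w]_(x in S) phi k x =
      P (kappa k) * \int[nu]_(x in S) phi k x.
    apply: campbell => // D mD DS.
    apply: (prm_mean_indep prm (A := fun i : 'I_k.+1 => A i)) => //.
    - apply/trivIsetP => i j _ _ ij; move/trivIsetP : tA; apply => //.
    - move=> i; apply/seteqP; split => // x [Ax /DS Sx].
      by rewrite -(AS i); split.
  have : (c k)%:E * P (kappa k `&` bad k) <= (c k)%:E * (rho%:E * P (kappa k)).
    apply: (@le_trans _ _ (\int[P]_(w in kappa k) \int[mu w]_(x in S) phi k x)).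
      apply: (@le_trans _ _ (\int[P]_(w in kappa k `&` bad k) \int[mu w]_(x in S) phi k x)).
        rewrite -integral_cst//; last exact: measurableI.
        apply: ge0_le_integral => //; first exact: measurableI.
        - by move=> w _; rewrite lee_fin ltW.
        - exact: measurable_funTS.
        - by move=> w [].
      apply: ge0_subset_integral => //; first exact: measurableI.
      - exact: measurable_funTS.
      - by move=> w _; exact: integral_ge0.
    rewrite camp muleC muleA -EFinM [(c k * rho)%R]mulrC.
    by apply: lee_pmul => //; exact: integral_ge0.
  by rewrite lee_pmul2l// lte_fin.
set U := \bigcup_k _.
have mU : measurable U.
  apply: bigcup_measurable => k _; apply: measurableI.
    rewrite (_ : [set _ | _] = ~` ((mu ^~ (A k)) @^-1` [set 0])).
      by apply: measurableC; rewrite -[X in measurable X]setTI; exact: mX.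
    by apply/seteqP; split => w /= /eqP.
  rewrite -[X in measurable X]setTI; exact: emeasurable_fun_infty_o.
(* The union of the [A k] has infinite intensity, hence infinite mass a.s., so some [A k] is charged
   and there is a first one. *)
have hit : {ae P, forall w, (\bigcup_k kappa k) w}.
  have nuU : nu (\bigcup_k A k) = +oo.
    rewrite measure_bigcup//.
    by rewrite (eq_eseriesl (Q := xpredT))// => k; rewrite in_setT.
  have := prm_infinite prm (bigcup_measurable (fun k _ => mA k)) nuU.
  apply: filterS => w muU.
  have exk : exists k, mu w (A k) != 0.
    apply: contrapT => /forallNP A0; have : mu w (\bigcup_k A k) = 0.
      rewrite measure_bigcup// eseries0// => k _ _.
      by have /negP/negPn/eqP := A0 k.
    by rewrite muU.
  have := ex_minnP exk; case: ex_minnP => k hk hmin _.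
  exists k => // i _; rewrite /B /=; case: ifPn => [ik|].
    by apply: contrapT => /eqP/hmin; rewrite leqNgt ik.
  rewrite -leqNgt => ki.
  have -> : nat_of_ord i = k by apply/eqP; rewrite eqn_leq ki -ltnS ltn_ord.
  exact/eqP.
rewrite leeBlDr//.
have mUk : measurable (\bigcup_k kappa k) by exact: bigcup_measurable.
have -> : 1 = P (\bigcup_k kappa k).
  have : P (~` \bigcup_k kappa k) = 0 by apply/negligibleP => //; exact: measurableC.
  rewrite probability_setC// => /eqP; rewrite sube_eq ?add0e; last 2 first.
    by [].
    by rewrite fin_num_adde_defl// fin_num_measure.
  by move=> /eqP.
apply: (@le_trans _ _ (P (U `|` \bigcup_k (kappa k `&` bad k)))).
  apply: le_measure; rewrite ?inE.
  - exact: bigcup_measurable.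
  - apply: measurableU => //; apply: bigcup_measurable => k _; exact: measurableI.
  - move=> w [k _ kw]; have [b|b] := leP (c k)%:E (\int[mu w]_(x in S) phi k x).
      by right; exists k.
    by left; exists k => //; split => //=; exact: kappaP kw.
apply: le_trans; first apply: measureU2 => //.
  by apply: bigcup_measurable => k _; exact: measurableI.
apply: leeD => //.
apply: (@le_trans _ _ (\sum_(k <oo) P (kappa k `&` bad k))).
  apply: measure_sigma_subadditive => //.
  - by move=> k; exact: measurableI.
  - by apply: bigcup_measurable => k _; exact: measurableI.
apply: (@le_trans _ _ (\sum_(k <oo) rho%:E * P (kappa k))).
  exact: lee_nneseries.
rewrite nneseriesZl// -[leRHS]mule1 lee_pmul//; first exact: nneseries_ge0.
rewrite -(@probability_setT _ _ _ P).
apply: (@le_trans _ _ (P (\bigcup_k kappa k))).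
  rewrite measure_bigcup//.
  by rewrite [leRHS](eq_eseriesl (Q := xpredT))// => k; rewrite in_setT.
by apply: le_measure; rewrite ?inE//; exact: bigcup_measurable.
Qed.

End first_hit.

(** * Jump parts of the mild solution *)

Section window_kernel.
Context {R : realType} {d : nat}.
Notation leb := (@lebesgue_measure R).

(** The kernel at time t seen from the origin, cut to births before c. Taking [c = t] gives the full
    kernel, while c < t keeps only jumps of age more than t - c, at which the kernel varies
    slowly. *)
Definition window_kernel (c t : R) (p : R * d.-tuple R) : R :=
  (if 0 < p.1 < c then heat_kernel (t - p.1) p.2 else 0)%R.

Lemma window_kernel_ge0 c t p : (0 <= window_kernel c t p)%R.
Proof. by rewrite /window_kernel; case: ifP => // _; exact: heat_kernel_ge0. Qed.

Lemma measurable_window_kernel c t : measurable_fun setT (window_kernel c t).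
Proof.
have m1 : measurable_fun setT (fun p : R * d.-tuple R => p.1) by exact: measurable_fst.
apply: measurable_fun_ifT => //.
- by apply: measurable_and; exact: measurable_fun_ltr.
- pose h (p : R * d.-tuple R) : R * d.-tuple R := ((t - p.1)%R, p.2).
  apply: (measurableT_comp (@measurable_heat_kernel R d) (_ : measurable_fun setT h)).
  apply/measurable_fun_pairP; split; last exact: measurable_snd.
  exact: measurable_funB.
Qed.

Lemma integral_window_kernel c t : (0 <= c <= t)%R ->
  \int[leb]_(s in `]0%R, +oo[) \int[@lebesgue_tuple R d]_y
    (window_kernel c t (s, y))%:E = c%:E.
Proof.
move=> /andP[c0 ct].
transitivity (\int[leb]_(s in `]0%R, +oo[) (\1_(`]0%R, c[%classic : set R) s)%:E).
  apply: eq_integral => s; rewrite inE/= in_itv/= andbT => s0.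
  rewrite indicE /window_kernel/= s0/=; case: ltP => sc.
    rewrite mem_set/=; last by rewrite in_itv/= s0.
    by rewrite integral_heat_kernel// subr_gt0 (lt_le_trans sc).
  rewrite memNset/=; last by rewrite in_itv/= s0/= ltNge sc.
  by rewrite integral0.
rewrite integral_indic// (_ : _ `&` _ = `]0%R, c[%classic); last first.
  apply/seteqP; split => [x []//|x /= xc]; split => //.
  by move: xc; rewrite !in_itv/= andbT => /andP[].
rewrite /= lebesgue_measure_itv/= lte_fin; case: ifPn => [_|].
  by rewrite -EFinD subr0.
by rewrite -leNgt => c0'; congr EFin; apply/le_anti/andP.
Qed.

Context {l : {sigma_finite_measure set R -> \bar R}}.

Lemma integral_noise_window_kernel c t (b : R -> R) : (0 <= c <= t)%R ->
  measurable_fun setT b -> (forall z, (0 <= b z)%R) ->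
  \int[noise_measure d l]_q (window_kernel c t q.1 * b q.2)%:E =
  c%:E * \int[l]_z (b z)%:E.
Proof.
move=> ct mb b0.
rewrite -(integral_window_kernel ct) -(@ge0_integral_noise_measureM R d l
  (fun p => (window_kernel c t p)%:E) (fun z => (b z)%:E))//.
- by apply/measurable_EFinP; exact: measurable_window_kernel.
- by move=> p; rewrite lee_fin window_kernel_ge0.
- exact/measurable_EFinP.
Qed.

End window_kernel.

Section mild_solution_decomposition.
Context {R : realType} {d : nat} {d0 : measure_display} {Omega : measurableType d0}.
Variables (lambda : {measure set R -> \bar R}) (m : R)
  (mu : Omega -> {measure set (R * d.-tuple R * R) -> \bar R}).

Definition jump_part (sg t : R) (w : Omega) : \bar R :=
  \int[mu w]_q (window_kernel t t q.1 * Num.max (sg * q.2) 0)%:E.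

Lemma jump_part_ge0 sg t w : 0 <= jump_part sg t w.
Proof.
apply: integral_ge0 => q _.
by rewrite lee_fin mulr_ge0 ?window_kernel_ge0// le_max lexx orbT.
Qed.

(** Since the kernel is nonnegative, the positive and negative parts of the integrand are selected
    by the sign of the jump. The integral is by definition the difference of the two, so the
    identity holds in the extended reals, infinite values included. *)
Lemma mild_solutionE (t : R) w : (0 < t)%R ->
  mild_solution lambda m mu t (torigin d) w =
  (drift lambda m * t)%:E + (jump_part 1 t w - jump_part (-1) t w).
Proof.
move=> t0; rewrite /mild_solution /noise_integral.
pose D : set (R * d.-tuple R) := `]0%R, t]%classic `*` setT.
have DE (p : R * d.-tuple R) : (p \in D) = (0 < p.1 <= t)%R.
  by rewrite /D; apply/idP/idP; [rewrite inE => -[/=]; rewrite in_itv|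
    move=> pt; rewrite inE; split => //=; rewrite in_itv].
have kE (p : R * d.-tuple R) : p \in D ->
    heat_kernel (t - p.1) (tsub (torigin d) p.2) = window_kernel t t p.
  rewrite DE heat_kernel_tsub0 /window_kernel => /andP[-> pt] /=.
  case: ltP => // tp; rewrite heat_kernel_le0//.
  by rewrite subr_le0.
have kN (p : R * d.-tuple R) : p \notin D -> window_kernel t t p = 0%R.
  rewrite DE /window_kernel; case: ifP => // /andP[-> /ltW ->] //.
congr (_ + _).
- rewrite EFinM; congr (_ * _).
  transitivity (\int[@spacetime_lebesgue R d]_p (window_kernel t t p)%:E).
    rewrite integral_mkcond; apply: eq_integral => p _; rewrite patchE.
    by case: ifPn => pD; [rewrite kE|rewrite kN].
  rewrite ge0_integral_spacetime; last 2 first.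
  + by apply/measurable_EFinP; exact: measurable_window_kernel.
  + by move=> p; rewrite lee_fin window_kernel_ge0.
  rewrite -[RHS](@integral_window_kernel _ d t t); last by rewrite lexx ltW.
  rewrite [RHS]integral_mkcond; apply: eq_integral => s _.
  rewrite patchE; case: ifPn => //; rewrite notin_setE/= in_itv/= andbT => s0.
  apply: integral0_eq => y _; rewrite /window_kernel/=; case: ifP => // /andP[s0'].
  by rewrite s0' in s0.
- rewrite integral_mkcond integralE; congr (_ - _).
  + apply: eq_integral => q _; rewrite funeposE patchE.
    have [|] := boolP (q \in _).
      rewrite inE => -[Dq _]; rewrite kE ?inE// -EFin_max mul1r.
      by rewrite maxr_pMr ?window_kernel_ge0// mulr0.
    move=> qN; rewrite kN ?mul0r ?maxxx//.
    by apply: contra qN; rewrite !inE => Dq; split.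
  + apply: eq_integral => q _; rewrite funenegE patchE.
    have [|] := boolP (q \in _).
      rewrite inE => -[Dq _]; rewrite kE ?inE// -EFinN -EFin_max mulN1r.
      by rewrite maxr_pMr ?window_kernel_ge0// mulr0 mulrN.
    move=> qN; rewrite kN ?mul0r ?oppe0 ?maxxx//.
    by apply: contra qN; rewrite !inE => Dq; split.
Qed.

End mild_solution_decomposition.

(** The failures of Q lie, up to a null set, in the intersection of the complements of events of
    probability at least 1 - 1/(n + 1). The set Q itself may be nonmeasurable. *)
Lemma ae_of_prob_close_to_1 {R : realType} {d} {T : measurableType d}
    (P : probability T R) (Q : T -> Prop) :
  (forall e : R, (0 < e)%R -> exists U, [/\ measurable U, 1 - e%:E <= P U &
    {ae P, forall w, U w -> Q w}]) ->
  {ae P, forall w, Q w}.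
Proof.
move=> H.
have e0 n : (0 < (n.+1%:R : R)^-1)%R by [].
have [U HU] := choice (fun n => H _ (e0 n)).
have mU n : measurable (U n) by have [] := HU n.
have aeU : {ae P, forall w, forall n, U n w -> Q w}.
  by apply: ae_foralln => n; have [] := HU n.
have mC : measurable (\bigcap_n ~` U n).
  by apply: bigcap_measurableType => n _; exact: measurableC.
have PC : P (\bigcap_n ~` U n) = 0.
  apply/eqP; rewrite eq_le measure_ge0 andbT; apply/lee_addgt0Pr => e ep.
  rewrite add0e; pose n := Num.trunc (e^-1)%R.
  apply: (@le_trans _ _ (P (~` U n))).
    apply: le_measure; rewrite ?inE//; first exact: measurableC.
    exact: bigcap_inf.
  have [_ PU _] := HU n.
  rewrite probability_setC// leeBlDr ?fin_num_measure// -leeBlDl ?fin_num_measure//.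
  apply: le_trans PU; apply: leeB => //; rewrite lee_fin.
  by rewrite invf_ple ?posrE// ltW// truncnS_gt.
have negC : P.-negligible (\bigcap_n ~` U n) by exists (\bigcap_n ~` U n); split.
have := negligibleU negC aeU; apply: negligibleS => w /= nQ.
have [[n Un]|nU] := pselect (exists n, U n w); [right|left].
  by move=> /(_ n Un).
by move=> n _ Un; apply: nU; exists n.
Qed.

(** * Riemann sums over windows of unequal length, and the measure of boxes *)

Section partition_test.
Context {R : realType}.
Notation leb := (@lebesgue_measure R).
Variables (g : R -> R) (t : nat -> R).
Hypotheses (g0 : forall x, (0 <= g x)%R)
  (gni : forall x y, (x <= y)%R -> (g y <= g x)%R)
  (tnd : forall k, (t k <= t k.+1)%R) (tub : forall x, exists k, (x < t k)%R).

Lemma integral_le_partition_series :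
  \int[leb]_(x in `[t 0%N, +oo[) (g x)%:E <=
  \sum_(k <oo) ((t k.+1 - t k) * g (t k))%:E.
Proof.
have tmono : {homo t : i j / (i <= j)%N >-> (i <= j)%R}.
  by apply: homo_leq => //; exact: le_trans.
have mg D : measurable D -> measurable_fun D g.
  by move=> mD; apply: nonincreasing_measurable => // x y; exact: gni.
have -> : `[t 0%N, +oo[%classic = \bigcup_k `[t k, t k.+1[%classic.
  apply/seteqP; split => [x /=|x [k _]/=]; last first.
    rewrite !in_itv/= andbT => /andP[tx _]; apply: le_trans tx; exact: tmono.
  rewrite in_itv/= andbT => tx; case: (ex_minnP (tub x)) => k xk kmin.
  case: k => [|k] in xk kmin *; first by rewrite ltNge tx in xk.
  exists k => //=; rewrite in_itv/= xk andbT leNgt; apply/negP => /kmin.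
  by rewrite ltnn.
rewrite ge0_integral_bigcup//.
- apply: lee_nneseries => k _; first by move=> _; apply: integral_ge0 => x _; rewrite lee_fin.
  apply: (@le_trans _ _ (\int[leb]_(x in `[t k, t k.+1[) (cst (g (t k))%:E) x)).
    apply: ge0_le_integral => //.
    + by move=> x _; rewrite lee_fin.
    + by apply/measurable_EFinP; exact: mg.
    + move=> x /=; rewrite in_itv/= => /andP[tx _].
      by rewrite lee_fin gni.
  rewrite integral_cst//= lebesgue_measure_itv/= lte_fin; case: ifPn => _.
    by rewrite -EFinD -EFinM mulrC.
  by rewrite mule0 lee_fin mulr_ge0// subr_ge0.
- by apply/measurable_EFinP; apply: mg; exact: bigcup_measurable.
- by move=> x _; rewrite lee_fin.
- apply: ltn_trivIset => n1 n2 n12; apply/seteqP; split => // x [/=].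
  rewrite !in_itv/= => /andP[_ x1] /andP[x2 _].
  have := le_lt_trans x2 x1.
  by rewrite ltNge tmono.
Qed.

End partition_test.

Section noise_rectangle.
Context {R : realType} {d : nat} {l : {sigma_finite_measure set R -> \bar R}}.

Lemma noise_rectangleE (a b u v : R) (J : set R) :
  [set q : R * d.-tuple R * R | [/\ (a < q.1.1 <= b)%R,
    forall i, (u < tnth q.1.2 i <= v)%R & J q.2]] =
  (`]a, b]%classic `*` [set y : d.-tuple R | forall i, `]u, v]%classic (tnth y i)]) `*` J.
Proof.
apply/seteqP; split => [[[s y] z] [/= sab yuv Jz]|[[s y] z] [[/= sab yuv] Jz]].
  by split => //; split.
by move: sab; rewrite in_itv/= => sab; split.
Qed.

Let measurable_box (u v : R) :
  measurable [set y : d.-tuple R | forall i, `]u, v]%classic (tnth y i)].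
Proof.
rewrite (_ : [set v | _] = \bigcap_(i in setT) ((fun y => tnth y i) @^-1` `]u, v]%classic)); last first.
  by apply/seteqP; split => [y /= Av i _|y /= Av i]; exact: Av.
apply: fin_bigcap_measurable => // i _; rewrite -[X in measurable X]setTI.
exact: (measurable_tnth i).
Qed.

Lemma measurable_noise_rectangle (a b u v : R) (J : set R) : measurable J ->
  measurable [set q : R * d.-tuple R * R | [/\ (a < q.1.1 <= b)%R,
    forall i, (u < tnth q.1.2 i <= v)%R & J q.2]].
Proof.
by move=> mJ; rewrite noise_rectangleE; apply: measurableX => //; exact: measurableX.
Qed.

Lemma noise_measure_rectangle (a b u v : R) (J : set R) :
  (0 <= a <= b)%R -> (u <= v)%R -> measurable J ->
  noise_measure d l [set q | [/\ (a < q.1.1 <= b)%R,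
    forall i, (u < tnth q.1.2 i <= v)%R & J q.2]] =
  ((b - a) * (v - u) ^+ d)%:E * l J.
Proof.
move=> /andP[a0 ab] uv mJ.
rewrite /noise_measure/= /mrestr.
have -> : [set q : R * d.-tuple R * R | [/\ (a < q.1.1 <= b)%R,
    forall i, (u < tnth q.1.2 i <= v)%R & J q.2]] `&` [set p | (0 < p.1.1)%R] =
    [set q : R * d.-tuple R * R | [/\ (a < q.1.1 <= b)%R,
    forall i, (u < tnth q.1.2 i <= v)%R & J q.2]].
  by apply: setIidl => q /= [/andP[/(le_lt_trans a0)]].
have mbox := measurable_box u v.
rewrite noise_rectangleE product_measure1E//; last exact: measurableX.
congr (_ * _).
transitivity (@lebesgue_measure R `]a, b]%classic * @lebesgue_tuple R d
    [set y | forall i, `]u, v]%classic (tnth y i)]).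
  by apply: product_measure1E.
rewrite lebesgue_tuple_box// EFinM; congr (_ * _).
  rewrite lebesgue_measure_itv/= lte_fin; case: ltP => // ba.
  by congr EFin; apply/eqP; rewrite eq_sym subr_eq0 eq_le ab ba.
rewrite lebesgue_measure_itv/= lte_fin; case: ltP => [_|vu].
  by rewrite -EFinD EFin_expe.
have -> : v = u by apply/eqP; rewrite eq_le uv vu.
by rewrite subrr EFin_expe.
Qed.

End noise_rectangle.

(** * Peaks *)

Section oscillation.
Context {R : realType} {d : nat} {d0 : measure_display} {Omega : measurableType d0}
  {P : probability Omega R} {l : {sigma_finite_measure set R -> \bar R}}
  {mu : Omega -> {measure set (R * d.-tuple R * R) -> \bar R}}.
Hypothesis hd : (1 <= d)%N.
Hypothesis prm : poisson_random_measure P (noise_measure d l) mu.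
Hypothesis lambda1 : \int[l]_z `|z|%:E < +oo.
Variables (sg : R) (sg1 : (`|sg| = 1)%R).
Hypothesis lsg : 0 < l [set z | (0 < sg * z)%R].
Variables (F : R -> R) (drf : R).
Hypotheses (F0 : forall x, (0 < F x)%R)
  (Fnd : forall x y, (x <= y)%R -> (F x <= F y)%R).
Hypothesis sF : \sum_(n <oo) ((F n.+1%:R)^-1)%:E = +oo.

Let measurable_side (e : R) : measurable [set z | (e <= sg * z)%R].
Proof.
rewrite (_ : [set _ | _] = (fun z => sg * z)%R @^-1` `[e, +oo[%classic); last first.
  by apply/seteqP; split => z /=; rewrite in_itv/= andbT.
rewrite -[X in measurable X]setTI.
suff mf : measurable_fun setT (fun z : R => (sg * z)%R) by exact: mf.
exact: measurable_funM.
Qed.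

Let big_jumps : exists2 e : R, (0 < e)%R & 0 < l [set z | (e <= sg * z)%R].
Proof.
apply: contrapT => H; move: lsg.
have -> : [set z | (0 < sg * z)%R] =
    \bigcup_n [set z | ((n.+1%:R)^-1 <= sg * z)%R].
  apply/seteqP; split => [z /= z0|z [n _] /=]; last by apply: lt_le_trans.
  exists (Num.trunc (sg * z)^-1) => //=.
  by rewrite invf_ple ?posrE// ltW// truncnS_gt.
have : l.-negligible (\bigcup_n [set z | ((n.+1%:R)^-1 <= sg * z)%R]).
  apply: negligible_bigcup => n; exists [set z | ((n.+1%:R)^-1 <= sg * z)%R].
  split => //; apply/eqP; rewrite eq_le measure_ge0 andbT leNgt.
  by apply/negP => ln; apply: H; exists (n.+1%:R)^-1%R.
rewrite negligibleP//; last exact: bigcup_measurable.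
by move=> ->; rewrite ltxx.
Qed.

Let l_fin (e : R) : (0 < e)%R -> l [set z | (e <= sg * z)%R] \is a fin_num.
Proof.
move=> e0; rewrite ge0_fin_numE//; apply: le_lt_trans (levy_tail_fin lambda1 e0).
apply: le_measure; rewrite ?inE//; first exact: measurable_levy_tail.
move=> z /= ez; rewrite (le_trans ez)// (le_trans (ler_norm _))//.
by rewrite normrM sg1 mul1r.
Qed.

Section peaks.
Variables (e M C : R) (N : nat).
Hypotheses (e0 : (0 < e)%R) (le0 : 0 < l [set z | (e <= sg * z)%R])
  (M0 : (0 <= M)%R) (C0 : (0 < C)%R) (N0 : (0 < N)%N).

(** The shift by 2 anticipates that the peak of a window is observed at most 2 later than its start:
    there, both the time and F are still bounded by H at the start. *)
Let H (t : R) : R := Num.max (F (t + 2)%R) (t + 2)%R.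

Let H0 t : (0 < H t)%R. Proof. by rewrite lt_max F0. Qed.

Let Hnd x y : (x <= y)%R -> (H x <= H y)%R.
Proof.
move=> xy; have xy2 : (x + 2 <= y + 2)%R by rewrite lerD2r.
by rewrite /H ge_max !le_max Fnd//= xy2 orbT.
Qed.

Let c0 : R := ((8 * pi) `^ (- (d%:R / 2)) * expR (- d%:R))%R.

Let c00 : (0 < c0)%R.
Proof. by rewrite mulr_gt0 ?expR_gt0// powR_gt0// mulr_gt0// pi_gt0. Qed.

(** Chosen so that c0 K e = c0 e + M + C + |drf|: a peak of height c0 K e H exceeds M F together
    with C T, the level allowed to opposite jumps, and the drift. The summand 1 makes K at least 1
    and hence the radius at most 1. *)
Let K : R := (1 + (M + C + `|drf|) / (c0 * e))%R.

Let K1 : (1 <= K)%R.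
Proof.
by rewrite /K lerDl divr_ge0//; [rewrite !addr_ge0// ltW|rewrite mulr_ge0// ltW].
Qed.

(* The radius below which a jump of size [e] produces a peak of height of
   order [K * H t]. *)
Let r (t : R) : R := ((K * H t)^-1 `^ (d%:R^-1))%R.

Let KH0 t : (0 < K * H t)%R.
Proof. by rewrite mulr_gt0// (lt_le_trans _ K1). Qed.

Let r0 t : (0 < r t)%R. Proof. by rewrite powR_gt0// invr_gt0. Qed.

Let rd t : (r t ^+ d = (K * H t)^-1)%R.
Proof.
have dn0 : (d%:R != 0 :> R)%R by rewrite pnatr_eq0 -lt0n.
rewrite -powR_mulrn; last exact: ltW.
by rewrite -powRrM mulVf// powRr1// invr_ge0 ltW.
Qed.

Let rni x y : (x <= y)%R -> (r y <= r x)%R.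
Proof.
move=> xy; apply: ge0_ler_powR; rewrite ?nnegrE ?invr_ge0 ?(ltW (KH0 _))//.
by rewrite lef_pV2 ?posrE// ler_pM2l ?Hnd// (lt_le_trans _ K1).
Qed.

Let r_le1 t : (0 <= t)%R -> (r t <= 1)%R.
Proof.
move=> t0; rewrite [leRHS](_ : _ = (1 `^ (d%:R^-1))%R); last by rewrite powR1.
apply: ge0_ler_powR; rewrite ?nnegrE ?invr_ge0 ?(ltW (KH0 _))//.
rewrite invf_le1// -[leLHS]mulr1 ler_pM// le_max; apply/orP; right.
by lra.
Qed.

(** Each window has length r^2 and is observed r^2 after its end, at [T k]. The jumps in it then
    have ages between r^2 and 2 r^2, the range of [heat_kernel_lower]. *)
Fixpoint peak_time (k : nat) : R :=
  (if k is k'.+1 then peak_time k' + r (peak_time k') ^+ 2 else N%:R)%R.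

Let T k : R := (peak_time k + 2 * r (peak_time k) ^+ 2)%R.

Let peak_timeS k : (peak_time k < peak_time k.+1)%R.
Proof. by rewrite /= ltrDl exprn_gt0. Qed.

Let peak_time_ge k : (N%:R <= peak_time k)%R.
Proof.
by elim: k => // k IH; rewrite (le_trans IH)// ltW// peak_timeS.
Qed.

Let peak_time_gt0 k : (0 < peak_time k)%R.
Proof. by rewrite (lt_le_trans _ (peak_time_ge k))// ltr0n. Qed.

(** Below a bound x every step is at least r(x)^2, because the radius is nonincreasing. *)
Let peak_time_unbounded x : exists k, (x < peak_time k)%R.
Proof.
apply: contrapT => /forallNP xub.
have {}xub k : (peak_time k <= x)%R by rewrite leNgt; exact/negP.
have lb k : (k%:R * r x ^+ 2 <= peak_time k)%R.
  elim: k => [|k IH]; first by rewrite mul0r ltW.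
  rewrite -natr1 mulrDl mul1r /= lerD// lerXn2r ?nnegrE ?(ltW (r0 _))//.
  exact: rni.
have r20 : (0 < r x ^+ 2)%R by rewrite exprn_gt0.
have := truncnS_gt (x / r x ^+ 2).
by rewrite ltr_pdivrMr// ltNge (le_trans (lb _) (xub _)).
Qed.

Let peak_time_homo : {homo peak_time : i j / (i <= j)%N >-> (i <= j)%R}.
Proof. by apply: homo_leq => //; [exact: le_trans|move=> k; exact: ltW]. Qed.

(** A cube of side r at distance of order r from the origin replaces a ball: its volume is exactly
    r^d = 1 / (K H). *)
Let A k : set (R * d.-tuple R * R) := [set q |
  [/\ (peak_time k < q.1.1 <= peak_time k.+1)%R,
    forall i, (r (peak_time k) < tnth q.1.2 i <= 2 * r (peak_time k))%R &
    (e <= sg * q.2)%R]].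

Let measurable_A k : measurable (A k).
Proof. exact: (measurable_noise_rectangle _ _ _ _ (measurable_side e)). Qed.

Let nuA k : noise_measure d l (A k) =
  ((peak_time k.+1 - peak_time k) * (H (peak_time k))^-1)%:E *
  (K^-1%:E * l [set z | (e <= sg * z)%R]).
Proof.
have pk : (0 <= peak_time k <= peak_time k.+1)%R by rewrite !ltW.
have rk : (r (peak_time k) <= 2 * r (peak_time k))%R by rewrite ler_peMl ?ler1n// ltW.
rewrite [LHS](noise_measure_rectangle pk rk (measurable_side e)).
rewrite muleA -EFinM; congr (_%:E * _).
have -> : (2 * r (peak_time k) - r (peak_time k) = r (peak_time k))%R by ring.
rewrite rd invfM [(K^-1 * _)%R]mulrC mulrA //.
Qed.

(** Up to a constant factor the sum is a left Riemann sum of the nonincreasing function 1 / H, hence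
    at least its integral, which diverges by [reciprocal_series_max]; dropping the first N + 2 terms
    accounts for the start at N and the shift in H. *)
Let series_nuA : \sum_(k <oo) noise_measure d l (A k) = +oo.
Proof.
under eq_eseriesr do rewrite nuA muleC.
rewrite nneseriesZle; last 2 first.
- by rewrite mule_ge0// lee_fin invr_ge0 (le_trans _ K1).
- by move=> k; rewrite lee_fin mulr_ge0 ?invr_ge0 ?subr_ge0 ?ltW.
suff -> : \sum_(k <oo) ((peak_time k.+1 - peak_time k) * (H (peak_time k))^-1)%:E = +oo.
  by rewrite gt0_muley// mule_gt0// lte_fin invr_gt0 (lt_le_trans _ K1).
apply/eqP; rewrite eq_le leey/=.
pose g t := (H t)^-1%R.
have g0 t : (0 <= g t)%R by rewrite invr_ge0 ltW.
have gni x y : (x <= y)%R -> (g y <= g x)%R by move=> xy; rewrite lef_pV2 ?posrE ?Hnd.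
apply: le_trans (integral_le_partition_series g0 gni _ peak_time_unbounded); last first.
  by move=> k; exact: ltW.
apply: le_trans (series_le_integral g0 gni N).
have Hoo := reciprocal_series_max F0 Fnd sF.
rewrite (nneseries_split 0 (N + 2)) in Hoo; last first.
  by move=> k _; rewrite lee_fin invr_ge0 ltW// lt_max F0.
rewrite sumEFin add0n -nneseries_addn in Hoo; last first.
  by move=> k; rewrite lee_fin invr_ge0 ltW// lt_max F0.
rewrite leye_eq; apply/eqP.
have E : \sum_(n <oo) (g (N + n).+1%:R)%:E =
    \sum_(i <oo) ((Num.max (F (i + (N + 2)).+1%:R) (i + (N + 2)).+1%:R)^-1)%:E.
  apply: eq_eseriesr => n _; rewrite /g /H -natrD.
  by have -> : ((N + n).+1 + 2 = (n + (N + 2)).+1)%N by rewrite addnA addSn [(n + N)%N]addnC.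
by rewrite [LHS]E; move: Hoo; case: (\sum_(i <oo) _).
Qed.

Let trivIset_A : trivIset setT A.
Proof.
apply: ltn_trivIset => i j ji; apply/seteqP; split => // q [] [qj _ _] [qi _ _].
move: qj qi => /andP[_ q1] /andP[q2 _]; have := lt_le_trans q2 q1.
by rewrite ltNge peak_time_homo.
Qed.

Let T_gt0 k : (0 < T k)%R.
Proof. by rewrite /T addr_gt0// mulr_gt0// exprn_gt0. Qed.

Let T_le k : (T k <= peak_time k + 2)%R.
Proof.
rewrite /T lerD2l ler_piMr// exprn_ile1//; first exact: ltW.
by rewrite r_le1// ltW.
Qed.

Let peak_height k q : A k q ->
  (c0 * K * H (peak_time k) * e <=
   window_kernel (T k) (T k) q.1 * Num.max (sg * q.2) 0)%R.
Proof.
case: q => -[s y] z [/= /andP[s1 s2] yr ez].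
have rr := r0 (peak_time k); have r2 : (0 < r (peak_time k) ^+ 2)%R by rewrite exprn_gt0.
apply: ler_pM; [|exact: ltW| |by rewrite le_max ez].
  apply: mulr_ge0; last exact: ltW.
  by apply: mulr_ge0; [exact: ltW|exact: le_trans K1].
have sT : (0 < s < T k)%R.
  rewrite (lt_trans (peak_time_gt0 k) s1)/= (le_lt_trans s2)// /T ltrD2l.
  by rewrite ltr_pMl// ltr1n.
rewrite /window_kernel/= sT.
have -> : (c0 * K * H (peak_time k) = c0 / r (peak_time k) ^+ d)%R.
  by rewrite rd invrK mulrA.
apply: heat_kernel_lower => //.
- by rewrite /T lerBrDr; apply: le_trans (lerD (lexx _) s2) _; lra.
- by rewrite /T lerBlDr; lra.
- move=> i; have /andP[y1 y2] := yr i.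
  by rewrite ger0_norm// ltW// (lt_trans _ y1).
Qed.

(** It carries the whole of the opposite jump part and, since e > 0, is disjoint from every target
    [A k]. *)
Let S : set (R * d.-tuple R * R) := [set q | (sg * q.2 <= 0)%R].

Let measurable_S : measurable S.
Proof.
rewrite (_ : S = (fun q : R * d.-tuple R * R => sg * q.2)%R @^-1` `]-oo, 0%R]%classic); last first.
  by apply/seteqP; split => z /=; rewrite in_itv.
rewrite -[X in measurable X]setTI.
suff mf : measurable_fun setT (fun q : R * d.-tuple R * R => (sg * q.2)%R) by exact: mf.
exact: measurable_funM.
Qed.

Let phi k (q : R * d.-tuple R * R) : \bar R :=
  (window_kernel (T k) (T k) q.1 * Num.max (- sg * q.2) 0)%:E.

Let jump_partS k w : jump_part mu (- sg) (T k) w = \int[mu w]_(q in S) phi k q.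
Proof.
rewrite [RHS]integral_mkcond; apply: eq_integral => q _; rewrite patchE.
case: ifPn => // qS; congr EFin; rewrite (_ : Num.max _ _ = 0%R) ?mulr0//.
apply/max_idPr; rewrite mulNr oppr_le0.
by move: qS; rewrite notin_setE/= => /negP; rewrite -ltNge => /ltW.
Qed.

Let measurable_max (a : R) : measurable_fun setT (fun z : R => Num.max (a * z) 0)%R.
Proof. by apply: measurable_maxr => //; exact: measurable_funM. Qed.

Let mean_jump : R := fine (\int[l]_z `|z|%:E).

(** The mean of the opposite jump part at time t is at most t times [mean_jump]. So [prm_first_hit],
    with levels C T and rho = [mean_jump / C], finds a hit at which that part stays below C T. *)
Lemma peaks_prob : exists U, [/\ measurable U,
  1 - (mean_jump / C)%:E <= P U &
  {ae P, forall w, U w -> exists t, [/\ (N%:R <= t)%R, (0 < t)%R &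
    (M * F t)%:E <= (sg * drf * t)%:E +
      (jump_part mu sg t w - jump_part mu (- sg) t w)]}].
Proof.
have mj0 : (0 <= mean_jump)%R by apply: fine_ge0; exact: integral_ge0.
have mjE : mean_jump%:E = \int[l]_z `|z|%:E.
  by rewrite fineK// ge0_fin_numE//; exact: integral_ge0.
have phi0 k q : 0 <= phi k q.
  by rewrite lee_fin mulr_ge0 ?window_kernel_ge0// le_max lexx orbT.
have mphi k : measurable_fun setT (phi k).
  apply/measurable_EFinP; apply: measurable_funM.
    exact: (measurableT_comp (measurable_window_kernel _ _) measurable_fst).
  exact: (measurableT_comp (measurable_max (- sg)) measurable_snd).
exists (\bigcup_k ([set w | mu w (A k) != 0] `&`
    [set w | \int[mu w]_(x in S) phi k x < (C * T k)%:E])).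
split.
- apply: bigcup_measurable => k _; apply: measurableI.
    have mX := prm_measurable prm (measurable_A k).
    rewrite (_ : [set _ | _] = ~` ((mu ^~ (A k)) @^-1` [set 0])).
      by apply: measurableC; rewrite -[X in measurable X]setTI; exact: mX.
    by apply/seteqP; split => w /= /eqP.
  rewrite -[X in measurable X]setTI; apply: emeasurable_fun_infty_o => //.
  exact: (measurable_prm_integral prm).
- apply: (prm_first_hit prm) => //.
  + by move=> k; apply/seteqP; split => // q [] [_ _ /= qe] /=;
      rewrite /S/= leNgt (lt_le_trans e0 qe).
  + by move=> k; rewrite mulr_gt0.
  + by rewrite divr_ge0// ltW.
  + move=> k; apply: (@le_trans _ _ (\int[noise_measure d l]_x phi k x)).
      by apply: ge0_subset_integral.
    rewrite [leLHS](@integral_noise_window_kernel R d l (T k) (T k)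
      (fun z => Num.max (- sg * z) 0)%R)//; last 2 first.
    * by rewrite lexx ltW.
    * by move=> z; rewrite le_max lexx orbT.
    have -> : (mean_jump / C * (C * T k) = T k * mean_jump)%R.
      by rewrite mulrA divfK ?gt_eqF// mulrC.
    rewrite EFinM mjE lee_pmul2l ?lte_fin//; apply: ge0_le_integral => //.
    * by move=> z _; rewrite lee_fin le_max lexx orbT.
    * exact/measurable_EFinP.
    * by apply/measurable_EFinP; exact: normr_measurable.
    * move=> z _; rewrite lee_fin ge_max normr_ge0 andbT (le_trans (ler_norm _))//.
      by rewrite normrM normrN sg1 mul1r.
(* Counts are a.s. integers, so a nonzero count is at least 1 and the peak height bounds the jump
   part from below. *)
- have fink : {ae P, forall w, forall k, exists j : nat, mu w (A k) = j%:R%:E}.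
    apply: ae_foralln => k; apply: (prm_ae_finite prm) => //.
    by rewrite nuA -(fineK (l_fin e0)) -!EFinM ltry.
  apply: filterS fink => w fink [k _ [/= Ak0 Ik]].
  have [j Ej] := fink k.
  exists (T k); split => //.
    by rewrite (le_trans (peak_time_ge k))// lerDl mulr_ge0// sqr_ge0.
  rewrite jump_partS; move: Ik; set y := \int[mu w]_(x in S) phi k x => yC.
  have y0 : 0 <= y by exact: integral_ge0.
  have h0 : (0 <= c0 * K * H (peak_time k) * e)%R.
    apply: mulr_ge0; last exact: ltW.
    apply: mulr_ge0; last exact: ltW.
    by apply: mulr_ge0; [exact: ltW|exact: le_trans K1].
  have jp : (c0 * K * H (peak_time k) * e)%:E <= jump_part mu sg (T k) w.
    apply: (@le_trans _ _ (\int[mu w]_(q in A k)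
        (window_kernel (T k) (T k) q.1 * Num.max (sg * q.2) 0)%:E)).
      apply: (@le_trans _ _ (\int[mu w]_(q in A k)
          (cst (c0 * K * H (peak_time k) * e)%:E) q)).
        rewrite integral_cst// Ej -EFinM lee_fin ler_peMr//.
        rewrite ler1n lt0n; apply/eqP => j0; move: Ak0.
        by rewrite Ej j0 eqxx.
      apply: ge0_le_integral => //.
      * apply: measurable_funTS; apply/measurable_EFinP; apply: measurable_funM.
          exact: (measurableT_comp (measurable_window_kernel _ _) measurable_fst).
        exact: (measurableT_comp (measurable_max sg) measurable_snd).
      * by move=> q Aq; rewrite lee_fin; exact: peak_height.
    apply: ge0_subset_integral => //.
    + apply/measurable_EFinP; apply: measurable_funM.
        exact: (measurableT_comp (measurable_window_kernel _ _) measurable_fst).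
      exact: (measurableT_comp (measurable_max sg) measurable_snd).
    + by move=> q _; rewrite lee_fin mulr_ge0 ?window_kernel_ge0// le_max lexx orbT.
  have ce : (c0 * K * e = c0 * e + (M + C + `|drf|))%R.
    by rewrite /K; field; rewrite !gt_eqF.
  have HT : (T k <= H (peak_time k))%R.
    by rewrite (le_trans (T_le k))// /H le_max lexx orbT.
  have HF : (F (T k) <= H (peak_time k))%R.
    by rewrite (le_trans (Fnd (T_le k)))// /H le_max lexx.
  have drfT : (- (`|drf| * T k) <= sg * drf * T k)%R.
    rewrite lerNl -mulNr; apply: ler_wpM2r; first exact: ltW.
    by rewrite (le_trans (ler_norm _))// normrN normrM sg1 mul1r.
  have real : (M * F (T k) <= sg * drf * T k + (c0 * K * H (peak_time k) * e - C * T k))%R.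
    have -> : (c0 * K * H (peak_time k) * e =
        (c0 * e + (M + C + `|drf|)) * H (peak_time k))%R by rewrite -ce; ring.
    have h1 : (M * F (T k) <= M * H (peak_time k))%R by rewrite ler_wpM2l.
    have h2 : (C * T k <= C * H (peak_time k))%R by rewrite ler_wpM2l// ltW.
    have h3 : (`|drf| * T k <= `|drf| * H (peak_time k))%R by rewrite ler_wpM2l.
    have h4 : (0 <= c0 * e * H (peak_time k))%R.
      by apply: mulr_ge0; [apply: mulr_ge0|]; exact: ltW.
    rewrite !mulrDl; lra.
  apply: (@le_trans _ _ (sg * drf * T k + (c0 * K * H (peak_time k) * e - C * T k))%:E).
    by rewrite lee_fin.
  by rewrite EFinD EFinB leeD2l// leeB// ltW.
Qed.

End peaks.

Lemma jump_part_oscillation :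
  {ae P, forall w, forall M N : nat, exists t, [/\ (N%:R <= t)%R, (0 < t)%R &
    (M%:R * F t)%:E <= (sg * drf * t)%:E +
      (jump_part mu sg t w - jump_part mu (- sg) t w)]}.
Proof.
apply: ae_foralln => M; apply: ae_foralln => N.
have [e e0 le0] := big_jumps.
have mj0 : (0 <= fine (\int[l]_z `|z|%:E))%R by apply: fine_ge0; exact: integral_ge0.
apply: ae_of_prob_close_to_1 => a a0.
(* This makes the failure probability, mean over C, at most a; the summand 1 keeps C positive. *)
pose C := (fine (\int[l]_z `|z|%:E) / a + 1)%R.
have C0 : (0 < C)%R by rewrite ltr_wpDl// divr_ge0// ltW.
have [U [mU PU HU]] := peaks_prob e0 le0 (ler0n _ M) C0 (ltn0Sn N).
exists U; split => //.
  apply: le_trans PU; apply: leeB => //; rewrite lee_fin ler_pdivrMr//.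
  by rewrite /C mulrDr mulr1 mulrC divfK ?gt_eqF// lerDl ltW.
apply: filterS HU => w H Uw; have [t [Nt t0 Ht]] := H Uw.
by exists t; split => //; rewrite (le_trans _ Nt)// ler_nat.
Qed.

End oscillation.

(** * Law of large numbers for jumps of one sign *)

Section borel_cantelli_inverse_square.
Context {R : realType} {d} {T : measurableType d} (P : probability T R).

(** Telescoping: 1 / x^2 <= 2 / x - 2 / (x + 1) for x >= 1. *)
Lemma inverse_square_partial_sum n :
  (\sum_(0 <= k < n) ((k.+1%:R ^+ 2)^-1 : R) <= 2 - 2 / n.+1%:R)%R.
Proof.
elim: n => [|n IH]; first by rewrite big_nil divr1 subrr.
rewrite big_nat_recr//=.
have n1 : (0 < n.+1%:R :> R)%R by [].
have x1 : (1 <= n.+1%:R :> R)%R by rewrite ler1n.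
rewrite -[n.+2%:R]natr1; move: (n.+1%:R) (n1) x1 IH => x x0 x1 IH.
have : ((x ^+ 2)^-1 <= 2 / x - 2 / (x + 1))%R.
  have -> : (2 / x - 2 / (x + 1) = 2 / (x * (x + 1)))%R.
    by field; rewrite !gt_eqF// addr_gt0.
  rewrite ler_pdivlMr ?mulr_gt0 ?addr_gt0// mulrC ler_pdivrMr ?exprn_gt0//.
  have := mulr_ge0 (ltW x0) (_ : (0 <= x - 1)%R); rewrite subr_ge0 => /(_ x1).
  by lra.
by lra.
Qed.

Lemma ae_eventually_not (B : (set T)^nat) (C : R) (n0 : nat) :
  (forall n, measurable (B n)) -> (0 <= C)%R ->
  (forall n, (n0 <= n)%N -> P (B n) <= (C / n.+1%:R ^+ 2)%:E) ->
  {ae P, forall w, exists N, forall n, (N <= n)%N -> ~ B n w}.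
Proof.
move=> mB C0 PB.
have V0 n : 0 <= (C / n.+1%:R ^+ 2)%:E by rewrite lee_fin divr_ge0// sqr_ge0.
have sumfin : \sum_(n <oo) P (B n) < +oo.
  rewrite (nneseries_split 0 n0)// add0n lte_add_pinfty//.
    by apply/lte_sum_pinfty => k _; rewrite ltey_eq fin_num_measure.
  rewrite -nneseries_addn//.
  apply: (@le_lt_trans _ _ (2 * C)%:E); last exact: ltry.
  apply: (@le_trans _ _ (\sum_(n <oo) (C / n.+1%:R ^+ 2)%:E)).
    apply: (@le_trans _ _ (\sum_(n <oo) (C / (n + n0).+1%:R ^+ 2)%:E)).
      by apply: lee_nneseries => // n _; apply: PB; exact: leq_addl.
    rewrite (nneseries_addn n0 V0) [leRHS](nneseries_split 0 n0)// add0n leeDr//.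
    exact: sume_ge0.
  apply: lime_le; first exact: is_cvg_nneseries.
  apply: nearW => n; rewrite sumEFin lee_fin -mulr_sumr mulrC ler_wpM2r//.
  by rewrite (le_trans (inverse_square_partial_sum n))// gerBl divr_ge0.
have mL : measurable (lim_sup_set B).
  by apply: bigcap_measurableType => n _; exact: bigcup_measurable.
exists (lim_sup_set B); split => //; first exact: lim_sup_set_cvg0.
move=> w /= nN n _; apply: contrapT => H; apply: nN; exists n => k nk Bk.
by apply: H; exists k.
Qed.

Lemma expRN_le_inverse_square (x : R) : (0 < x)%R -> (expR (- x) <= 4 / x ^+ 2)%R.
Proof.
move=> x0; rewrite expRN -[leRHS]invrK lef_pV2 ?posrE ?expR_gt0//; last first.
  by rewrite invr_gt0 divr_gt0// exprn_gt0.
rewrite invf_div; have -> : (x = x / 2 + x / 2)%R by field.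
have h := expR_ge1Dx (x / 2); rewrite expRD.
apply: le_trans (ler_pM _ _ h h); [by nra|lra|lra].
Qed.

End borel_cantelli_inverse_square.

Section lln_lower.
Context {R : realType} {d : nat} {d0 : measure_display} {Omega : measurableType d0}
  {P : probability Omega R} {l : {sigma_finite_measure set R -> \bar R}}
  {mu : Omega -> {measure set (R * d.-tuple R * R) -> \bar R}}.
Hypothesis prm : poisson_random_measure P (noise_measure d l) mu.
Hypothesis lambda1 : \int[l]_z `|z|%:E < +oo.
Variables (sg : R) (sg1 : (`|sg| = 1)%R).

Let b (z : R) : R := Num.max (sg * z)%R 0%R.

Let b0 z : (0 <= b z)%R. Proof. by rewrite /b le_max lexx orbT. Qed.

Let mb : measurable_fun setT b.
Proof. by apply: measurable_maxr => //; exact: measurable_funM. Qed.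

Let b_le z : (b z <= `|z|)%R.
Proof.
rewrite /b ge_max normr_ge0 andbT (le_trans (ler_norm _))//.
by rewrite normrM sg1 mul1r.
Qed.

Lemma side_integral_fin_num : \int[l]_z (b z)%:E \is a fin_num.
Proof.
rewrite ge0_fin_numE; last by apply: integral_ge0 => z _; rewrite lee_fin.
by apply: le_lt_trans lambda1; apply: ge0_integral_mono => z _; rewrite lee_fin.
Qed.

Definition mean_side : R := fine (\int[l]_z (b z)%:E).

Let mean_sideE : mean_side%:E = \int[l]_z (b z)%:E.
Proof. exact/fineK/side_integral_fin_num. Qed.

Let truncated_mean (e : R) : (0 < e)%R ->
  exists2 K : R, (0 < K)%R & (mean_side - e)%:E < \int[l]_z (Num.min (b z) K)%:E.
Proof.
move=> e0.
have cvgt : \int[l]_z (Num.min (b z) n%:R)%:E @[n --> \oo] --> mean_side%:E.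
  rewrite mean_sideE.
  have -> : \int[l]_z (b z)%:E = \int[l]_z limn (fun n => (Num.min (b z) n%:R)%:E).
    apply: eq_integral => z _; apply/esym/cvg_lim => //.
    apply: cvg_near_cst; exists (Num.trunc (b z)).+1 => // n /= bn; congr EFin.
    apply/min_idPl/ltW; apply: lt_le_trans (truncnS_gt _) _.
    by rewrite ler_nat.
  apply: cvg_monotone_convergence => //.
  - move=> n; apply/measurable_EFinP; exact: measurable_minr.
  - by move=> n z _; rewrite lee_fin le_min b0 ler0n.
  - move=> z _ i j ij; rewrite lee_fin le_min ge_min lexx/= ge_min.
    by rewrite ler_nat ij orbT.
have /fine_cvgP[[N1 _ H1] cvgf] := cvgt.
have me : (mean_side - e < mean_side)%R by rewrite ltrBlDr ltrDl.
have [N2 _ H2] := cvgr_gt _ cvgf _ me.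
pose n := (maxn N1 N2).+1; exists n%:R => //.
have /= := H2 n (leq_trans (leq_maxr _ _) (leqnSn _)).
by rewrite -lte_fin fineK//; apply: H1; rewrite /= (leq_trans (leq_maxl N1 N2)).
Qed.

Section chernoff.
Variables (K a : R) (L : nat).
Hypotheses (K0 : (0 < K)%R) (a0 : (0 <= a)%R) (L0 : (0 < L)%N).
Hypothesis aK : a%:E < \int[l]_z (Num.min (b z) K)%:E.

(** Age at least L >= 1 bounds the kernel by 1, and truncation bounds the size by K, so [phi] is
    bounded by K and Chernoff's exponent can be linearized uniformly. *)
Let phi (n : nat) (q : R * d.-tuple R * R) : R :=
  (window_kernel (n%:R - L%:R) n%:R q.1 * Num.min (b q.2) K)%R.

Let phi0 n q : (0 <= phi n q)%R.
Proof. by rewrite mulr_ge0 ?window_kernel_ge0// le_min b0 ltW. Qed.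

Let phiK n q : (phi n q <= K)%R.
Proof.
rewrite /phi -[leRHS]mul1r ler_pM ?window_kernel_ge0//.
- by rewrite le_min b0 ltW.
- rewrite /window_kernel; case: ifP => // /andP[_ qn].
  apply: heat_kernel_le1; rewrite lerBrDr -lerBrDl (le_trans (ltW qn))//.
  by rewrite lerD2l lerN2 ler1n.
- by rewrite ge_min lexx orbT.
Qed.

Let mphi n : measurable_fun setT (phi n).
Proof.
apply: measurable_funM.
  exact: (measurableT_comp (measurable_window_kernel _ _) measurable_fst).
have mm : measurable_fun setT (fun z => Num.min (b z) K) by exact: measurable_minr.
exact: (measurableT_comp mm measurable_snd).
Qed.

Let mK : R := fine (\int[l]_z (Num.min (b z) K)%:E).

Let mKE : mK%:E = \int[l]_z (Num.min (b z) K)%:E.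
Proof.
rewrite fineK// ge0_fin_numE; last first.
  by apply: integral_ge0 => z _; rewrite lee_fin le_min b0 ltW.
apply: le_lt_trans (_ : \int[l]_z (b z)%:E < +oo); last by rewrite -mean_sideE ltry.
apply: ge0_integral_mono => z _; rewrite lee_fin; first by rewrite le_min b0 ltW.
by rewrite ge_min lexx.
Qed.

Let intphi n : (L <= n)%N ->
  \int[noise_measure d l]_q (phi n q)%:E = ((n%:R - L%:R) * mK)%:E.
Proof.
move=> Ln; rewrite EFinM mKE.
apply: (integral_noise_window_kernel (b := fun z => Num.min (b z) K)).
- by rewrite subr_ge0 ler_nat Ln/= gerBl.
- exact: measurable_minr.
- by move=> z; rewrite le_min b0 ltW.
Qed.

Lemma ae_old_jumps_lower : {ae P, forall w, exists N, forall n : nat, (N <= n)%N ->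
  (a * n%:R)%:E < \int[mu w]_q (phi n q)%:E}.
Proof.
have aK' : (a < mK)%R by rewrite -lte_fin mKE.
have mK0 : (0 < mK)%R by exact: le_lt_trans aK'.
(* With this parameter, (1 - th K) mK is the midpoint of a and mK, leaving a gap (mK - a) / 2 for
   exponential decay in n. *)
pose th := (((mK - a) / 2) / (K * mK))%R.
have th0 : (0 < th)%R by rewrite divr_gt0 ?mulr_gt0// subr_gt0.
have thK : ((1 - th * K) * mK = (mK + a) / 2)%R.
  by rewrite /th; field; rewrite !gt_eqF.
have thK0 : (0 <= 1 - th * K)%R.
  have : (0 < (1 - th * K) * mK)%R by rewrite thK divr_gt0// ltr_pwDl.
  by rewrite pmulr_lgt0// => /ltW.
(* From exp(-x) <= 1 / (1 + x) <= 1 - x + x^2, and x^2 <= x th K on the range of [th * phi]. *)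
have expbound x : (0 <= x)%R -> (x <= th * K)%R -> (x * (1 - th * K) <= 1 - expR (- x))%R.
  move=> x0 xK; have : (expR (- x) <= (1 + x)^-1)%R.
    by rewrite expRN lef_pV2 ?posrE ?expR_gt0 ?expR_ge1Dx// ltr_pwDl.
  have : ((1 + x)^-1 <= 1 - x + x ^+ 2)%R.
    rewrite -[leLHS]mul1r ler_pdivrMr ?ltr_pwDl//.
    have -> : ((1 - x + x ^+ 2) * (1 + x) = 1 + x ^+ 3)%R by ring.
    by rewrite lerDl exprn_ge0.
  have thKx : (x ^+ 2 <= x * (th * K))%R by rewrite expr2 ler_wpM2l.
  by lra.
pose B n := [set w | \int[mu w]_q (phi n q)%:E <= (a * n%:R)%:E].
have mI n : measurable_fun setT (fun w => \int[mu w]_q (phi n q)%:E).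
  apply: (measurable_prm_integral prm) => //; first exact/measurable_EFinP.
  by move=> q; rewrite lee_fin.
have mB n : measurable (B n).
  by rewrite -[X in measurable X]setTI; exact: emeasurable_fun_infty_c.
pose c := (th * ((mK - a) / 2))%R.
have c0 : (0 < c)%R by rewrite mulr_gt0// divr_gt0// subr_gt0.
(* The cost of the L units of time that the old jumps leave out. *)
pose D := (th * L%:R * ((mK + a) / 2))%R.
have PB n : (L <= n)%N -> P (B n) <= (expR (D - c * n%:R))%:E.
  move=> Ln.
  have mthphi : measurable_fun setT (fun q => th * phi n q)%R by exact: measurable_funM.
  have thphi0 q : (0 <= th * phi n q)%R by rewrite mulr_ge0// ltW.
  have mexp : measurable_fun setT (fun q => (1 - expR (- (th * phi n q)))%:E).
    apply/measurable_EFinP; apply: measurable_funB => //.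
    by apply: measurableT_comp => //; exact: measurableT_comp.
  have exp0 q : (0 <= 1 - expR (- (th * phi n q)))%R.
    by rewrite subr_ge0 -expR0 ler_expR oppr_le0.
  have lower : ((th * (1 - th * K)) * ((n%:R - L%:R) * mK))%:E <=
      \int[noise_measure d l]_q (1 - expR (- (th * phi n q)))%:E.
    rewrite EFinM -intphi// -ge0_integralZl_EFin//; last 3 first.
    - by move=> q _; rewrite lee_fin.
    - exact/measurable_EFinP.
    - by rewrite mulr_ge0 ?(ltW th0).
    apply: ge0_le_integral => //.
    - move=> q _; rewrite -EFinM lee_fin mulr_ge0//.
      by rewrite mulr_ge0 ?(ltW th0).
    - by apply: measurable_funeM; exact/measurable_EFinP.
    - move=> q _; rewrite -EFinM lee_fin -mulrA [((1 - _) * _)%R]mulrC mulrA.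
      by apply: expbound => //; rewrite ler_wpM2l// ltW.
  have upper : \int[noise_measure d l]_q (1 - expR (- (th * phi n q)))%:E < +oo.
    apply: (@le_lt_trans _ _ (\int[noise_measure d l]_q (th%:E * (phi n q)%:E))).
      apply: ge0_le_integral => //.
      - by move=> q _; rewrite lee_fin.
      - by apply: measurable_funeM; exact/measurable_EFinP.
      - move=> q _; rewrite -EFinM lee_fin lerBlDr -lerBlDl.
        exact: expR_ge1Dx.
    rewrite ge0_integralZl_EFin//; [|by move=> q _; rewrite lee_fin|exact/measurable_EFinP|exact: ltW].
    by rewrite intphi// -EFinM ltry.
  have lap := prm_laplace_neg prm mthphi thphi0 upper.
  have mE : measurable_fun setT (fun w => expeR (- \int[mu w]_q (th * phi n q)%:E)).
    apply: measurableT_comp; first exact: measurable_expeR.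
    apply: measurableT_comp => //; apply: (measurable_prm_integral prm) => //.
    exact/measurable_EFinP.
  have ineq : (expR (- (th * (a * n%:R))))%:E * P (B n) <=
      \int[P]_w expeR (- \int[mu w]_q (th * phi n q)%:E).
    rewrite -integral_cst//.
    apply: (@le_trans _ _ (\int[P]_(w in B n) expeR (- \int[mu w]_q (th * phi n q)%:E))).
      apply: ge0_le_integral => //.
      - by move=> w _; rewrite lee_fin expR_ge0.
      - exact: measurable_funTS.
      - move=> w; rewrite /B/= => Bw.
        rewrite -[leLHS]/(expeR (- (th * (a * n%:R))%:E)) lee_expeR leeN2.
        under eq_integral do rewrite EFinM.
        rewrite ge0_integralZl_EFin//; last 3 first.
        + by move=> q _; rewrite lee_fin.
        + exact/measurable_EFinP.
        + exact: ltW.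
        by rewrite [leRHS]EFinM lee_pmul2l ?lte_fin.
    by apply: ge0_subset_integral => // w _; exact: expeR_ge0.
  have : (expR (- (th * (a * n%:R))))%:E * P (B n) <=
      (expR (- (th * (1 - th * K) * ((n%:R - L%:R) * mK))))%:E.
    apply: (le_trans ineq); apply: (le_trans lap).
    by rewrite -[leRHS]/(expeR (- _%:E)) lee_expeR leeN2.
  rewrite -lee_pdivlMl ?expR_gt0// => /le_trans; apply.
  rewrite -expRN -EFinM -expRD lee_fin ler_expR opprK.
  have -> : (th * (1 - th * K) * ((n%:R - L%:R) * mK) =
      th * (n%:R - L%:R) * ((1 - th * K) * mK))%R by ring.
  rewrite thK /D /c.
  have -> : (th * (a * n%:R) - th * (n%:R - L%:R) * ((mK + a) / 2) =
    th * L%:R * ((mK + a) / 2) - th * ((mK - a) / 2) * n%:R)%R by field.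
  by [].
have : {ae P, forall w, exists N, forall n, (N <= n)%N -> ~ B n w}.
  apply: (@ae_eventually_not _ _ _ P B (expR (D + c) * 4 / c ^+ 2)%R L) => //.
    by rewrite divr_ge0 ?sqr_ge0// mulr_ge0// expR_ge0.
  move=> n Ln; apply: (le_trans (PB n Ln)); rewrite lee_fin.
  have -> : (D - c * n%:R = D + c + - (c * n.+1%:R))%R by rewrite -natr1; ring.
  have n1 : (0 < n.+1%:R :> R)%R by [].
  rewrite expRD; move: (n.+1%:R) n1 => x x0.
  have -> : (expR (D + c) * 4 / c ^+ 2 / x ^+ 2 = expR (D + c) * (4 / (c * x) ^+ 2))%R.
    by field; rewrite !gt_eqF.
  by rewrite ler_wpM2l ?expR_ge0// expRN_le_inverse_square// mulr_gt0.
apply: filterS => w [N HN]; exists N => n Nn; rewrite ltNge; apply/negP.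
exact: HN.
Qed.

End chernoff.

(** For t in [n, n + 1) and births before n - L, replacing n by t loses at most the factor (1 +
    1/L)^(d/2) on the kernel. A large L makes this factor close to 1, which reduces the claim to the
    integer times of [ae_old_jumps_lower]. *)
Lemma jump_part_lower (e : R) : (0 < e)%R ->
  {ae P, forall w, exists T, forall t, (T <= t)%R ->
    ((mean_side - e) * t)%:E <= jump_part mu sg t w}.
Proof.
move=> e0; have [x0|x0] := leP (mean_side - e)%R 0%R.
  apply: aeW => w; exists 0%R => t t0; apply: le_trans (jump_part_ge0 _ _ _ _).
  by rewrite lee_fin mulr_le0_ge0.
have e2 : (0 < e / 2)%R by rewrite divr_gt0.
have [K K0 HK] := truncated_mean e2.
set x := (mean_side - e)%R in x0 *.
set a := (mean_side - e / 2)%R in HK.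
have xa : (x < a)%R by rewrite /x /a; lra.
have a0 : (0 <= a)%R by lra.
pose x' := ((a + x) / 2)%R.
have xx' : (x < x')%R by rewrite /x'; lra.
have x'0 : (0 < x')%R by exact: lt_trans xx'.
have x'a : (x' < a)%R by rewrite /x'; lra.
have ln0 : (0 < ln (x' / x))%R by rewrite ln_gt0// ltr_pdivlMr// mul1r.
(* Large enough for (1 + 1/L)^d <= exp(d / L) <= x' / x. The remaining room between x' and a absorbs
   the step from n to n + 1. *)
pose L := (Num.trunc (d%:R / ln (x' / x))).+1.
have L0 : (0 < L%:R :> R)%R by rewrite ltr0n.
pose rho := ((1 + L%:R^-1) `^ (d%:R / 2) : R)%R.
have L1 : (1 <= 1 + L%:R^-1 :> R)%R by rewrite lerDl invr_ge0.
have rho0 : (0 < rho)%R by rewrite powR_gt0// (lt_le_trans ltr01).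
have rhox : (rho * x <= x')%R.
  rewrite -ler_pdivlMr//; apply: (@le_trans _ _ ((1 + L%:R^-1) `^ d%:R)%R).
    by apply: ler_powR => //; rewrite ler_pdivrMr// ler_peMr// ler1n.
  rewrite powR_mulrn ?addr_ge0 ?invr_ge0//.
  apply: (@le_trans _ _ (expR (L%:R^-1) ^+ d)%R).
    by rewrite lerXn2r ?nnegrE ?expR_ge0 ?addr_ge0 ?invr_ge0// expR_ge1Dx.
  rewrite -expRM_natl -[leRHS]lnK ?posrE; last by rewrite divr_gt0.
  rewrite ler_expR ler_pdivrMr// mulrC -ler_pdivrMr// ltW//.
  exact: truncnS_gt.
have HL := ae_old_jumps_lower K0 a0 (ltn0Sn _ : (0 < L)%N) HK.
apply: filterS HL => w [N HN].
exists (Num.max (maxn N L).+1%:R (x' / (a - x') + 1))%R => t.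
rewrite ge_max => /andP[tN tx].
have t0 : (0 <= t)%R by exact: le_trans tN.
have /andP[nt tn] := truncn_itv t0; set n := Num.trunc t in nt tn.
have NLn : (maxn N L <= n)%N.
  by rewrite -ltnS -(ltr_nat R); apply: le_lt_trans tn; apply: le_trans tN; rewrite ler_nat.
have Nn : (N <= n)%N by exact: leq_trans (leq_maxl _ _) NLn.
have Ln : (L <= n)%N by exact: leq_trans (leq_maxr _ _) NLn.
have := HN n Nn; rewrite -/(_ * _)%R => HNn.
have tn1 : (t <= n%:R + 1)%R by rewrite natr1 ltW.
have nbig : (x' <= n%:R * (a - x'))%R.
  rewrite -ler_pdivrMr ?subr_gt0//; move: tx; lra.
apply: (@le_trans _ _ ((rho^-1)%:E * (a * n%:R)%:E)).
  rewrite -EFinM lee_fin ler_pdivlMl//.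
  apply: (@le_trans _ _ (x' * (n%:R + 1))%R); last by lra.
  by rewrite mulrA; apply: ler_pM => //; rewrite mulr_ge0// ltW.
apply: (@le_trans _ _ ((rho^-1)%:E * \int[mu w]_q (window_kernel (n%:R - L%:R) n%:R q.1 *
    Num.min (b q.2) K)%:E)).
  by rewrite lee_pmul2l ?lte_fin ?invr_gt0// ltW.
rewrite -ge0_integralZl_EFin//; last 3 first.
- by move=> q _; rewrite lee_fin mulr_ge0 ?window_kernel_ge0// le_min b0 ltW.
- apply/measurable_EFinP; apply: measurable_funM.
    exact: (measurableT_comp (measurable_window_kernel _ _) measurable_fst).
  have mm : measurable_fun setT (fun z => Num.min (b z) K) by exact: measurable_minr.
  exact: (measurableT_comp mm measurable_snd).
- by rewrite invr_ge0 ltW.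
apply: ge0_le_integral => //.
- move=> q _; rewrite -EFinM lee_fin !mulr_ge0 ?window_kernel_ge0// ?invr_ge0 ?(ltW rho0)//.
  by rewrite le_min b0 ltW.
- apply: measurable_funeM; apply/measurable_EFinP; apply: measurable_funM.
    exact: (measurableT_comp (measurable_window_kernel _ _) measurable_fst).
  have mm : measurable_fun setT (fun z => Num.min (b z) K) by exact: measurable_minr.
  exact: (measurableT_comp mm measurable_snd).
- apply/measurable_EFinP; apply: measurable_funM.
    exact: (measurableT_comp (measurable_window_kernel _ _) measurable_fst).
  exact: (measurableT_comp mb measurable_snd).
- move=> q _; rewrite -EFinM lee_fin mulrA; apply: ler_pM.
  + by rewrite mulr_ge0 ?window_kernel_ge0// invr_ge0 ltW.
  + by rewrite le_min b0 ltW.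
  + rewrite /window_kernel; case: ifPn => [/andP[q0 qn]|_]; last first.
      by rewrite mulr0; case: ifP => // _; exact: heat_kernel_ge0.
    have L1' : (1 <= L%:R :> R)%R by rewrite ler1n.
    have qnn : (q.1.1 < n%:R)%R by lra.
    have -> : (0 < q.1.1 < t)%R by rewrite q0 (lt_le_trans qnn).
    rewrite mulrC ler_pdivrMr// mulrC.
    have nq0 : (0 < n%:R - q.1.1)%R by rewrite subr_gt0.
    apply: le_trans (heat_kernel_time _ nq0 (_ : n%:R - q.1.1 <= t - q.1.1)%R) _.
      by rewrite lerD2r.
    apply: ler_wpM2r; first exact: heat_kernel_ge0.
    apply: ge0_ler_powR => //; rewrite ?nnegrE.
    + by rewrite divr_ge0// ?subr_ge0 ltW// (lt_le_trans qnn).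
    + by rewrite addr_ge0// invr_ge0.
    + rewrite ler_pdivrMr// mulrDl mul1r.
      have : (1 <= L%:R^-1 * (n%:R - q.1.1))%R.
        by rewrite mulrC ler_pdivlMr// mul1r; lra.
      by lra.
  + by rewrite ge_min lexx.
Qed.

Let mjp t : measurable_fun setT (jump_part mu sg t).
Proof.
apply: (measurable_prm_integral prm) => //.
- apply/measurable_EFinP; apply: measurable_funM.
    exact: (measurableT_comp (measurable_window_kernel _ _) measurable_fst).
  exact: (measurableT_comp mb measurable_snd).
- by move=> q; rewrite lee_fin mulr_ge0 ?window_kernel_ge0//; exact: b0.
Qed.

Lemma jump_part_expectation (t : R) : (0 <= t)%R ->
  \int[P]_w jump_part mu sg t w = (t * mean_side)%:E.
Proof.
move=> t0; have tt : (0 <= t <= t)%R by rewrite t0 lexx.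
rewrite EFinM mean_sideE -(integral_noise_window_kernel (d := d) tt mb b0).
have := campbell (P := P) (nu := noise_measure d l) (mu := mu) (G := setT) (S := setT)
  (phi := fun q => (window_kernel t t q.1 * b q.2)%:E) prm measurableT measurableT.
rewrite probability_setT !mul1e; apply.
- by move=> B mB _; rewrite mul1e; exact: (prm_mean prm).
- apply/measurable_EFinP; apply: measurable_funM.
    exact: (measurableT_comp (measurable_window_kernel _ _) measurable_fst).
  exact: (measurableT_comp mb measurable_snd).
- by move=> q; rewrite lee_fin mulr_ge0 ?window_kernel_ge0//; exact: b0.
Qed.

Lemma jump_part_upper (e : R) : (0 < e)%R ->
  {ae P, forall w, forall N : nat, exists t, [/\ (N%:R <= t)%R, (0 < t)%R &
    jump_part mu sg t w <= ((mean_side + e) * t)%:E]}.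
Proof.
move=> e0; apply: ae_foralln => N.
(* Times start at 1, so that the division is by a positive number. *)
pose f n w := (n.+1%:R^-1)%:E * jump_part mu sg n.+1%:R w.
have mf n : measurable_fun setT (f n) by exact: measurable_funeM.
have f0 n w : 0 <= f n w by rewrite mule_ge0 ?jump_part_ge0.
pose D := \bigcap_(n in [set n | (N <= n)%N]) [set w | (mean_side + e)%:E < f n w].
have mD : measurable D.
  apply: bigcap_measurableType => n _.
  by rewrite -[X in measurable X]setTI; exact: emeasurable_fun_o_infty.
have ms0 : (0 <= mean_side)%R.
  by apply: fine_ge0; apply: integral_ge0 => z _; rewrite lee_fin.
pose G w := limn_einf (f^~ w).
have G_ge c w N' : (forall n, (N' <= n)%N -> c <= f n w) -> c <= G w.
  move=> H; rewrite /G /limn_einf -/(limf_einf (f^~ w) \oo) limf_einfE.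
  apply: (@le_trans _ _ (ereal_inf [set f n w | n in [set n | (N' <= n)%N]])).
    by apply: le_ereal_inf_tmp => _ [n /= Nn <-]; exact: H.
  by apply: ereal_sup_ubound; exists [set n | (N' <= n)%N] => //; exists N'.
have lb : {ae P, forall w, forall k, exists T, forall t, (T <= t)%R ->
    ((mean_side - k.+1%:R^-1) * t)%:E <= jump_part mu sg t w}.
  by apply: ae_foralln => k; apply: jump_part_lower.
have mG : measurable_fun setT G.
  rewrite /G /limn_einf; apply: measurableT_comp => //.
  apply: (@measurable_fun_limn_esup _ _ _ setT (fun n w => - f n w)) => n.
  exact: measurableT_comp.
(* The lower limit is a.s. at least [mean_side] by [jump_part_lower], and is at least e more on D,
   where the averages stay high from N on. *)
have GD : {ae P, forall w, (mean_side%:E + e%:E * (\1_D w)%:E) <= G w}.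
  apply: filterS lb => w lbw.
  rewrite indicE; case: (boolP (w \in D)) => wD.
    rewrite mule1; apply: (G_ge _ _ N) => n Nn; rewrite -EFinD ltW//.
    by move: wD; rewrite inE; exact.
  rewrite mule0 adde0; apply/lee_addgt0Pr => c cp.
  pose k := Num.trunc (c^-1)%R; have [T HT] := lbw k.
  rewrite -leeBlDr//.
  apply: (G_ge _ _ (Num.trunc `|T|).+1) => n Tn.
  apply: (@le_trans _ _ (mean_side - k.+1%:R^-1)%:E).
    rewrite -EFinB lee_fin lerD2l lerN2 invf_ple ?posrE// ltW//.
    exact: truncnS_gt.
  rewrite /f lee_pdivlMl// -EFinM mulrC; apply: HT.
  rewrite (le_trans (ler_norm _))// ltW// (lt_le_trans (truncnS_gt _))// ler_nat.
  exact: leqW.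
have G0 w : 0 <= G w by apply: (G_ge _ _ 0%N).
have PD : P D = 0.
  have fa : \int[P]_w G w <= mean_side%:E.
    apply: le_trans (fatou P measurableT mf (fun n w _ => f0 n w)) _.
    rewrite (_ : (fun n => \int[P]_w f n w) = cst mean_side%:E); last first.
      apply/funext => n; rewrite /f ge0_integralZl//; last first.
        by move=> w _; exact: jump_part_ge0.
      by rewrite jump_part_expectation// -EFinM mulrA mulVf// mul1r.
    by rewrite (cvg_limn_einf_sup (cvg_cst _)).
  (* Integrating [GD] and applying Fatou gives [mean_side] + e P(D) <= [mean_side], hence P(D) =
     0. *)
  have : \int[P]_w (mean_side%:E + e%:E * (\1_D w)%:E) <= mean_side%:E.
    apply: le_trans fa; apply: ae_ge0_le_integral => //.
    - by move=> w _; rewrite adde_ge0 ?mule_ge0// lee_fin// ltW.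
    - apply: emeasurable_funD => //; apply: measurable_funeM.
      exact/measurable_EFinP.
    - by apply: filterS GD.
  rewrite ge0_integralD//; last 2 first.
  - by move=> w _; rewrite mule_ge0// lee_fin// ltW.
  - by apply: measurable_funeM; exact/measurable_EFinP.
  rewrite integral_cst// (_ : _ [set: Omega] = 1) ?mule1; last exact: (@probability_setT _ _ _ P).
  rewrite ge0_integralZl_EFin//; [|exact/measurable_EFinP|exact: ltW].
  rewrite integral_indic// setIT.
  rewrite -leeBrDl// subee// => eP.
  apply/eqP; rewrite eq_le measure_ge0 andbT -(@lee_pmul2l _ e%:E) ?lte_fin//.
  by rewrite mule0.
have negD : P.-negligible D by exists D; split.
apply: negligibleS negD => w /= nH n /= Nn; rewrite ltNge; apply/negP => fn.
apply: nH; exists n.+1%:R; split => //; first by rewrite ler_nat leqW.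
by move: fn; rewrite /f lee_pdivrMl// -EFinM mulrC.
Qed.

End lln_lower.

(** * Chernoff bounds and domination by dyadic times *)

Section exponential_bounds.
Context {R : realType}.
Local Open Scope ring_scope.

Lemma expR_sub1_le (x : R) : expR x - 1 <= x * expR x.
Proof.
have h : (1 - x) * expR x <= 1.
  rewrite -ler_pdivlMr ?expR_gt0// div1r -expRN.
  by have := expR_ge1Dx (- x).
by lra.
Qed.

(** Applying [expR_sub1_le] twice gives x + x^2 exp(x), and x^2 <= x^(1+s) for x <= 1; for x > 1 use
    x <= x^(1+s). The linear term then needs only the first moment of the jumps, and the rest the
    moment of order 1 + s. *)
Lemma expR_sub1_le_powR (s x : R) : 0 <= s -> s <= 1 -> 0 <= x ->
  expR x - 1 <= x + x `^ (1 + s) * expR x.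
Proof.
move=> s0 s1 x0; have ex0 := expR_ge0 x; have h := expR_sub1_le x.
have [x1|x1] := leP x 1.
  have [->|xn0] := eqVneq x 0.
    by rewrite expR0 subrr add0r mulr_ge0// powR_ge0.
  have xp : 0 < x by rewrite lt_def xn0.
  have : x ^+ 2 <= x `^ (1 + s).
    rewrite -powR_mulrn//; apply: ger_powR; first by rewrite xp.
    by lra.
  have hx : x * (expR x - 1) <= x * (x * expR x) by rewrite ler_wpM2l.
  move=> /(fun H => ler_wpM2r ex0 H); rewrite expr2; lra.
have : x <= x `^ (1 + s) by apply: le1r_powR; [exact: ltW|lra].
move=> /(fun H => ler_wpM2r ex0 H); lra.
Qed.

End exponential_bounds.

Section chernoff_upper.
Context {R : realType} {d0 : measure_display} {Omega : measurableType d0}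
  {P : probability Omega R} {d1 : measure_display} {E : measurableType d1}
  {nu : {measure set E -> \bar R}} {mu : Omega -> {measure set E -> \bar R}}.
Hypothesis prm : poisson_random_measure P nu mu.

Lemma prm_chernoff_upper (phi : E -> R) (th x B : R) :
  measurable_fun setT phi -> (forall q, (0 <= phi q)%R) -> (0 < th)%R ->
  \int[nu]_q (expR (th * phi q) - 1)%:E <= B%:E ->
  P [set w | x%:E <= \int[mu w]_q (phi q)%:E] <= (expR (B - th * x))%:E.
Proof.
move=> mphi phi0 th0 hB.
have mth : measurable_fun setT (fun q => th * phi q)%R by exact: measurable_funM.
have th_ge0 q : (0 <= th * phi q)%R by rewrite mulr_ge0// ltW.
have lap := prm_laplace_pos prm mth th_ge0.
have mI : measurable_fun setT (fun w => \int[mu w]_q (phi q)%:E).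
  apply: (measurable_prm_integral prm) => //; exact/measurable_EFinP.
have mI' : measurable_fun setT (fun w => expeR (\int[mu w]_q (th * phi q)%:E)).
  apply: measurableT_comp; first exact: measurable_expeR.
  apply: (measurable_prm_integral prm) => //; exact/measurable_EFinP.
set D := [set w | _]; have mD : measurable D.
  by rewrite -[X in measurable X]setTI; exact: emeasurable_fun_c_infty.
have : (expR (th * x))%:E * P D <= (expR B)%:E.
  apply: (@le_trans _ _ (\int[P]_w expeR (\int[mu w]_q (th * phi q)%:E))); last first.
    by rewrite (le_trans lap)// -[leRHS]/(expeR B%:E) lee_expeR.
  rewrite -integral_cst//.
  apply: (@le_trans _ _ (\int[P]_(w in D) expeR (\int[mu w]_q (th * phi q)%:E))).
    apply: ge0_le_integral => //.
    - by move=> w _; rewrite lee_fin expR_ge0.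
    - exact: measurable_funTS.
    - move=> w; rewrite /D/= => Dw.
      rewrite -[leLHS]/(expeR (th * x)%:E) lee_expeR.
      under eq_integral do rewrite EFinM.
      rewrite ge0_integralZl_EFin//; last 3 first.
      + by move=> q _; rewrite lee_fin.
      + exact/measurable_EFinP.
      + exact: ltW.
      by rewrite EFinM lee_pmul2l ?lte_fin.
  by apply: ge0_subset_integral => // w _; exact: expeR_ge0.
rewrite -lee_pdivlMl ?expR_gt0// => /le_trans; apply.
by rewrite -expRN -EFinM -expRD lee_fin ler_expR addrC.
Qed.

End chernoff_upper.

Section lebesgue_ball.
Context {R : realType} {d : nat}.

Lemma measurable_enorm_le (x : R) : measurable [set y : d.-tuple R | (enorm y ^+ d <= x)%R].
Proof.
rewrite (_ : [set _ | _] = (fun y : d.-tuple R => enorm y ^+ d)%R @^-1` `]-oo, x]%classic); last first.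
  by apply/seteqP; split => y /=; rewrite in_itv.
rewrite -[X in measurable X]setTI.
have mf : measurable_fun setT (fun y : d.-tuple R => enorm y ^+ d)%R.
  by apply: measurable_funX; exact: measurable_enorm.
exact: mf.
Qed.

(** The ball lies in the cube of half-side x^(1/d). The radius enters through its d-th power because
    [near] is described that way. *)
Lemma lebesgue_tuple_ball_le (x : R) : (0 < d)%N -> (0 <= x)%R ->
  @lebesgue_tuple R d [set y | (enorm y ^+ d <= x)%R] <= (2 ^+ d * x)%:E.
Proof.
move=> d_gt0 x0; pose s := (x `^ (d%:R^-1))%R.
have s0 : (0 <= s)%R by exact: powR_ge0.
have sd : (s ^+ d = x)%R.
  by rewrite -powR_mulrn// -powRrM mulVf ?powRr1// pnatr_eq0 -lt0n.
have mbox : measurable [set y : d.-tuple R | forall i, `[(- s)%R, s]%classic (tnth y i)].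
  rewrite (_ : [set v | _] = \bigcap_(i in setT) ((fun y => tnth y i) @^-1` `[(- s)%R, s]%classic)); last first.
    by apply/seteqP; split => [y /= Av i _|y /= Av i]; exact: Av.
  apply: fin_bigcap_measurable => // i _; rewrite -[X in measurable X]setTI.
  exact: (measurable_tnth i).
apply: (@le_trans _ _ (@lebesgue_tuple R d
    [set y | forall i, `[(- s)%R, s]%classic (tnth y i)])).
  apply: le_measure; rewrite ?inE//; first exact: measurable_enorm_le.
  move=> y /= yx i; rewrite in_itv/= -ler_norml.
  have ys : (enorm y <= s)%R.
    by rewrite -(ler_pXn2r d_gt0) ?nnegrE ?enorm_ge0// sd.
  apply: le_trans ys; rewrite -ler_sqr ?nnegrE ?enorm_ge0//.
  rewrite enorm_sqr real_normK ?num_real// (bigD1 i)//= lerDl.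
  by apply: sumr_ge0 => j _; exact: sqr_ge0.
rewrite lebesgue_tuple_box// lebesgue_measure_itv/= lte_fin.
case: ltP => [_|ss].
  have -> : s%:E - (- s)%:E = (2 * s)%:E by rewrite -EFinB opprK; congr EFin; ring.
  by rewrite -EFin_expe exprMn sd.
by rewrite -[X in X ^+ d]/(0%:E) -EFin_expe expr0n gtn_eqF// lee_fin mulr_ge0// exprn_ge0.
Qed.

End lebesgue_ball.

Section dyadic_kernel.
Context {R : realType} {d : nat}.
Hypothesis hd : (0 < d)%N.

(* At time scales at most [2], the kernel is dominated by the sum of its values
   at dyadic times. *)
Definition dyadic_time (j : nat) : R := (2 * 2^-1 ^+ j)%R.

Definition dyadic_kernel (y : d.-tuple R) : \bar R :=
  \sum_(j <oo) (heat_kernel (dyadic_time j) y)%:E.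

Let dt0 j : (0 < dyadic_time j)%R.
Proof. by rewrite mulr_gt0// exprn_gt0. Qed.

(** Some dyadic time lies in [u, 2 u], and [heat_kernel_time] compares the two kernels at the price
    of 2^(d/2). *)
Lemma heat_kernel_le_dyadic (u : R) (y : d.-tuple R) : (0 < u)%R -> (u <= 2)%R ->
  (heat_kernel u y)%:E <= (2 `^ (d%:R / 2))%:E * dyadic_kernel y.
Proof.
move=> u0 u2.
have [j uj juj] : exists2 j, (u <= dyadic_time j)%R & (dyadic_time j <= 2 * u)%R.
  have exk : exists k, (dyadic_time k <= 2 * u)%R.
    exists (Num.trunc u^-1).+1; rewrite /dyadic_time ler_pM2l//.
    rewrite exprVn invf_ple ?posrE ?exprn_gt0//.
    apply: (le_trans (ltW (truncnS_gt _))).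
    by rewrite -natrX ler_nat ltnW// ltn_expl.
  case: (ex_minnP exk) => -[|k] hk hmin; first by exists 0%N; rewrite // /dyadic_time expr0 mulr1.
  exists k.+1 => //; rewrite leNgt; apply/negP => ku.
  have : (dyadic_time k <= 2 * u)%R.
    by move: ku; rewrite /dyadic_time exprS; lra.
  by move=> /hmin; rewrite ltnn.
apply: (@le_trans _ _ ((2 `^ (d%:R / 2))%:E * (heat_kernel (dyadic_time j) y)%:E)).
  rewrite -EFinM lee_fin (le_trans (heat_kernel_time y u0 uj))//.
  rewrite ler_wpM2r ?heat_kernel_ge0// ge0_ler_powR ?nnegrE ?divr_ge0// ?(ltW (dt0 _))// ?(ltW u0)//.
  by rewrite ler_pdivrMr.
apply: lee_pmul => //; first by rewrite lee_fin heat_kernel_ge0.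
rewrite /dyadic_kernel (nneseriesD1 (n := j))//; last first.
  by move=> k _; rewrite lee_fin heat_kernel_ge0.
by rewrite leeDl// nneseries_ge0// => k _ _; rewrite lee_fin heat_kernel_ge0.
Qed.

Lemma measurable_dyadic_kernel : measurable_fun setT dyadic_kernel.
Proof.
apply: ge0_emeasurable_sum => [k y _ _|k _]; first by rewrite lee_fin heat_kernel_ge0.
by apply/measurable_EFinP; exact: measurable_heat_kernel1.
Qed.

Lemma dyadic_kernel_ge0 y : 0 <= dyadic_kernel y.
Proof. by apply: nneseries_ge0 => k _ _; rewrite lee_fin heat_kernel_ge0. Qed.

End dyadic_kernel.

Section geometric_split.
Context {R : realType}.

(** The constant bound serves for the first k terms and the geometric one for the rest; k stays free
    for a later optimization. *)
Lemma nneseries_min_geometric (u : nat -> \bar R) (c B rho : R) (k : nat) :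
  (forall j, 0 <= u j) -> (0 <= c)%R -> (0 <= B)%R -> (0 < rho)%R -> (rho < 1)%R ->
  (forall j, u j <= c%:E) -> (forall j, u j <= (B * rho ^+ j)%:E) ->
  \sum_(j <oo) u j <= (c * k%:R + B / (1 - rho) * rho ^+ k)%:E.
Proof.
move=> u0 c0 B0 rho0 rho1 uc uB.
have V0 j : 0 <= (B * rho ^+ k * rho ^+ j)%:E.
  by rewrite lee_fin !mulr_ge0// exprn_ge0// ltW.
rewrite (nneseries_split 0 k)// add0n EFinD; apply: leeD.
  apply: (@le_trans _ _ (\sum_(0 <= j < k) c%:E)); first exact: lee_sum.
  by rewrite sumEFin sumr_const_nat subn0 mulr_natr.
rewrite -nneseries_addn//.
apply: (@le_trans _ _ (\sum_(j <oo) (B * rho ^+ k * rho ^+ j)%:E)).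
  apply: lee_nneseries => // j _; apply: le_trans (uB _) _.
  by rewrite lee_fin exprD mulrA mulrAC.
apply: lime_le; first exact: is_cvg_nneseries.
apply: nearW => n; rewrite sumEFin lee_fin -mulr_sumr.
have r1 : (0 < 1 - rho)%R by rewrite subr_gt0.
have -> : (B / (1 - rho) * rho ^+ k = B * rho ^+ k * (1 - rho)^-1)%R by rewrite mulrAC.
rewrite ler_wpM2l ?mulr_ge0 ?exprn_ge0 ?(ltW rho0)//.
rewrite -[leRHS]div1r ler_pdivlMr//.
have -> : ((\sum_(0 <= i < n) rho ^+ i) * (1 - rho) = 1 - rho ^+ n)%R.
  elim: n => [|n IH]; first by rewrite big_nil mul0r expr0 subrr.
  by rewrite big_nat_recr//= mulrDl IH exprS; ring.
by rewrite gerBl exprn_ge0// ltW.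
Qed.

End geometric_split.

Section dyadic_kernel_truncation.
Context {R : realType} {d : nat}.
Hypothesis hd : (0 < d)%N.
Local Notation dyadic_kernel := (@dyadic_kernel R d).
Local Notation dyadic_time := (@dyadic_time R).

Let dt0 j : (0 < dyadic_time j)%R.
Proof. by rewrite mulr_gt0// exprn_gt0. Qed.

(** The root of the kernel at a dyadic time has integral of order that time to the power d/4, which
    is geometric with this ratio. *)
Let rho : R := (2^-1 `^ (d%:R / 4))%R.

Let rho0 : (0 < rho)%R. Proof. by rewrite powR_gt0. Qed.

Let rho1 : (rho < 1)%R.
Proof.
have d4 : (0 < d%:R / 4 :> R)%R by rewrite divr_gt0// ltr0n.
have h : (0 < (2^-1 : R) < 1)%R by lra.
by rewrite /rho /powR gt_eqF// -[ltRHS]expR0 ltr_expR pmulr_rlt0 ?ln_lt0.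
Qed.

Let C4 : R := ((8 * pi) `^ (d%:R / 4) * 2 `^ (d%:R / 2))%R.

Let trunc_integral_le_mass (c b : R) j : (0 <= c)%R -> (0 <= b)%R ->
  \int[@lebesgue_tuple R d]_y (Num.min (c * heat_kernel (dyadic_time j) y) b)%:E <= c%:E.
Proof.
move=> c0 b0.
have mh : measurable_fun setT (fun y : d.-tuple R => c * heat_kernel (dyadic_time j) y)%R.
  by apply: measurable_funM => //; exact: measurable_heat_kernel1.
apply: (@le_trans _ _ (\int[@lebesgue_tuple R d]_y
    (c%:E * (heat_kernel (dyadic_time j) y)%:E))).
  apply: ge0_integral_mono => y _.
    by rewrite lee_fin le_min b0 mulr_ge0// heat_kernel_ge0.
  by rewrite -EFinM lee_fin ge_min lexx.
rewrite ge0_integralZl_EFin//; last 2 first.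
- by move=> y _; rewrite lee_fin heat_kernel_ge0.
- by apply/measurable_EFinP; exact: measurable_heat_kernel1.
by rewrite integral_heat_kernel// mule1.
Qed.

(* [min x b <= sqrt (x b)], and the square root of a heat kernel is a multiple
   of the heat kernel at twice the time. *)
Let trunc_integral_le_sqrt (c b : R) j : (0 <= c)%R -> (0 <= b)%R ->
  \int[@lebesgue_tuple R d]_y (Num.min (c * heat_kernel (dyadic_time j) y) b)%:E <=
  (Num.sqrt (c * b) * C4 * rho ^+ j)%:E.
Proof.
move=> c0 b0.
have mh : measurable_fun setT (fun y : d.-tuple R => c * heat_kernel (dyadic_time j) y)%R.
  by apply: measurable_funM => //; exact: measurable_heat_kernel1.
pose A := ((4 * pi * dyadic_time j) `^ (d%:R / 4) * 2 `^ (d%:R / 2) : R)%R.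
have A0 : (0 <= A)%R by rewrite mulr_ge0// powR_ge0.
have -> : (Num.sqrt (c * b) * C4 * rho ^+ j = Num.sqrt (c * b) * A)%R.
  rewrite -mulrA; congr (_ * _)%R; rewrite /C4 /A mulrAC; congr (_ * _)%R.
  have -> : (4 * pi * dyadic_time j = 8 * pi * 2^-1 ^+ j)%R by rewrite /dyadic_time; ring.
  rewrite (@powRM _ (8 * pi) (2^-1 ^+ j)); last 2 first.
  - by rewrite mulr_ge0// pi_ge0.
  - by rewrite exprn_ge0.
  congr (_ * _)%R.
  have -> : (2^-1 ^+ j = 2^-1 `^ j%:R :> R)%R by rewrite powR_mulrn.
  by rewrite -(@powR_mulrn _ rho j (ltW rho0)) /rho -!powRrM mulrC.
apply: (@le_trans _ _ (\int[@lebesgue_tuple R d]_y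
    ((Num.sqrt (c * b) * A)%:E * (heat_kernel (2 * dyadic_time j) y)%:E))).
  apply: ge0_integral_mono => y _.
  - by rewrite lee_fin le_min b0 mulr_ge0// heat_kernel_ge0.
  - rewrite -EFinM lee_fin -mulrA -sqrt_heat_kernel//.
    have h0 := heat_kernel_ge0 (dyadic_time j) y.
    rewrite -sqrtrM ?mulr_ge0// mulrAC.
    set x := (c * _)%R; have x0 : (0 <= x)%R by rewrite mulr_ge0.
    have m0 : (0 <= Num.min x b)%R by rewrite le_min x0.
    rewrite -[leLHS]ger0_norm// -sqrtr_sqr ler_wsqrtr// expr2.
    by apply: ler_pM => //; rewrite ge_min lexx ?orbT.
rewrite ge0_integralZl_EFin//; last 3 first.
- by move=> y _; rewrite lee_fin heat_kernel_ge0.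
- by apply/measurable_EFinP; exact: measurable_heat_kernel1.
- by rewrite mulr_ge0// sqrtr_ge0.
by rewrite integral_heat_kernel ?mule1// mulr_gt0.
Qed.

Lemma trunc_dyadic_kernel_le (c b : R) (k : nat) : (0 <= c)%R -> (0 <= b)%R ->
  \int[@lebesgue_tuple R d]_y Order.min (c%:E * dyadic_kernel y) b%:E <=
  (c * k%:R + Num.sqrt (c * b) * C4 / (1 - rho) * rho ^+ k)%:E.
Proof.
move=> c0 b0.
pose a j (y : d.-tuple R) : R := Num.min (c * heat_kernel (dyadic_time j) y)%R b.
have a0 j y : (0 <= a j y)%R by rewrite le_min b0 mulr_ge0// heat_kernel_ge0.
have ma j : measurable_fun setT (a j).
  apply: measurable_minr => //.
  by apply: measurable_funM => //; exact: measurable_heat_kernel1.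
apply: (@le_trans _ _ (\int[@lebesgue_tuple R d]_y \sum_(j <oo) (a j y)%:E)).
  apply: ge0_integral_mono => y _.
  - by rewrite le_min lee_fin b0 mule_ge0// dyadic_kernel_ge0.
  (* Either one term alone reaches b and its truncation already equals b, or no term is
     truncated. *)
  - have [[j bj]|nb] := pselect (exists j, b <= c * heat_kernel (dyadic_time j) y)%R.
      rewrite ge_min; apply/orP; right; rewrite (nneseriesD1 (n := j))//; last first.
        by move=> i _; rewrite lee_fin.
      rewrite {1}/a (min_idPr bj) leeDl// nneseries_ge0// => i _ _.
      by rewrite lee_fin.
    rewrite ge_min; apply/orP; left.
    rewrite /dyadic_kernel -nneseriesZle//; last by move=> i; rewrite lee_fin heat_kernel_ge0.
    apply: lee_nneseries => i _; first by move=> _; rewrite mule_ge0// lee_fin heat_kernel_ge0.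
    rewrite -EFinM lee_fin /a le_min lexx/= leNgt; apply/negP => bi; apply: nb.
    by exists i; exact: ltW.
rewrite integral_nneseries//; last 2 first.
- by move=> j; exact/measurable_EFinP.
- by move=> j y _; rewrite lee_fin.
apply: nneseries_min_geometric => //.
- by move=> j; apply: integral_ge0 => y _; rewrite lee_fin.
- by rewrite mulr_ge0 ?sqrtr_ge0// mulr_ge0// powR_ge0.
- by move=> j; exact: trunc_integral_le_mass.
- by move=> j; exact: trunc_integral_le_sqrt.
Qed.

(** The dependence on the jump size that remains once time and space are integrated out; the
    logarithm is felt at small jumps only. *)
Definition log_weight (z : R) : R :=
  (`|z| + (if `|z| <= 1 then `|z * ln `|z| | else 0))%R.

Lemma log_weight_ge0 z : (0 <= log_weight z)%R.
Proof. by rewrite addr_ge0//; case: ifP. Qed.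

Let expand_le (a e f s w : R) : (0 <= a -> 0 <= e -> 0 <= f -> 0 <= s -> 0 <= w ->
  a + e * w + f * s <= (a + e + f) * (1 + w + s))%R.
Proof.
move=> a0 e0 f0 s0 w0.
have h1 := mulr_ge0 a0 s0; have h2 := mulr_ge0 a0 w0.
have h3 := mulr_ge0 e0 s0; have h4 := mulr_ge0 f0 w0.
by clear -h1 h2 h3 h4 a0 e0 f0; lra.
Qed.

Lemma trunc_dyadic_kernel_log : exists2 C : R, (0 <= C)%R & forall b z : R, (0 <= b)%R ->
  \int[@lebesgue_tuple R d]_y
    Order.min ((2 `^ (d%:R / 2) * `|z|)%:E * dyadic_kernel y) b%:E <=
  (C * (1 + Num.sqrt b) * log_weight z)%:E.
Proof.
pose c2 : R := (2 `^ (d%:R / 2))%R.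
have c20 : (0 <= c2)%R by exact: powR_ge0.
pose L : R := (- ln rho)%R.
have L0 : (0 < L)%R by rewrite oppr_gt0 ln_lt0// rho0.
pose D : R := (Num.sqrt c2 * C4 / (1 - rho))%R.
have D0 : (0 <= D)%R.
  by rewrite divr_ge0 ?mulr_ge0 ?sqrtr_ge0 ?powR_ge0// subr_ge0 ltW.
exists (c2 + c2 / (2 * L) + D)%R.
  by rewrite !addr_ge0// divr_ge0// mulr_ge0// ltW.
move=> b z b0; have sb0 := sqrtr_ge0 b.
have E0 : (0 <= c2 / (2 * L))%R by rewrite divr_ge0// mulr_ge0// ltW.
have c0 : (0 <= c2 * `|z|)%R by rewrite mulr_ge0.
have split k : \int[@lebesgue_tuple R d]_y
    Order.min ((c2 * `|z|)%:E * dyadic_kernel y) b%:E <=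
    (c2 * `|z| * k%:R + D * Num.sqrt b * (Num.sqrt `|z| * rho ^+ k))%:E.
  apply: le_trans (trunc_dyadic_kernel_le k c0 b0) _.
  rewrite lee_fin lerD2l -mulrA sqrtrM// sqrtrM//.
  by rewrite le_eqVlt; apply/orP; left; apply/eqP; rewrite /D; ring.
have [z1|z1] := leP `|z|%R 1%R; last first.
  apply: le_trans (split 0%N) _; rewrite lee_fin mulr0 add0r expr0 mulr1.
  rewrite /log_weight (lt_geF z1) addr0; apply: ler_pM.
  - by rewrite mulr_ge0.
  - exact: sqrtr_ge0.
  - have h1 : (0 <= (c2 + c2 / (2 * L)) * (1 + Num.sqrt b))%R.
      by rewrite mulr_ge0 ?addr_ge0.
    by rewrite mulrDl; lra.
  - rewrite -[leRHS]sqr_sqrtr// expr2 ler_peMl ?sqrtr_ge0//.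
    by rewrite -sqrtr1 ler_wsqrtr// ltW.
rewrite /log_weight z1.
have [z0|zn0] := eqVneq z 0%R.
  apply: le_trans (split 0%N) _; rewrite z0 normr0 mulr0 !mul0r sqrtr0 mul0r mulr0 add0r.
  by rewrite normr0 addr0 mulr0.
have zp : (0 < `|z|)%R by rewrite normr_gt0.
(* Just large enough for rho^k to be at most the root of |z|. *)
pose k := (Num.trunc (- ln `|z| / (2 * L))).+1.
have lnz : (ln `|z| <= 0)%R by rewrite ln_le0.
have kz : (Num.sqrt `|z| * rho ^+ k <= `|z|)%R.
  rewrite -[leRHS]sqr_sqrtr// expr2 ler_wpM2l ?sqrtr_ge0//.
  rewrite -powR12_sqrt// /powR gt_eqF//.
  have -> : (rho ^+ k = expR (k%:R * ln rho))%R by rewrite expRM_natl lnK ?posrE.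
  rewrite ler_expR; have := truncnS_gt (- ln `|z| / (2 * L)).
  rewrite -/k ltr_pdivrMr ?mulr_gt0// /L; lra.
have kle : (k%:R <= 1 - ln `|z| / (2 * L))%R.
  have tl : (0 <= - ln `|z| / (2 * L))%R by rewrite divr_ge0 ?oppr_ge0// mulr_ge0// ltW.
  have /andP[tk _] := truncn_itv tl.
  by rewrite /k -[_.+1%:R]natr1 addrC lerD2l (le_trans tk)// mulNr.
apply: le_trans (split k) _; rewrite lee_fin.
have -> : (`|z * ln `|z| | = `|z| * - ln `|z|)%R by rewrite normrM (ler0_norm lnz).
set w := (- ln `|z|)%R in kle *; have w0 : (0 <= w)%R by rewrite oppr_ge0.
apply: (@le_trans _ _ (c2 * `|z| * (1 + w / (2 * L)) + D * Num.sqrt b * `|z|)%R).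
  apply: lerD; apply: ler_wpM2l => //; last by rewrite mulr_ge0.
  by rewrite /w mulNr.
have -> : (c2 * `|z| * (1 + w / (2 * L)) + D * Num.sqrt b * `|z| =
  `|z| * (c2 + c2 / (2 * L) * w + D * Num.sqrt b))%R by field; rewrite gt_eqF.
have -> : ((c2 + c2 / (2 * L) + D) * (1 + Num.sqrt b) * (`|z| + `|z| * w) =
  `|z| * ((c2 + c2 / (2 * L) + D) * (1 + Num.sqrt b) * (1 + w)))%R by ring.
rewrite ler_wpM2l//.
apply: (@le_trans _ _ ((c2 + c2 / (2 * L) + D) * (1 + w + Num.sqrt b))%R).
  exact: expand_le.
rewrite -[leRHS]mulrA; apply: ler_wpM2l; first by rewrite !addr_ge0.
by rewrite mulrDl mul1r mulrDr mulr1 addrA lerDl mulr_ge0.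
Qed.

End dyadic_kernel_truncation.

(** * Jumps that make no peak *)

Lemma ln_le_powR {R : realType} (sigma x : R) : (0 < sigma)%R -> (0 < x)%R ->
  (ln x <= x `^ sigma / sigma)%R.
Proof.
move=> s0 x0; rewrite ler_pdivlMr// mulrC -ln_powR ltW// ln_sublinear//.
exact: powR_gt0.
Qed.

Lemma measurable_log_weight {R : realType} : measurable_fun setT (@log_weight R).
Proof.
apply: measurable_funD => //; apply: measurable_fun_ifT => //.
  by apply: measurable_fun_ler.
apply: measurableT_comp => //; apply: measurable_funM => //.
exact: (measurableT_comp (@measurable_ln R)).
Qed.

Section peak_free_bounds.
Context {R : realType} {d : nat} {d0 : measure_display} {Omega : measurableType d0}
  {P : probability Omega R} {l : {sigma_finite_measure set R -> \bar R}}
  {mu : Omega -> {measure set (R * d.-tuple R * R) -> \bar R}}.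
Hypothesis hd : (0 < d)%N.
Hypothesis prm : poisson_random_measure P (noise_measure d l) mu.
Variables (s : R) (s0 : (0 < s)%R) (s2 : (s <= 2^-1)%R).
Variables (mu1 mus W : R).
Hypotheses (mu1E : \int[l]_z `|z|%:E = mu1%:E)
  (musE : \int[l]_z (`|z| `^ (1 + s))%:E = mus%:E)
  (WE : \int[l]_z (log_weight z)%:E = W%:E).
Variables (eta : R) (eta0 : (0 < eta)%R) (F : R -> R).
Hypotheses (F0 : forall x, (0 < F x)%R)
  (Fsuper : forall M : R, exists a : R, forall t, (a <= t)%R -> (M * t <= F t)%R).

Let mu10 : (0 <= mu1)%R.
Proof. by rewrite -lee_fin -mu1E; exact: integral_ge0. Qed.

Let mus0 : (0 <= mus)%R.
Proof. by rewrite -lee_fin -musE; apply: integral_ge0 => z _; rewrite lee_fin powR_ge0. Qed.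

Let W0 : (0 <= W)%R.
Proof. by rewrite -lee_fin -WE; apply: integral_ge0 => z _; rewrite lee_fin log_weight_ge0. Qed.

(** Tuned to the Chernoff parameter [th] below: [th n * (cutoff * F n)] equals (s / 2) log n. *)
Definition cutoff : R := (s / 2 * eta / 8)%R.

Lemma cutoff_gt0 : (0 < cutoff)%R.
Proof. by rewrite !divr_gt0// mulr_gt0// divr_gt0. Qed.

Let c3 : R := (3 `^ (d%:R / 2))%R.

Let c30 : (0 < c3)%R. Proof. by rewrite powR_gt0. Qed.

(** For births before n - 1 and t in [n, n + 1], the age at time n + 2 is at most 3 times the age at
    t, whence the constant c3 and a bound free of t. *)
Definition old_jump (n : nat) (q : R * d.-tuple R * R) : R :=
  (Num.min (c3 * window_kernel (n%:R - 1) (n%:R + 2) q.1 * `|q.2|) (cutoff * F n%:R))%R.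

(** Against the level eta / 2 F n it yields n^(-4) ([th_half]), while for quantities capped at
    [cutoff * F n] the exponential is at most n^(s/2) ([th_cutoff]). *)
Let th (n : nat) : R := (8 * ln n%:R / (eta * F n%:R))%R.

Let th_gt0 n : (2 <= n)%N -> (0 < th n)%R.
Proof.
move=> n2; rewrite divr_gt0 ?mulr_gt0// ln_gt0//.
by rewrite ltr1n.
Qed.

Let th_cutoff n x : (2 <= n)%N -> (x <= cutoff * F n%:R)%R ->
  (expR (th n * x) <= n%:R `^ (s / 2))%R.
Proof.
move=> n2 xF; rewrite /powR pnatr_eq0 gtn_eqF ?(ltnW n2)// ler_expR.
apply: (@le_trans _ _ (th n * (cutoff * F n%:R))%R).
  by rewrite ler_wpM2l// ltW// th_gt0.
rewrite le_eqVlt; apply/orP; left; apply/eqP.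
by rewrite /th /cutoff; field; rewrite (gt_eqF eta0) (gt_eqF (F0 _)).
Qed.

Let th_half n : (th n * (eta / 2 * F n%:R) = 4 * ln n%:R)%R.
Proof. by rewrite /th; field; rewrite (gt_eqF eta0) (gt_eqF (F0 _)). Qed.

Lemma old_jump_ge0 n q : (0 <= old_jump n q)%R.
Proof.
have c0 := ltW cutoff_gt0; rewrite le_min; apply/andP; split.
  by rewrite !mulr_ge0 ?window_kernel_ge0 ?(ltW c30).
by rewrite mulr_ge0// ltW.
Qed.
#[local] Hint Resolve old_jump_ge0 : core.

Lemma measurable_old_jump n : measurable_fun setT (old_jump n).
Proof.
apply: measurable_minr => //; apply: measurable_funM.
  apply: measurable_funM => //.
  exact: (measurableT_comp (measurable_window_kernel _ _) measurable_fst).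
by apply: measurableT_comp => //; exact: measurable_snd.
Qed.
#[local] Hint Resolve measurable_old_jump : core.

Let old_weight n (z : R) : R :=
  (th n * c3 * `|z| + (th n * c3) `^ (1 + s) * n%:R `^ (s / 2) * `|z| `^ (1 + s))%R.

(** The old kernel is at most 1, so its power 1 + s is below itself. Both terms then carry a single
    kernel factor, whose integral is known exactly. *)
Let old_exp_le n q : (2 <= n)%N ->
  (expR (th n * old_jump n q) - 1 <=
   window_kernel (n%:R - 1) (n%:R + 2) q.1 * old_weight n q.2)%R.
Proof.
move=> n2; have t0 := th_gt0 n2.
set wk := window_kernel _ _ _; have wk0 : (0 <= wk)%R by exact: window_kernel_ge0.
have wk1 : (wk <= 1)%R.
  rewrite /wk /window_kernel; case: ifP => // /andP[_ qn].
  apply: heat_kernel_le1; rewrite lerBrDr.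
  by apply: le_trans (lerD (lexx 1%R) (ltW qn)) _; rewrite addrC subrK lerDl.
have o0 : (0 <= th n * old_jump n q)%R by rewrite mulr_ge0// ltW.
have s10 : (s <= 1)%R by apply: (le_trans s2); rewrite invf_le1 ?ler1n.
apply: le_trans (expR_sub1_le_powR (ltW s0) s10 o0) _.
have ole : (th n * old_jump n q <= th n * c3 * `|q.2| * wk)%R.
  have -> : (th n * c3 * `|q.2| * wk = th n * (c3 * wk * `|q.2|))%R.
    by rewrite -[LHS]mulrA -[LHS]mulrA [(`|_| * wk)%R]mulrC [(c3 * (_ * _))%R]mulrA.
  by apply: ler_wpM2l; [exact: ltW|rewrite /old_jump ge_min lexx].
have oE : (expR (th n * old_jump n q) <= n%:R `^ (s / 2))%R.
  by apply: (th_cutoff n2); rewrite /old_jump ge_min (lexx (cutoff * F n%:R)%R) orbT.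
rewrite /old_weight mulrDr; apply: lerD; first by rewrite [leRHS]mulrC.
have -> : (wk * ((th n * c3) `^ (1 + s) * n%:R `^ (s / 2) * `|q.2| `^ (1 + s)) =
  (th n * c3) `^ (1 + s) * `|q.2| `^ (1 + s) * wk * n%:R `^ (s / 2))%R.
  by move: (_ `^ _)%R (_ `^ _)%R (_ `^ _)%R => a b c; ring.
apply: ler_pM; rewrite ?powR_ge0 ?expR_ge0//.
have s1' : (0 <= 1 + s)%R by rewrite addr_ge0// ltW.
apply: (@le_trans _ _ ((th n * c3 * `|q.2| * wk) `^ (1 + s))%R).
  apply: ge0_ler_powR => //; rewrite nnegrE//.
  by rewrite mulr_ge0// mulr_ge0// mulr_ge0// ltW.
have tc0 : (0 <= th n * c3)%R by rewrite mulr_ge0// ltW.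
rewrite (powRM _ (mulr_ge0 tc0 (normr_ge0 _)) wk0) (powRM _ tc0 (normr_ge0 _)).
apply: ler_wpM2l; first by rewrite mulr_ge0 ?powR_ge0.
have [->|wkn0] := eqVneq wk 0%R; first by rewrite powR0// gt_eqF// addr_gt0.
by apply: ge1r_powR; [rewrite lt_def wkn0 wk0|rewrite lerDl ltW].
Qed.

Let old_exp_integral n : (2 <= n)%N ->
  \int[noise_measure d l]_q (expR (th n * old_jump n q) - 1)%:E <=
  ((n%:R - 1) * (th n * c3 * mu1 + (th n * c3) `^ (1 + s) * n%:R `^ (s / 2) * mus))%:E.
Proof.
move=> n2; have t0 := th_gt0 n2.
have tc0 : (0 <= th n * c3)%R by rewrite mulr_ge0// ltW.
have tcs0 : (0 <= (th n * c3) `^ (1 + s) * n%:R `^ (s / 2))%R.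
  by rewrite mulr_ge0 ?powR_ge0.
have w0 z : (0 <= old_weight n z)%R.
  by apply: addr_ge0; apply: mulr_ge0; rewrite ?powR_ge0.
have mw : measurable_fun setT (old_weight n).
  apply: measurable_funD; apply: measurable_funM => //.
  by apply: (measurableT_comp (measurable_powR _)).
apply: (@le_trans _ _ (\int[noise_measure d l]_q
    (window_kernel (n%:R - 1) (n%:R + 2) q.1 * old_weight n q.2)%:E)).
  apply: ge0_integral_mono => q _; last by rewrite lee_fin old_exp_le.
  by rewrite lee_fin subr_ge0 -expR0 ler_expR mulr_ge0// ltW.
have n1 : (1 <= n%:R :> R)%R by rewrite ler1n ltnW.
rewrite [leLHS](integral_noise_window_kernel (d := d) _ mw w0); last first.
  rewrite subr_ge0 n1/= lerD2l; by apply: (@le_trans _ _ 0%R); rewrite ?lerN10 ?ler0n.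
rewrite EFinM lee_wpmul2l// ?lee_fin ?subr_ge0//.
rewrite /old_weight; under eq_integral do rewrite EFinD.
rewrite ge0_integralD//; last 4 first.
- by move=> z _; rewrite lee_fin mulr_ge0.
- by apply/measurable_EFinP; apply: measurable_funM.
- by move=> z _; rewrite lee_fin mulr_ge0 ?powR_ge0.
- apply/measurable_EFinP; apply: measurable_funM => //.
  by apply: (measurableT_comp (measurable_powR _)).
under eq_integral do rewrite EFinM.
rewrite ge0_integralZl_EFin//; last first.
- exact/measurable_EFinP.
rewrite mu1E.
under eq_integral do rewrite EFinM.
rewrite ge0_integralZl_EFin//; last first.
  by apply/measurable_EFinP; apply: (measurableT_comp (measurable_powR _)).
by rewrite musE -!EFinM -EFinD.
Qed.

(** Chernoff's exponent is 2 log n + C - 4 log n, so the probabilities are of order n^(-2) and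
    summable. *)
Let eventually_small (phi : nat -> R * d.-tuple R * R -> R) (C : R) (n0 : nat) :
  (forall n, measurable_fun setT (phi n)) -> (forall n q, (0 <= phi n q)%R) ->
  (forall n, (n0 <= n)%N -> (2 <= n)%N ->
    \int[noise_measure d l]_q (expR (th n * phi n q) - 1)%:E <= (2 * ln n%:R + C)%:E) ->
  {ae P, forall w, exists N, forall n, (N <= n)%N ->
    \int[mu w]_q (phi n q)%:E <= (eta / 2 * F n%:R)%:E}.
Proof.
move=> mphi phi0 phiC.
pose B n := [set w | (eta / 2 * F n%:R)%:E <= \int[mu w]_q (phi n q)%:E].
have mB n : measurable (B n).
  rewrite -[B n]setTI; apply: emeasurable_fun_c_infty => //.
  apply: (measurable_prm_integral prm) => //; first exact/measurable_EFinP.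
  by move=> q; rewrite lee_fin.
have PB n : (maxn n0 2 <= n)%N -> P (B n) <= (4 * expR C / n.+1%:R ^+ 2)%:E.
  rewrite geq_max => /andP[n0n n2].
  apply: le_trans (prm_chernoff_upper prm (eta / 2 * F n%:R)%R (mphi n) (phi0 n)
    (th_gt0 n2) (phiC n n0n n2)) _.
  have np : (0 < n%:R :> R)%R by rewrite ltr0n ltnW.
  rewrite th_half lee_fin.
  have -> : (2 * ln n%:R + C - 4 * ln n%:R = C - ln (n%:R ^+ 2) :> R)%R.
    by rewrite lnXn// -[(ln n%:R *+ 2)%R]mulr_natl; ring.
  rewrite expRD expRN lnK; last by rewrite posrE exprn_gt0.
  rewrite [(4 * _)%R]mulrC -mulrA ler_wpM2l ?expR_ge0//.
  rewrite ler_pdivlMr ?exprn_gt0// mulrC ler_pdivrMr ?exprn_gt0//.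
  have -> : (4 * n%:R ^+ 2 = (n%:R + n%:R) ^+ 2 :> R)%R by ring.
  rewrite lerXn2r ?nnegrE ?addr_ge0//.
  by rewrite -[n.+1%:R]natr1 lerD2l ler1n ltnW.
have := ae_eventually_not mB (mulr_ge0 (ler0n _ 4) (expR_ge0 C)) PB.
apply: filterS => w [N HN]; exists N => n /HN/negP; rewrite -ltNge.
exact: ltW.
Qed.

(** The exponents of N cancel: 1 + (1 + s)(s / (2 (1 + s)) - 1) + s / 2 = 0. Thus the part of the
    exponential moment due to the moment of order 1 + s stays bounded in n. *)
Let powR_balance (N D : R) : (0 < N)%R -> (0 <= D)%R ->
  (N * ((D * (N `^ (s / (2 * (1 + s))) / N)) `^ (1 + s) * N `^ (s / 2)) = D `^ (1 + s))%R.
Proof.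
move=> N0 D0; have s1 : (1 + s != 0)%R by rewrite gt_eqF// addr_gt0.
rewrite powRM//; last by rewrite divr_ge0 ?powR_ge0// ltW.
rewrite -[X in (_ / X)%R]powRr1 ?(ltW N0)// -powRN -powRD; last by rewrite (gt_eqF N0) implybT.
rewrite -[X in (X * _ = _)%R]powRr1 ?(ltW N0)// -powRrM.
have aux (a b c e : R) : (a * (b * c * e) = b * (a * c * e))%R by ring.
rewrite aux -!powRD; try by rewrite (gt_eqF N0) implybT.
rewrite [X in (N `^ X)%R](_ : _ = 0%R) ?powRr0 ?mulr1//.
by field; rewrite s1.
Qed.

Lemma old_jump_eventually : {ae P, forall w, exists N, forall n, (N <= n)%N ->
  \int[mu w]_q (old_jump n q)%:E <= (eta / 2 * F n%:R)%:E}.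
Proof.
pose sigma : R := (s / (2 * (1 + s)))%R.
have s1 : (0 < 1 + s)%R by rewrite addr_gt0.
have sigma0 : (0 < sigma)%R by rewrite divr_gt0// mulr_gt0.
pose D : R := (8 * c3 / (eta * sigma))%R.
have D0 : (0 <= D)%R by apply: divr_ge0; apply: mulr_ge0 => //; exact: ltW.
(* This slope makes n times the linear term, [n * (th n * c3 * mu1)], at most 2 log n. The slope 1
   below gives n <= F n, which brings [th n * c3] under the bound that [powR_balance] requires. *)
have [a Fa] := Fsuper (4 * c3 * mu1 / eta)%R.
have [a' Fa'] := Fsuper 1%R.
pose n0 := (maxn (Num.trunc `|a|).+1 (Num.trunc `|a'|).+1).
apply: (@eventually_small old_jump (D `^ (1 + s) * mus) n0) => // n.
rewrite geq_max => /andP[an a'n] n2.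
have /Fa {Fa an}Fa : (a <= n%:R)%R.
  rewrite (le_trans (ler_norm a))// (le_trans (ltW (truncnS_gt _)))//.
  by rewrite ler_nat.
have /Fa' {Fa' a'n} : (a' <= n%:R)%R.
  rewrite (le_trans (ler_norm a'))// (le_trans (ltW (truncnS_gt _)))//.
  by rewrite ler_nat.
rewrite mul1r => nF.
have np : (0 < n%:R :> R)%R by rewrite ltr0n ltnW.
have ln0 : (0 <= ln n%:R :> R)%R by rewrite ln_ge0// ler1n ltnW.
apply: le_trans (old_exp_integral n2) _; rewrite lee_fin mulrDr; apply: lerD.
  apply: (@le_trans _ _ (n%:R * (th n * c3 * mu1))%R).
    rewrite ler_wpM2r ?gerBl// mulr_ge0// mulr_ge0 ?(ltW c30)//.
    exact/ltW/th_gt0.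
  have -> : (n%:R * (th n * c3 * mu1) =
      2 * ln n%:R * ((4 * c3 * mu1 / eta * n%:R) / F n%:R))%R.
    by rewrite /th; field; rewrite (gt_eqF eta0) (gt_eqF (F0 _)).
  by rewrite ler_piMr ?mulr_ge0// ler_pdivrMr// mul1r.
rewrite mulrA ler_wpM2r// -(powR_balance np D0) -/sigma.
apply: ler_pM; rewrite ?mulr_ge0 ?powR_ge0//.
- by rewrite subr_ge0 ler1n ltnW.
- by rewrite gerBl.
rewrite ler_wpM2r ?powR_ge0//.
have tc0 : (0 <= th n * c3)%R by apply: mulr_ge0; apply: ltW => //; exact: th_gt0.
apply: ge0_ler_powR; rewrite ?nnegrE//; first exact: ltW.
- by apply: mulr_ge0 => //; rewrite divr_ge0 ?powR_ge0.
have -> : (th n * c3 = 8 * c3 / eta * (ln n%:R / F n%:R))%R.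
  by rewrite /th; field; rewrite (gt_eqF eta0) (gt_eqF (F0 _)).
have -> : (D * (n%:R `^ sigma / n%:R) = 8 * c3 / eta * ((n%:R `^ sigma / sigma) / n%:R))%R.
  by rewrite /D; field; rewrite (gt_eqF eta0) (gt_eqF sigma0) (gt_eqF np).
apply: ler_wpM2l; first by rewrite divr_ge0 ?mulr_ge0 ?(ltW c30) ?(ltW eta0).
apply: ler_pM => //; first by rewrite invr_ge0 ltW.
  exact: ln_le_powR.
by rewrite lef_pV2// posrE.
Qed.

(** The dyadic kernel may be infinite, but the minimum with the cap is finite, so [fine] loses
    nothing and the Laplace functionals, stated for real functions, apply. *)
Definition recent_jump (n : nat) (q : R * d.-tuple R * R) : R :=
  if (n%:R - 1 <= q.1.1 < n%:R + 1)%R then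
    fine (Order.min ((2 `^ (d%:R / 2) * `|q.2|)%:E * dyadic_kernel q.1.2)
      (cutoff * F n%:R)%:E)
  else 0%R.

Let trunc0 n (y : d.-tuple R) (z : R) :
  0 <= Order.min ((2 `^ (d%:R / 2) * `|z|)%:E * dyadic_kernel y) (cutoff * F n%:R)%:E.
Proof.
rewrite le_min lee_fin mulr_ge0 ?(ltW cutoff_gt0) ?(ltW (F0 _))// andbT.
by rewrite mule_ge0 ?dyadic_kernel_ge0// lee_fin mulr_ge0 ?powR_ge0.
Qed.

Let truncE n (y : d.-tuple R) (z : R) :
  (fine (Order.min ((2 `^ (d%:R / 2) * `|z|)%:E * dyadic_kernel y) (cutoff * F n%:R)%:E)%E)%:E
  = Order.min ((2 `^ (d%:R / 2) * `|z|)%:E * dyadic_kernel y) (cutoff * F n%:R)%:E.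
Proof.
rewrite fineK// ge0_fin_numE; last exact: trunc0.
by apply: (@le_lt_trans _ _ (cutoff * F n%:R)%:E); rewrite ?ltry// ge_min lexx orbT.
Qed.

Lemma recent_jumpE n q : (n%:R - 1 <= q.1.1 < n%:R + 1)%R ->
  (recent_jump n q)%:E =
  Order.min ((2 `^ (d%:R / 2) * `|q.2|)%:E * dyadic_kernel q.1.2) (cutoff * F n%:R)%:E.
Proof. by move=> qn; rewrite /recent_jump qn truncE. Qed.

Lemma recent_jump_ge0 n q : (0 <= recent_jump n q)%R.
Proof. by rewrite /recent_jump; case: ifP => // _; exact/fine_ge0/trunc0. Qed.
#[local] Hint Resolve recent_jump_ge0 : core.

Let recent_jump_le n q : (recent_jump n q <= cutoff * F n%:R)%R.
Proof.
rewrite /recent_jump; case: ifP => _; last first.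
  by rewrite mulr_ge0 ?(ltW cutoff_gt0)// ltW.
by rewrite -lee_fin truncE ge_min lexx orbT.
Qed.

Lemma measurable_recent_jump n : measurable_fun setT (recent_jump n).
Proof.
apply: measurable_fun_ifT => //.
  apply: measurable_and; [apply: measurable_fun_ler => //|apply: measurable_fun_ltr => //];
    exact: (measurableT_comp measurable_fst measurable_fst).
apply: measurableT_comp => //; apply: measurable_mine => //; apply: emeasurable_funM.
  apply/measurable_EFinP; apply: measurable_funM => //.
  by apply: measurableT_comp => //; exact: measurable_snd.
apply: (measurableT_comp measurable_dyadic_kernel).
exact: (measurableT_comp measurable_snd measurable_fst).
Qed.
#[local] Hint Resolve measurable_recent_jump : core.

Let recent_integral : exists2 C : R, (0 <= C)%R & forall n,
  \int[noise_measure d l]_q (recent_jump n q)%:E <=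
  (C * (1 + Num.sqrt (cutoff * F n%:R)))%:E.
Proof.
have [C C0 HC] := @trunc_dyadic_kernel_log R d hd.
exists (2 * C * W)%R; first by rewrite !mulr_ge0.
move=> n; set b := (cutoff * F n%:R)%R.
have b0 : (0 <= b)%R by rewrite mulr_ge0 ?(ltW cutoff_gt0)// ltW.
have k0 : (0 <= C * (1 + Num.sqrt b))%R by rewrite mulr_ge0// addr_ge0// sqrtr_ge0.
rewrite ge0_integral_noise_measure//; last 2 first.
- exact/measurable_EFinP.
- by move=> q; rewrite lee_fin.
have -> : (2 * C * W * (1 + Num.sqrt b) = 2 * (C * (1 + Num.sqrt b)) * W)%R by ring.
rewrite EFinM -WE -ge0_integralZl_EFin//; last 3 first.
- by move=> z _; rewrite lee_fin log_weight_ge0.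
- by apply/measurable_EFinP; exact: measurable_log_weight.
- by rewrite mulr_ge0.
apply: ge0_integral_mono => z _.
  by do 2![apply: integral_ge0 => ? _]; rewrite lee_fin.
have w0 : (0 <= C * (1 + Num.sqrt b) * log_weight z)%R by rewrite mulr_ge0// log_weight_ge0.
apply: (@le_trans _ _ (\int[lebesgue_measure]_(t in `]0%R, +oo[)
   ((C * (1 + Num.sqrt b) * log_weight z)%:E * (\1_`[n%:R - 1, n%:R + 1[ t)%:E))).
  apply: ge0_integral_mono => t _.
    by apply: integral_ge0 => ? _; rewrite lee_fin.
  rewrite indicE; have -> : (t \in `[(n%:R - 1)%R, (n%:R + 1)%R[%classic) = (n%:R - 1 <= t < n%:R + 1)%R.
    by apply/idP/idP; rewrite inE/= in_itv.
  have [tn|tn] := boolP (n%:R - 1 <= t < n%:R + 1)%R; last first.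
    rewrite mule0 integral0_eq// => y _.
    by rewrite /recent_jump/= (negbTE tn).
  rewrite mule1; apply: le_trans (HC b z b0).
  apply: ge0_integral_mono => y _; first by rewrite lee_fin.
  by rewrite /recent_jump/= tn truncE.
rewrite ge0_integralZl_EFin//; last by apply/measurable_EFinP.
rewrite integral_indic//.
apply: (@le_trans _ _ ((C * (1 + Num.sqrt b) * log_weight z)%:E * 2%:E)).
  apply: lee_wpmul2l; first by rewrite lee_fin.
  apply: (@le_trans _ _ (lebesgue_measure `[(n%:R - 1)%R, (n%:R + 1 : R)%R[%classic)).
    by apply: le_measure; rewrite ?inE//; exact: measurableI.
  rewrite /= lebesgue_measure_itv/= lte_fin; case: ifP => _; last by rewrite lee_fin.
  by rewrite -EFinB lee_fin [leLHS](_ : _ = 2%R)//; ring.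
by rewrite -!EFinM lee_fin [leLHS](_ : _ = 2 * (C * (1 + Num.sqrt b)) * log_weight z)%R//; ring.
Qed.

Let recent_exp_le n q : (2 <= n)%N ->
  (expR (th n * recent_jump n q) - 1 <= th n * n%:R `^ (s / 2) * recent_jump n q)%R.
Proof.
move=> n2; have t0 := th_gt0 n2.
have o0 : (0 <= th n * recent_jump n q)%R by rewrite mulr_ge0// ltW.
apply: le_trans (expR_sub1_le _) _.
rewrite -[leRHS]mulrA [X in (_ <= _ * X)%R]mulrC mulrA ler_wpM2l//.
exact: th_cutoff.
Qed.

(** Since F n >= n, it suffices that log n times n^(s/2) be at most 4 times the root of n: indeed
    log n <= 4 n^(1/4), and s <= 1/2. *)
Let log_bound (n : nat) : (2 <= n)%N -> (n%:R <= F n%:R)%R ->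
  (th n * n%:R `^ (s / 2) * (1 + Num.sqrt (cutoff * F n%:R)) <=
   32 / eta * (1 + Num.sqrt cutoff))%R.
Proof.
move=> n2 nF; have n1 : (1 <= n%:R :> R)%R by rewrite ler1n ltnW.
have np : (0 < n%:R :> R)%R by rewrite ltr0n ltnW.
have sF : (Num.sqrt n%:R <= Num.sqrt (F n%:R))%R by rewrite ler_wsqrtr.
have sn1 : (1 <= Num.sqrt n%:R :> R)%R by rewrite -[leLHS]sqrtr1 ler_wsqrtr.
have sn0 : (0 < Num.sqrt n%:R :> R)%R by rewrite (lt_le_trans ltr01).
have sF0 : (0 < Num.sqrt (F n%:R))%R by rewrite sqrtr_gt0.
rewrite sqrtrM ?(ltW cutoff_gt0)//.
have sc0 : (0 <= Num.sqrt cutoff)%R := sqrtr_ge0 _.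
have lnn : (ln n%:R * n%:R `^ (s / 2) <= 4 * Num.sqrt n%:R)%R.
  rewrite -powR12_sqrt ?(ltW np)//.
  have -> : (2^-1 = 4^-1 + 4^-1 :> R)%R by field.
  rewrite powRD ?(gt_eqF np) ?implybT// mulrA.
  apply: ler_pM; rewrite ?powR_ge0 ?ln_ge0//.
    by rewrite mulrC -[X in (_ * X)%R]invrK; apply: ln_le_powR.
  apply: ler_powR => //.
  have -> : (4^-1 + 4^-1 = 2^-1 :> R)%R by field.
  have -> : (4^-1 = 2^-1 / 2 :> R)%R by field.
  by rewrite ler_wpM2r.
apply: (@le_trans _ _ (th n * n%:R `^ (s / 2) * (Num.sqrt (F n%:R) * (1 + Num.sqrt cutoff)))%R).
  apply: ler_wpM2l; first by rewrite mulr_ge0 ?powR_ge0// ltW// th_gt0.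
  by rewrite mulrDr mulr1 lerD// ?(le_trans sn1)// mulrC.
rewrite mulrA ler_wpM2r// ?addr_ge0//.
have -> : (th n * n%:R `^ (s / 2) * Num.sqrt (F n%:R) =
    8 / eta * (ln n%:R * n%:R `^ (s / 2) / Num.sqrt (F n%:R)))%R.
  have := sqr_sqrtr (ltW (F0 n%:R)); move: sF0.
  move: (Num.sqrt (F n%:R)) => r r0 rE; rewrite /th -rE.
  by field; rewrite (gt_eqF eta0) (gt_eqF r0).
have -> : (32 / eta = 8 / eta * 4)%R by field; rewrite gt_eqF.
rewrite ler_wpM2l ?divr_ge0 ?(ltW eta0)//.
by rewrite ler_pdivrMr// (le_trans lnn)// ler_wpM2l.
Qed.

Lemma recent_jump_eventually : {ae P, forall w, exists N, forall n, (N <= n)%N ->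
  \int[mu w]_q (recent_jump n q)%:E <= (eta / 2 * F n%:R)%:E}.
Proof.
have [C C0 HC] := recent_integral.
have [a' Fa'] := Fsuper 1%R.
apply: (@eventually_small recent_jump (C * (32 / eta * (1 + Num.sqrt cutoff))) (Num.trunc `|a'|).+1) => //.
move=> n a'n n2.
have /Fa' {Fa' a'n} : (a' <= n%:R)%R.
  rewrite (le_trans (ler_norm a'))// (le_trans (ltW (truncnS_gt _)))//.
  by rewrite ler_nat.
rewrite mul1r => nF.
have t0 := th_gt0 n2.
have ln0 : (0 <= ln n%:R :> R)%R by rewrite ln_ge0// ler1n ltnW.
have k0 : (0 <= th n * n%:R `^ (s / 2))%R by rewrite mulr_ge0 ?powR_ge0// ltW.
apply: (@le_trans _ _ (\int[noise_measure d l]_q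
    ((th n * n%:R `^ (s / 2))%:E * (recent_jump n q)%:E))).
  apply: ge0_integral_mono => q _; last by rewrite -EFinM lee_fin recent_exp_le.
  by rewrite lee_fin subr_ge0 -expR0 ler_expR mulr_ge0// ltW.
rewrite ge0_integralZl_EFin//; last 2 first.
- by move=> q _; rewrite lee_fin.
- exact/measurable_EFinP.
apply: le_trans (lee_wpmul2l _ (HC n)) _; first by rewrite lee_fin.
rewrite -EFinM lee_fin mulrCA.
apply: (@le_trans _ _ (C * (32 / eta * (1 + Num.sqrt cutoff)))%R).
  by rewrite ler_wpM2l// log_bound.
by rewrite lerDr mulr_ge0.
Qed.

End peak_free_bounds.

(** * Jumps that make a peak *)

Section near_points.
Context {R : realType} {d : nat} {d0 : measure_display} {Omega : measurableType d0}
  {P : probability Omega R} {l : {sigma_finite_measure set R -> \bar R}}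
  {mu : Omega -> {measure set (R * d.-tuple R * R) -> \bar R}}.

Let old_ratio (n t x : R) : (n <= t -> x < n - 1 -> n + 2 - x <= 3 * (t - x))%R.
Proof. by move=> ? ?; lra. Qed.

Let recent_delay (n t x : R) : (t <= n + 1 -> n - 1 <= x -> t - x <= 2)%R.
Proof. by move=> ? ?; lra. Qed.

Hypothesis hd : (0 < d)%N.
Hypothesis prm : poisson_random_measure P (noise_measure d l) mu.
Variables (s : R) (s0 : (0 < s)%R) (s2 : (s <= 2^-1)%R).
Variables (mu1 mus W : R).
Hypotheses (mu1E : \int[l]_z `|z|%:E = mu1%:E)
  (musE : \int[l]_z (`|z| `^ (1 + s))%:E = mus%:E)
  (WE : \int[l]_z (log_weight z)%:E = W%:E).
Variables (F : R -> R).
Hypotheses (F0 : forall x, (0 < F x)%R)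
  (Fnd : forall x y, (x <= y)%R -> (F x <= F y)%R)
  (sF : \sum_(n <oo) ((F n.+1%:R)^-1)%:E < +oo).

Let Fsuper : forall M : R, exists a : R, forall t, (a <= t)%R -> (M * t <= F t)%R.
Proof. exact: reciprocal_series_superlinear. Qed.

Variables (eta : R) (eta0 : (0 < eta)%R).

Let delta := cutoff s eta.

Let delta0 : (0 < delta)%R. Proof. exact: cutoff_gt0. Qed.

(** By [heat_kernel_enorm], only these jumps can contribute more than delta F n at a time t in
    [n, n + 1]: a birth before t gives F(birth - 2) <= F n. The bound involves the birth time alone,
    so the set does not depend on t. *)
Definition near : set (R * d.-tuple R * R) :=
  [set q | (0 < q.1.1)%R /\
    (enorm q.1.2 ^+ d * (delta * F (q.1.1 - 2)) <= d%:R ^+ d * `|q.2|)%R].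

Let mF : measurable_fun setT F.
Proof. by apply: nondecreasing_measurable => // x y; exact: Fnd. Qed.

Let measurable_near : measurable near.
Proof.
have m11 : measurable_fun setT (fun q : R * d.-tuple R * R => q.1.1).
  exact: (measurableT_comp measurable_fst measurable_fst).
rewrite (_ : near = [set q | (0 < q.1.1)%R] `&`
  [set q | (enorm q.1.2 ^+ d * (delta * F (q.1.1 - 2)) <= d%:R ^+ d * `|q.2|)%R])//.
apply: measurableI; first exact: measurable_positive_time.
rewrite -[X in measurable X]setTI.
apply: measurable_fun_le => //.
- apply: measurable_funM.
    apply: measurable_funX.
    apply: (measurableT_comp (@measurable_enorm R d)).
    exact: (measurableT_comp measurable_snd measurable_fst).
  by apply: measurable_funM => //; apply: (measurableT_comp mF); exact: measurable_funB.
- by apply: measurable_funM => //; apply: measurableT_comp => //; exact: measurable_snd.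
Qed.

(** For fixed birth time t and size z the slice is a ball of volume at most a multiple of |z| / F(t
    - 2), which is integrable in t by convergence of the series and in z by the first moment. *)
Let near_finite : noise_measure d l near < +oo.
Proof.
have mu10 : (0 <= mu1)%R by rewrite -lee_fin -mu1E; exact: integral_ge0.
pose g (t : R) : R := ((F (t - 2))^-1)%R.
have g0 t : (0 <= g t)%R by rewrite invr_ge0 ltW.
have gni x y : (x <= y)%R -> (g y <= g x)%R.
  by move=> xy; rewrite lef_pV2 ?posrE//; apply: Fnd; rewrite lerD2r.
have mg D : measurable D -> measurable_fun D g.
  by move=> mD; apply: nonincreasing_measurable => // x y; exact: gni.
have gfin : \int[lebesgue_measure]_(t in `]0%R, +oo[) (g t)%:E < +oo.
  apply: (@le_lt_trans _ _ (\int[lebesgue_measure]_(t in `[0%:R%R, +oo[) (g t)%:E)).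
    apply: ge0_subset_integral => //; first by apply/measurable_EFinP; exact: mg.
      by move=> t _; rewrite lee_fin.
    by move=> t; rewrite /= !in_itv/= !andbT => /ltW.
  apply: le_lt_trans (integral_le_series g0 gni 0) _.
  (* Three terms are set aside to undo the shift in F: (n + 3) - 2 = n + 1. *)
  rewrite (nneseries_split 0 3)//; last by move=> k _; rewrite lee_fin.
  rewrite lte_add_pinfty//.
    by rewrite lte_sum_pinfty// => k _; rewrite ltry.
  rewrite add0n -nneseries_addn; last by move=> k; rewrite lee_fin.
  under eq_eseriesr => n _.
    rewrite add0n /g (_ : ((n + 3)%:R - 2 = n.+1%:R :> R)%R); last first.
      by rewrite -addn1 !natrD; ring.
    over.
  exact: sF.
pose K : R := (d%:R ^+ d / delta)%R.
have K0 : (0 <= K)%R by rewrite divr_ge0 ?exprn_ge0// ltW.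
have -> : noise_measure d l near = \int[noise_measure d l]_q (\1_near q)%:E.
  by rewrite integral_indic// setIT.
rewrite ge0_integral_noise_measure//; last first.
  by apply/measurable_EFinP.
apply: (@le_lt_trans _ _ (\int[l]_z (((2 ^+ d * K)%:E *
    \int[lebesgue_measure]_(t in `]0%R, +oo[) (g t)%:E) * `|z|%:E))); last first.
  rewrite ge0_integralZl//; last 2 first.
  - exact/measurable_EFinP.
  - apply: mule_ge0; first by rewrite lee_fin mulr_ge0// exprn_ge0.
    by apply: integral_ge0 => t _; rewrite lee_fin.
  rewrite mu1E lte_mul_pinfty ?ltry//.
  - apply: mule_ge0; first by rewrite lee_fin mulr_ge0// exprn_ge0.
    by apply: integral_ge0 => t _; rewrite lee_fin.
  - rewrite ge0_fin_numE.
      by apply: lte_mul_pinfty => //; rewrite lee_fin mulr_ge0// exprn_ge0.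
    apply: mule_ge0; first by rewrite lee_fin mulr_ge0// exprn_ge0.
    by apply: integral_ge0 => t _; rewrite lee_fin.
apply: ge0_integral_mono => z _.
  by apply: integral_ge0 => t _; apply: integral_ge0 => y _; rewrite lee_fin.
apply: (@le_trans _ _ (\int[lebesgue_measure]_(t in `]0%R, +oo[)
    ((2 ^+ d * K * `|z|)%:E * (g t)%:E))).
  apply: ge0_integral_mono => t t0.
    by apply: integral_ge0 => y _; rewrite lee_fin.
  have x0 : (0 <= K * `|z| * g t)%R by rewrite mulr_ge0// mulr_ge0.
  rewrite -EFinM -(_ : 2 ^+ d * (K * `|z| * g t) = 2 ^+ d * K * `|z| * g t)%R; last by ring.
  apply: le_trans (lebesgue_tuple_ball_le hd x0).
  set B := [set y | _]; have mB : measurable B by exact: measurable_enorm_le.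
  have -> : @lebesgue_tuple R d B = \int[@lebesgue_tuple R d]_y (\1_B y)%:E.
    by rewrite integral_indic// setIT.
  apply: ge0_integral_mono => y _; first by rewrite lee_fin.
  rewrite lee_fin !indicE; case: (boolP ((t, y, z) \in near)) => //.
  rewrite inE => -[/= _ tyz]; rewrite mem_set// /B/=.
  have dF : (0 < delta * F (t - 2))%R by rewrite mulr_gt0.
  rewrite -(ler_pM2r dF); apply: le_trans tyz _.
  rewrite le_eqVlt; apply/orP; left; apply/eqP.
  by rewrite /K /g; field; rewrite (gt_eqF delta0) (gt_eqF (F0 _)).
rewrite ge0_integralZl_EFin//; last 3 first.
- by move=> t _; rewrite lee_fin.
- by apply/measurable_EFinP; exact: mg.
- by apply: mulr_ge0 => //; apply: mulr_ge0 => //; exact: exprn_ge0.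
by rewrite EFinM muleAC.
Qed.

Let far (r : nat) := near `&` [set q | ~~ ((q.1.1 <= r%:R) && (`|q.2| <= r%:R))%R].

Let measurable_far r : measurable (far r).
Proof.
apply: measurableI => //.
rewrite (_ : [set _ | _] = ~` ([set q | (q.1.1 <= r%:R)%R] `&`
    [set q | (`|q.2| <= r%:R)%R])); last first.
  apply/seteqP; split => q /=; first by move=> /negP h [a b]; apply: h; rewrite a b.
  by move=> h; apply/negP => /andP[a b]; exact: h.
apply: measurableC; apply: measurableI; rewrite -[X in measurable X]setTI.
  apply: measurable_fun_le => //.
  exact: (measurableT_comp measurable_fst measurable_fst).
by apply: measurable_fun_le => //; apply: measurableT_comp => //; exact: measurable_snd.
Qed.

(** The sets [far r] decrease to the empty set inside [near], which has finite mass a.s.; their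
    masses are integers tending to 0, hence 0 from some r on. *)
Let far_null : {ae P, forall w, exists r : nat, mu w (far r) = 0}.
Proof.
have far_count : {ae P, forall w, forall r, exists k : nat, mu w (far r) = k%:R%:E}.
  apply/ae_foralln => r; apply: (prm_ae_finite prm) => //.
  apply: le_lt_trans near_finite; apply: le_measure; rewrite ?inE//.
  exact: subIsetl.
have near_count := prm_ae_finite prm measurable_near near_finite.
apply: filterS2 far_count near_count => w farw [k nearw].
have far0 : \bigcap_r far r = set0.
  apply/seteqP; split => // q farq.
  pose r := (Num.trunc (`|q.1.1| + `|q.2|)).+1.
  have qr : (`|q.1.1| + `|q.2| <= r%:R)%R by exact/ltW/truncnS_gt.
  have [_ /negP] := farq r Logic.I; apply; apply/andP; split.
    rewrite (le_trans (ler_norm _))// (le_trans _ qr)// lerDl//.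
  by rewrite (le_trans _ qr)// lerDr.
have farcvg : mu w (far r) @[r --> \oo] --> mu w (\bigcap_r far r).
  apply: nonincreasing_cvg_mu => //.
  - apply: (@le_lt_trans _ _ (mu w near)); last by rewrite nearw ltry.
    by apply: le_measure; rewrite ?inE//; exact: subIsetl.
  - by rewrite far0.
  - move=> a b ab; apply/subsetPset => q [nq /negP qb]; split => //.
    apply/negP => /andP[q1 q2]; apply: qb.
    by rewrite (le_trans q1) ?ler_nat// (le_trans q2) ?ler_nat.
rewrite far0 measure0 in farcvg.
have : \forall r \near \oo, mu w (far r) < 1.
  have : nbhs (0 : \bar R) [set x | x < 1].
    by apply: open_nbhs_nbhs; split; [exact: open_ereal_lt_ereal|exact: lte01].
  exact: farcvg.
move=> [r _ /(_ r (leqnn r)) /= far1]; exists r.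
have [j farj] := farw r; rewrite farj in far1 *.
by move: far1; rewrite lte_fin ltrn1 ltnS leqn0 => /eqP ->.
Qed.

(** A domination uniform in t over [n, n + 1], valid off [far r], which carries no point for a
    suitable r. *)
Let kernel_bound r (n : nat) t q : (r.+2 <= n)%N -> (r%:R <= delta * F n%:R)%R ->
  (n%:R <= t <= n%:R + 1)%R -> ~ far r q ->
  (window_kernel t t q.1 * `|q.2| <= old_jump s eta F n q + recent_jump s eta F n q)%R.
Proof.
move=> rn rF /andP[nt tn] farq.
have o0 : (0 <= old_jump s eta F n q)%R by exact: old_jump_ge0.
have r0 : (0 <= recent_jump s eta F n q)%R by exact: recent_jump_ge0.
rewrite /window_kernel; case: ifPn => [/andP[q0 qt]|_]; last by rewrite mul0r addr_ge0.
have tq : (0 < t - q.1.1)%R by rewrite subr_gt0.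
have k0 : (0 <= heat_kernel (t - q.1.1) q.1.2)%R by exact: heat_kernel_ge0.
have capped : (~ near q \/ (q.1.1 <= r%:R /\ `|q.2| <= r%:R)%R) /\
    (q.1.1 < n%:R - 1 \/ ~ near q)%R.
  have [nq|nq] := pselect (near q); last by split; [left|right].
  have : (q.1.1 <= r%:R /\ `|q.2| <= r%:R)%R.
    by apply/andP; apply: contra_notT farq => h.
  move=> [qr zr]; split; [by right|left].
  apply: (le_lt_trans qr); rewrite ltrBrDr natr1 ltr_nat//.
(* A jump that is not near is capped by [heat_kernel_enorm]. A near one off [far r] is born by time
   r and has size at most r, so its age is at least 1, the kernel is at most 1, and r <= delta F
   n. *)
have le_cut : (heat_kernel (t - q.1.1) q.1.2 * `|q.2| <= delta * F n%:R)%R.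
  case: capped => -[nq|[qr zr]] _; last first.
    apply: le_trans rF; rewrite -[leRHS]mul1r ler_pM//.
    apply: heat_kernel_le1; rewrite lerBrDr (le_trans _ nt)//.
    rewrite (le_trans (lerD (lexx 1%R) qr))// nat1r ler_nat.
    exact: ltnW.
  have zle : (d%:R ^+ d * `|q.2| <= enorm q.1.2 ^+ d * (delta * F (q.1.1 - 2)))%R.
    by rewrite leNgt; apply/negP => h; apply: nq; split => //; exact: ltW.
  have dd : (0 < d%:R ^+ d :> R)%R by rewrite exprn_gt0// ltr0n.
  rewrite -(ler_pM2l dd) mulrCA.
  apply: (le_trans (ler_wpM2l k0 zle)); rewrite [leLHS]mulrA.
  apply: ler_pM.
  - by rewrite mulr_ge0// exprn_ge0// enorm_ge0.
  - by rewrite mulr_ge0// ltW.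
  - exact: heat_kernel_enorm.
  - rewrite ler_wpM2l ?(ltW delta0)//; apply: Fnd.
    by rewrite lerBlDr (le_trans (ltW qt))// (le_trans tn)// lerD2l ler1n.
have [qn|qn] := ltP q.1.1 (n%:R - 1)%R.
  apply: (@le_trans _ _ (old_jump s eta F n q)); last by rewrite lerDl.
  rewrite /old_jump le_min le_cut andbT ler_wpM2r//.
  rewrite /window_kernel q0 qn/=.
  have le_t : (t - q.1.1 <= n%:R + 2 - q.1.1)%R.
    by rewrite lerD2r (le_trans tn)// lerD2l ler1n.
  apply: le_trans (heat_kernel_time _ tq le_t) _.
  rewrite ler_wpM2r ?heat_kernel_ge0// ge0_ler_powR ?nnegrE//.
  - by rewrite divr_ge0// ltW// (lt_le_trans tq).
  - by rewrite ler_pdivrMr//; exact: old_ratio.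
have tu : (t - q.1.1 <= 2)%R by exact: recent_delay tn qn.
apply: (@le_trans _ _ (recent_jump s eta F n q)); last by rewrite lerDr.
have qb : (n%:R - 1 <= q.1.1 < n%:R + 1)%R by rewrite qn (lt_le_trans qt).
rewrite -lee_fin recent_jumpE// le_min lee_fin le_cut andbT.
rewrite EFinM [X in _ <= X * _]EFinM muleAC lee_wpmul2r//.
exact: heat_kernel_le_dyadic.
Qed.

Lemma total_variation_small : {ae P, forall w, exists T, forall t, (T <= t)%R ->
  \int[mu w]_q (window_kernel t t q.1 * `|q.2|)%:E <= (eta * F t)%:E}.
Proof.
have H1 := old_jump_eventually prm s0 s2 mu1E musE eta0 F0 Fsuper.
have H2 := recent_jump_eventually hd prm s0 s2 WE eta0 F0 Fsuper.
apply: filterS3 H1 H2 far_null => w [N1 HN1] [N2 HN2] [r far0].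
(* Superlinearity with slope 1 / delta gives r <= n <= delta F n. *)
have [a Fa] := Fsuper (delta^-1)%R.
pose N := maxn (maxn N1 N2) (maxn r.+2 (Num.trunc `|a|).+1).
exists N%:R => t Nt.
have t0 : (0 <= t)%R by apply: le_trans Nt.
have /andP[nt tn] := truncn_itv t0; set n := Num.trunc t in nt tn.
have Nn : (N <= n)%N by rewrite -ltnS -(ltr_nat R); exact: le_lt_trans tn.
move: Nn; rewrite !geq_max => /andP[/andP[N1n N2n] /andP[rn an]].
have Fn : (r%:R <= delta * F n%:R)%R.
  have /Fa : (a <= n%:R)%R.
    rewrite (le_trans (ler_norm a))// (le_trans (ltW (truncnS_gt _)))//.
    by rewrite ler_nat.
  rewrite ler_pdivrMl// => /(le_trans _); apply.
  by rewrite ler_nat ltnW// ltnW.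
apply: (@le_trans _ _ (\int[mu w]_q ((old_jump s eta F n q)%:E +
    (recent_jump s eta F n q)%:E))).
  apply: ae_ge0_le_integral => //.
  - by move=> q _; rewrite lee_fin mulr_ge0// window_kernel_ge0.
  - apply/measurable_EFinP; apply: measurable_funM.
      exact: (measurableT_comp (measurable_window_kernel _ _) measurable_fst).
    by apply: measurableT_comp => //; exact: measurable_snd.
  - by move=> q _; rewrite adde_ge0// lee_fin ?old_jump_ge0 ?recent_jump_ge0.
  - by apply: emeasurable_funD; apply/measurable_EFinP;
      [exact: measurable_old_jump|exact: measurable_recent_jump].
  - exists (far r); split => // q /=; apply: contra_notP => fq _.
    rewrite -EFinD lee_fin; apply: (kernel_bound rn Fn _ fq).
    by rewrite nt natr1 ltW.
rewrite ge0_integralD//; last 4 first.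
- by move=> q _; rewrite lee_fin old_jump_ge0.
- by apply/measurable_EFinP; exact: measurable_old_jump.
- by move=> q _; rewrite lee_fin recent_jump_ge0.
- by apply/measurable_EFinP; exact: measurable_recent_jump.
apply: le_trans (leeD (HN1 n N1n) (HN2 n N2n)) _.
rewrite -EFinD lee_fin -mulrDl -splitr ler_wpM2l ?(ltW eta0)//.
exact: Fnd.
Qed.

End near_points.

(** * The signed process *)

Arguments mean_side {R} l sg.

Section limsup_at_infinity.
Context {R : realType}.
Implicit Type g : R -> \bar R.

Lemma limf_esup_le g (T : R) (y : \bar R) :
  (forall t, (T <= t)%R -> g t <= y) -> limf_esup g (pinfty_nbhs R) <= y.
Proof.
move=> gy; rewrite limf_esupE.
apply: (@le_trans _ _ (ereal_sup (g @` [set t | (T <= t)%R]))).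
  apply: ereal_inf_lbound; exists [set t | (T <= t)%R] => //.
  by apply: nbhs_pinfty_ge; exact: num_real.
by apply: ge_ereal_sup => _ [t Tt <-]; exact: gy.
Qed.

Lemma limf_esup_ge g (y : \bar R) :
  (forall N : nat, exists2 t, (N%:R <= t)%R & y <= g t) ->
  y <= limf_esup g (pinfty_nbhs R).
Proof.
move=> yg; rewrite limf_esupE; apply: le_ereal_inf_tmp => _ [A [M [_ MA]] <-].
have [t Mt yt] := yg (Num.trunc `|M|).+1.
apply: le_trans yt _; apply: ereal_sup_ubound; exists t => //; apply: MA.
by apply: le_lt_trans (ler_norm M) _; apply: lt_le_trans (truncnS_gt _) Mt.
Qed.

Lemma divr_posE (x : \bar R) (r : R) : (0 < r)%R -> x / r%:E = x * (r^-1)%:E.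
Proof. by move=> r0; rewrite inver gt_eqF. Qed.

End limsup_at_infinity.

Section signed_process.
Context {R : realType} {d : nat} {d0 : measure_display} {Omega : measurableType d0}
  {P : probability Omega R} {l : {sigma_finite_measure set R -> \bar R}}
  {mu : Omega -> {measure set (R * d.-tuple R * R) -> \bar R}}.
Hypothesis hd : (1 <= d)%N.
Hypothesis prm : poisson_random_measure P (noise_measure d l) mu.
Hypothesis lambda1 : \int[l]_z `|z|%:E < +oo.

Definition signed_value (sg drf t : R) (w : Omega) : \bar R :=
  (sg * drf * t)%:E + (jump_part mu sg t w - jump_part mu (- sg) t w).

(** When both jump parts are infinite, [+oo - +oo] is [-oo] by convention on either side, so
    negation gives an inequality only. *)
Lemma signed_valueN drf t w :
  signed_value (-1) drf t w <= - signed_value 1 drf t w.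
Proof.
rewrite /signed_value opprK mul1r mulN1r mulNr.
have := jump_part_ge0 mu 1 t w; have := jump_part_ge0 mu (-1) t w.
case: (jump_part mu 1 t w) (jump_part mu (-1) t w) => [a| |] [b| |]//= _ _.
  by rewrite lee_fin; lra.
Qed.

Lemma signed_valueN_null drf t w : jump_part mu (-1) t w = 0 ->
  signed_value (-1) drf t w = - signed_value 1 drf t w.
Proof.
move=> J0; rewrite /signed_value opprK J0 mul1r mulN1r mulNr sub0e sube0.
by rewrite EFinN -oppeD// fin_num_adde_defr.
Qed.

Section oscillation.
Variables (F : R -> R).
Hypotheses (F0 : forall x, (0 < F x)%R)
  (Fnd : forall x y, (x <= y)%R -> (F x <= F y)%R)
  (sF : \sum_(n <oo) ((F n.+1%:R)^-1)%:E = +oo).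

(** Quantifying over every g above the quotient lets the same statement serve for the solution and
    for its negative, where only an inequality is available. *)
Lemma signed_value_oscillation (sg drf : R) : (`|sg| = 1)%R ->
  0 < l [set z | (0 < sg * z)%R] ->
  {ae P, forall w, forall g : R -> \bar R,
    (forall t, (1 <= t)%R -> signed_value sg drf t w / (F t)%:E <= g t) ->
    limf_esup g (pinfty_nbhs R) = +oo}.
Proof.
move=> sg1 lsg.
have := jump_part_oscillation hd prm lambda1 sg1 lsg drf F0 Fnd sF.
apply: filterS => w osc g gS; apply/eqyP => A A0; apply: limf_esup_ge => N.
have [t [Nt t0 Ft]] := osc (Num.trunc A).+1 N.+1.
have t1 : (1 <= t)%R by apply: le_trans Nt; rewrite ler1n.
exists t; first by apply: le_trans Nt; rewrite ler_nat.
apply: le_trans (gS t t1).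
rewrite divr_posE// lee_pdivlMr// -EFinM; apply: le_trans Ft.
by rewrite lee_fin ler_wpM2r ?(ltW (F0 _))// ltW// truncnS_gt.
Qed.

End oscillation.

Lemma mean_sideB sg : (`|sg| = 1)%R ->
  (\int[l]_z z = sg * (mean_side l sg - mean_side l (- sg)))%R.
Proof.
move=> sg1.
have -> : (sg * (mean_side l sg - mean_side l (- sg)) = mean_side l 1 - mean_side l (-1))%R.
  have [s0|s0] := ltP 0%R sg.
    by move: sg1; rewrite gtr0_norm// => ->; rewrite mul1r.
  by move: sg1; rewrite ler0_norm// => /eqP; rewrite eqr_oppLR => /eqP ->; rewrite opprK mulN1r opprB.
have pE : \int[l]_z (fun z => z%:E)^\+ z = \int[l]_z (Num.max (1 * z)%R 0)%:E.
  by apply: eq_integral => z _; rewrite funeposE mul1r EFin_max.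
have nE : \int[l]_z (fun z => z%:E)^\- z = \int[l]_z (Num.max (-1 * z)%R 0)%:E.
  by apply: eq_integral => z _; rewrite funenegE mulN1r EFin_max.
by rewrite /Rintegral integralE pE nE fineB// (side_integral_fin_num lambda1) ?normrN1 ?normr1.
Qed.

Let measurable_side sg : measurable [set z : R | (0 < sg * z)%R].
Proof.
have mM : measurable_fun setT (fun z : R => (sg * z)%R) by exact: measurable_funM.
have := mM measurableT `]0%R, +oo[%classic (measurable_itv _).
by rewrite setTI; congr measurable; apply/seteqP; split => z /=; rewrite in_itv/= andbT.
Qed.

(** The set of jumps of this sign has zero intensity, hence a.s. zero count. It does not depend on
    t, so one null event serves for all times. *)
Lemma jump_part_null sg : l [set z | (0 < sg * z)%R] = 0 ->
  {ae P, forall w, forall t, jump_part mu sg t w = 0}.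
Proof.
move=> l0; pose J := [set z : R | (0 < sg * z)%R].
have mJ : measurable J := measurable_side sg.
pose A : set (R * d.-tuple R * R) := [set q | J q.2].
have mA : measurable A by rewrite /A -[X in measurable X]setTI; exact: measurable_snd.
have lJ : \int[l]_z (\1_J z)%:E = 0 by rewrite integral_indic// setIT.
have nuA : noise_measure d l A = 0.
  have -> : noise_measure d l A = \int[noise_measure d l]_q (1 * (\1_J q.2)%:E).
    under eq_integral do rewrite mul1e.
    transitivity (\int[noise_measure d l]_q (\1_A q)%:E).
      by rewrite integral_indic// setIT.
    apply: eq_integral => q _; rewrite !indicE (_ : (q \in A) = (q.2 \in J))//.
  rewrite (ge0_integral_noise_measureM l (a := fun=> 1) (b := fun z => (\1_J z)%:E))//.
    by rewrite lJ mule0.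
  exact/measurable_EFinP.
have : \int[P]_w mu w A = 0 by rewrite (prm_mean prm).
have mmu : measurable_fun setT (fun w => mu w A) := prm_measurable prm mA.
have -> : \int[P]_w mu w A = \int[P]_w `|mu w A| by apply: eq_integral => w _; rewrite gee0_abs.
move/(ae_eq_integral_abs _ measurableT mmu); apply: filterS => w /(_ Logic.I) muA t.
rewrite /jump_part; apply: (@eq_trans _ _ (\int[mu w]_(q in setT) 0)); last by rewrite integral0.
apply: ae_eq_integral => //.
- apply/measurable_EFinP; apply: measurable_funM.
    exact: (measurableT_comp (measurable_window_kernel _ _) measurable_fst).
  apply: measurable_maxr => //; apply: measurable_funM => //; exact: measurable_snd.
- exists A; split => // q /=; apply: contra_notP => Aq _.
  by rewrite max_r ?mulr0// leNgt; apply/negP.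
Qed.

Lemma mean_side_null sg : l [set z | (0 < sg * z)%R] = 0 -> mean_side l sg = 0%R.
Proof.
move=> l0; rewrite /mean_side (_ : \int[l]_z _ = 0)//.
apply: (@eq_trans _ _ (\int[l]_(z in setT) 0)); last by rewrite integral0.
have mJ := measurable_side sg.
apply: ae_eq_integral => //.
- by apply/measurable_EFinP; apply: measurable_maxr => //; exact: measurable_funM.
- exists [set z | (0 < sg * z)%R]; split => // z /=; apply: contra_notP => Az _.
  by rewrite max_r// leNgt; apply/negP.
Qed.

(** Only the opposite jumps remain, with a minus sign: [jump_part_lower] bounds the upper limit from
    above, and the arbitrarily late times of [jump_part_upper] show that it is attained. *)
Lemma signed_value_lln sg drf : (`|sg| = 1)%R -> l [set z | (0 < sg * z)%R] = 0 ->
  {ae P, forall w, forall g : R -> \bar R,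
    (forall t, (1 <= t)%R -> g t = signed_value sg drf t w / t%:E) ->
    limf_esup g (pinfty_nbhs R) = (sg * drf - mean_side l (- sg))%:E}.
Proof.
move=> sg1 l0; have sgN1 : (`|- sg| = 1)%R by rewrite normrN.
have eps0 k : (0 < k.+1%:R^-1 :> R)%R by rewrite invr_gt0.
have lo : {ae P, forall w, forall k : nat, exists T, forall t, (T <= t)%R ->
    ((mean_side l (- sg) - k.+1%:R^-1) * t)%:E <= jump_part mu (- sg) t w}.
  by apply/ae_foralln => k; have := jump_part_lower prm lambda1 sgN1 (eps0 k).
have up : {ae P, forall w, forall k N : nat, exists t, [/\ (N%:R <= t)%R, (0 < t)%R &
    jump_part mu (- sg) t w <= ((mean_side l (- sg) + k.+1%:R^-1) * t)%:E]}.
  by apply/ae_foralln => k; have := jump_part_upper prm lambda1 sgN1 (eps0 k).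
apply: filterS3 lo up (jump_part_null l0) => w lo up j0 g gE.
set a := (sg * drf - mean_side l (- sg))%R.
have SE t : signed_value sg drf t w = (sg * drf * t)%:E - jump_part mu (- sg) t w.
  by rewrite /signed_value j0 add0e.
have small (e : R) : (0 < e)%R -> exists k : nat, (k.+1%:R^-1 <= e)%R.
  move=> e0; exists (Num.trunc e^-1).
  by rewrite invf_ple ?posrE// ltW// truncnS_gt.
apply/le_anti/andP; split.
  apply/lee_addgt0Pr => e e0; have [k ke] := small e e0; have [T HT] := lo k.
  apply: (@limf_esup_le _ _ (Num.max T 1%R)) => t; rewrite ge_max => /andP[Tt t1].
  have t0 : (0 < t)%R by exact: lt_le_trans t1.
  rewrite gE// divr_posE// lee_pdivrMr// SE.
  apply: (le_trans (leeB (lexx _) (HT t Tt))).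
  rewrite -EFinB -EFinD -EFinM lee_fin -mulrBl; apply: ler_wpM2r; first exact: ltW.
  by rewrite /a opprB [(_^-1 - _)%R]addrC addrA lerD2l.
apply/lee_subgt0Pr => e e0; have [k ke] := small e e0.
apply: limf_esup_ge => N; have [t [Nt t0 Jt]] := up k N.+1.
have t1 : (1 <= t)%R by apply: le_trans Nt; rewrite ler1n.
exists t; first by apply: le_trans Nt; rewrite ler_nat.
rewrite gE// divr_posE// lee_pdivlMr// SE.
apply: le_trans (leeB (lexx _) Jt).
rewrite -EFinB -EFinB -EFinM lee_fin -mulrBl; apply: ler_wpM2r; first exact: ltW.
by rewrite /a opprD addrA lerD2l lerN2.
Qed.

End signed_process.

Arguments signed_value {R d d0 Omega} mu sg drf t w.

(** * Integrability of the weights, and negligibility under convergence *)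

Section moments.
Context {R : realType} (l : {measure set R -> \bar R}).
Hypothesis l1 : \int[l]_z `|z|%:E < +oo.

(** |z|^(1+s) is at most |z| when |z| <= 1, and at most |z|^(1+eps) otherwise. The order can
    therefore be lowered until s <= 1/2. *)
Lemma moment_lower (s eps : R) : (0 < s)%R -> (s <= eps)%R ->
  \int[l]_z (`|z| `^ (1 + eps))%:E < +oo -> \int[l]_z (`|z| `^ (1 + s))%:E < +oo.
Proof.
move=> s0 seps leps.
apply: (@le_lt_trans _ _ (\int[l]_z (`|z|%:E + (`|z| `^ (1 + eps))%:E))).
  apply: ge0_integral_mono => z _; first by rewrite lee_fin powR_ge0.
  rewrite -EFinD lee_fin.
  have [z1|z1] := leP `|z|%R 1%R; last first.
    by rewrite ler_wpDl// ler_powR ?lerD2l// ltW.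
  rewrite ler_wpDr ?powR_ge0//.
  have [->|z0] := eqVneq `|z|%R 0%R; first by rewrite powR0// gt_eqF// addr_gt0.
  by apply: ge1r_powR; [rewrite lt_def z0 normr_ge0|rewrite lerDl ltW].
rewrite ge0_integralD//; first exact: lte_add_pinfty.
- by apply/measurable_EFinP; exact: normr_measurable.
- by apply/measurable_EFinP; apply: (measurableT_comp (measurable_powR _)).
Qed.

Lemma log_weight_fin : \int[l]_(z in `[(-1)%R, 1%R]) `|z * ln `|z| |%:E < +oo ->
  \int[l]_z (log_weight z)%:E < +oo.
Proof.
rewrite integral_mkcond => llog; rewrite /log_weight; under eq_integral do rewrite EFinD.
have E : (fun z : R => `|z * ln `|z| |%:E) \_ `[(-1)%R, 1%R] =
    (fun z : R => (if (`|z| <= 1)%R then `|z * ln `|z| |%R else 0%R)%:E).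
  apply/funext => z; rewrite patchE -(_ : (z \in `[(-1)%R, 1%R]%classic) = (`|z| <= 1)%R).
    by case: ifP.
  by apply/idP/idP; rewrite inE/= in_itv/= ler_norml.
rewrite E in llog.
rewrite ge0_integralD//.
- exact: lte_add_pinfty.
- by apply/measurable_EFinP; exact: normr_measurable.
- by move=> z _; case: ifP.
- apply/measurable_EFinP; apply: measurable_fun_ifT => //.
    by apply: measurable_fun_ler => //; exact: normr_measurable.
  apply: measurableT_comp => //; apply: measurable_funM => //.
  exact: (measurableT_comp (@measurable_ln R)).
Qed.

End moments.

Section negligible.
Context {R : realType} {d : nat} {d0 : measure_display} {Omega : measurableType d0}
  {P : probability Omega R} {l : {sigma_finite_measure set R -> \bar R}}
  {mu : Omega -> {measure set (R * d.-tuple R * R) -> \bar R}}.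
Hypothesis hd : (1 <= d)%N.
Hypothesis prm : poisson_random_measure P (noise_measure d l) mu.
Variables (s : R) (s0 : (0 < s)%R) (s2 : (s <= 2^-1)%R).
Hypotheses (l1 : \int[l]_z `|z|%:E < +oo)
  (ls : \int[l]_z (`|z| `^ (1 + s))%:E < +oo)
  (lw : \int[l]_z (log_weight z)%:E < +oo).
Variable F : R -> R.
Hypotheses (F0 : forall x, (0 < F x)%R)
  (Fnd : forall x y, (x <= y)%R -> (F x <= F y)%R)
  (sF : \sum_(n <oo) ((F n.+1%:R)^-1)%:E < +oo).

Let fin_integral (g : R -> R) : (forall z, (0 <= g z)%R) ->
  \int[l]_z (g z)%:E < +oo -> \int[l]_z (g z)%:E = (fine (\int[l]_z (g z)%:E))%:E.
Proof.
move=> g0 gfin; rewrite fineK// ge0_fin_numE//.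
by apply: integral_ge0 => z _; rewrite lee_fin.
Qed.

Lemma jump_part_le_abs sg t w : (`|sg| = 1)%R ->
  jump_part mu sg t w <= \int[mu w]_q (window_kernel t t q.1 * `|q.2|)%:E.
Proof.
move=> sg1; apply: ge0_integral_mono => q _.
  by rewrite lee_fin mulr_ge0 ?window_kernel_ge0// le_max lexx orbT.
rewrite lee_fin ler_wpM2l ?window_kernel_ge0// ge_max normr_ge0 andbT.
by rewrite (le_trans (ler_norm _))// normrM sg1 mul1r.
Qed.

Lemma signed_value_negligible drf : {ae P, forall w, forall e : R, (0 < e)%R ->
  exists T, forall t, (T <= t)%R -> `|signed_value mu 1 drf t w| <= (e * F t)%:E}.
Proof.
have tv : {ae P, forall w, forall k : nat, exists T, forall t, (T <= t)%R ->
    \int[mu w]_q (window_kernel t t q.1 * `|q.2|)%:E <= (k.+1%:R^-1 * F t)%:E}.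
  apply/ae_foralln => k.
  have k0 : (0 < k.+1%:R^-1 :> R)%R by rewrite invr_gt0.
  have wE := fin_integral (@log_weight_ge0 R) lw.
  have sE := fin_integral (fun z => powR_ge0 `|z|%R (1 + s)%R) ls.
  have aE := fin_integral (@normr_ge0 _ R) l1.
  have := total_variation_small hd prm s0 s2 aE sE wE F0 Fnd sF k0.
  exact.
apply: filterS tv => w tv e e0.
(* One third each for the drift and the two jump parts. *)
have e3 : (0 < e / 3)%R by rewrite divr_gt0.
pose k := Num.trunc (e / 3)^-1.
have ke : (k.+1%:R^-1 <= e / 3)%R by rewrite invf_ple ?posrE// ltW// truncnS_gt.
have [T HT] := tv k.
have [a Fa] := reciprocal_series_superlinear F0 Fnd sF (`|drf| / (e / 3))%R.
exists (Num.max (Num.max T a) 0%R) => t.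
rewrite !ge_max => /andP[/andP[Tt at_] t0].
have Jle sg : (`|sg| = 1)%R -> `|jump_part mu sg t w| <= (e / 3 * F t)%:E.
  move=> sg1; rewrite gee0_abs ?jump_part_ge0//.
  apply: le_trans (jump_part_le_abs t w sg1) _; apply: le_trans (HT t Tt) _.
  by rewrite lee_fin ler_wpM2r// ltW.
have Dle : `|(1 * drf * t)%:E| <= (e / 3 * F t)%:E.
  rewrite mul1r abse_EFin lee_fin normrM (ger0_norm t0) [leRHS]mulrC -ler_pdivrMr// mulrAC.
  exact: Fa.
have -> : (e * F t)%:E = (e / 3 * F t)%:E + ((e / 3 * F t)%:E + (e / 3 * F t)%:E).
  by rewrite -!EFinD; congr EFin; field.
rewrite /signed_value; apply: le_trans (lee_abs_add _ _) _; apply: leeD => //.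
apply: le_trans (lee_abs_sub _ _) _; apply: leeD; apply: Jle; rewrite ?normrN normr1//.
Qed.

End negligible.

Lemma cvge0_of_abs_le {R : realType} (g : R -> \bar R) :
  (forall e : R, (0 < e)%R -> exists T, forall t, (T <= t)%R -> `|g t| <= e%:E) ->
  g @ (pinfty_nbhs R) --> 0%:E.
Proof.
move=> ge A A0; have /nbhs_ballP[e /= e0 eA] : nbhs (0%R : R) [set r | A r%:E] by exact: A0.
have [T HT] := ge (e / 2)%R (divr_gt0 e0 (ltr0n _ 2)).
exists T; split; first exact: num_real.
move=> t /ltW/HT; rewrite /=; case: (g t) => [r| |]//; rewrite abse_EFin lee_fin => re.
apply: eA; rewrite /= /ball/= sub0r normrN (le_lt_trans re)//.
by rewrite ltr_pdivrMr// ltr_pMr// ltr1n.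
Qed.

Lemma reciprocal_series_dichotomy {R : realType} (F : R -> R) :
  (forall x, (0 < F x)%R) -> (forall x y, (x <= y)%R -> (F x <= F y)%R) ->
  (\int[lebesgue_measure]_(t in `[1%R, +oo[) ((F t)^-1)%:E = +oo ->
   \sum_(n <oo) ((F n.+1%:R)^-1)%:E = +oo) /\
  (\int[lebesgue_measure]_(t in `[1%R, +oo[) ((F t)^-1)%:E < +oo ->
   \sum_(n <oo) ((F n.+1%:R)^-1)%:E < +oo).
Proof.
move=> F0 Fnd; pose g (t : R) := ((F t)^-1)%R.
have g0 t : (0 <= g t)%R by rewrite invr_ge0 ltW.
have gni x y : (x <= y)%R -> (g y <= g x)%R.
  by move=> xy; rewrite lef_pV2 ?posrE//; exact: Fnd.
split => [Foo|Ffin].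
  apply/eqP; rewrite eq_le leey/= -Foo.
  exact: (integral_le_series g0 gni 1).
rewrite (nneseries_split 0 1)//; last by move=> k _; rewrite lee_fin invr_ge0 ltW.
rewrite lte_add_pinfty//; first by rewrite lte_sum_pinfty// => k _; rewrite ltry.
rewrite add0n -nneseries_addn; last by move=> k; rewrite lee_fin invr_ge0 ltW.
under eq_eseriesr do rewrite addn1.
exact: le_lt_trans (series_le_integral g0 gni 1) Ffin.
Qed.

(** * Assembly of the three statements *)

Theorem theorem2p2 (R : realType) (d : nat) (hd : (1 <= d)%N)
  (d0 : measure_display) (Omega : measurableType d0) (P : probability Omega R)
  (lambda : {measure set R -> \bar R})
  (hlevy : levy_measure lambda)
  (hlambda0 : lambda setT <> 0)
  (hlambda1 : \int[lambda]_z `|z|%:E < +oo)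
  (mu : Omega -> {measure set (R * d.-tuple R * R) -> \bar R})
  (hmu : poisson_random_measure P (noise_intensity lambda) mu)
  (tau : nat -> Omega -> R) (eta : nat -> Omega -> d.-tuple R)
  (zeta : nat -> Omega -> R)
  (hpoints : has_points P mu tau eta zeta)
  (m : R)
  (f : R -> R)
  (hfpos : forall t : R, (0 < t)%R -> (0 < f t)%R)
  (hfmono : forall s t : R, (0 < s)%R -> (s <= t)%R -> (f s <= f t)%R)
  (hmoment : exists2 eps : R, (0 < eps)%R &
    \int[lambda]_z (`|z| `^ (1 + eps))%:E < +oo)
  (hlog : \int[lambda]_(z in `[(-1)%R, 1%R]) `|z * ln `|z| |%:E < +oo) :
  let Y0 (w : Omega) (t : R) :=
    mild_solution lambda m mu t (torigin d) w in
  [/\ (* (1) *)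
      \int[lebesgue_measure]_(t in `[1%R, +oo[) ((f t)^-1)%:E = +oo ->
      (0 < lambda `]0%R, +oo[%classic ->
       {ae P, forall w,
         limf_esup (fun t => Y0 w t / (f t)%:E) (pinfty_nbhs R) = +oo}) /\
      (0 < lambda `]-oo, 0%R[%classic ->
       {ae P, forall w,
         limf_einf (fun t => Y0 w t / (f t)%:E) (pinfty_nbhs R) = -oo}),
      (* (2) *)
      \int[lebesgue_measure]_(t in `[1%R, +oo[) ((f t)^-1)%:E < +oo ->
      {ae P, forall w,
        (fun t => Y0 w t / (f t)%:E) @ (pinfty_nbhs R) --> 0%:E} &
      (* (3) *)
      (lambda `]0%R, +oo[%classic = 0 ->
       {ae P, forall w,
         limf_esup (fun t => Y0 w t / t%:E) (pinfty_nbhs R) = m%:E}) /\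
      (lambda `]-oo, 0%R[%classic = 0 ->
       {ae P, forall w,
         limf_einf (fun t => Y0 w t / t%:E) (pinfty_nbhs R) = m%:E})].
Proof.
have [l0 _] := hlevy.
(* Integrability of |z| makes [lambda] sigma-finite; it is replaced by a copy that carries this
   structure. *)
have [l lE] := sigma_finite_measureP (levy_sigma_finite l0 hlambda1).
have prm : poisson_random_measure P (noise_measure d l) mu.
  by rewrite -noise_intensityE; move: hmu; rewrite /noise_intensity lE.
rewrite lE in hlambda0 hlambda1 hmoment hlog *.
move=> Y0; set drf := drift lambda m.
have drfE : drf = (m - \int[l]_z z)%R by rewrite /drf /drift /Rintegral lE.
have Y0E w t : (0 < t)%R -> Y0 w t = signed_value mu 1 drf t w.
  by move=> t0; rewrite /Y0 mild_solutionE// /signed_value mul1r.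
clearbody Y0 drf.
have posE : `]0%R, +oo[%classic = [set z : R | (0 < 1 * z)%R].
  by apply/seteqP; split => z /=; rewrite in_itv/= andbT mul1r.
have negE : `]-oo, 0%R[%classic = [set z : R | (0 < -1 * z)%R].
  by apply/seteqP; split => z /=; rewrite in_itv/= mulN1r oppr_gt0.
have sg1 : (`|1 : R| = 1)%R by rewrite normr1.
have sgN1 : (`|-1 : R| = 1)%R by rewrite normrN1.
(* f is controlled on positive times only. This extension is positive and nondecreasing on the whole
   line and agrees with f from time 1 on. *)
pose F t := f (Num.max t 1%R).
have max0 (t : R) : (0 < Num.max t 1)%R by rewrite lt_max ltr01 orbT.
have F0 t : (0 < F t)%R by exact: hfpos.
have Fnd x y : (x <= y)%R -> (F x <= F y)%R.
  by move=> xy; apply: hfmono => //; rewrite ge_max !le_max xy lexx orbT.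
have Ff t : (1 <= t)%R -> F t = f t by move=> t1; rewrite /F max_l.
have intF : \int[lebesgue_measure]_(t in `[1%R, +oo[) ((f t)^-1)%:E =
    \int[lebesgue_measure]_(t in `[1%R, +oo[) ((F t)^-1)%:E.
  by apply: eq_integral => t; rewrite inE/= in_itv/= andbT => t1; rewrite Ff.
have [Foo Ffin] := reciprocal_series_dichotomy F0 Fnd.
rewrite intF posE negE.
have small_neg w t : (0 < t)%R -> signed_value mu (-1) drf t w <= - Y0 w t.
  by move=> t0; rewrite Y0E//; exact: signed_valueN.
split.
- move=> /Foo sF; split => [lpos|lneg].
    have := signed_value_oscillation hd prm hlambda1 F0 Fnd sF drf sg1 lpos.
    apply: filterS => w; apply => t t1.
    by rewrite Y0E ?(lt_le_trans ltr01)// Ff.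
  have := signed_value_oscillation hd prm hlambda1 F0 Fnd sF drf sgN1 lneg.
  (* The lower limit is minus the upper limit of the negative, and the bound [small_neg] is all that
     [osc] asks for. *)
  apply: filterS => w osc; rewrite /limf_einf osc// => t t1.
  have t0 : (0 < t)%R by exact: lt_le_trans t1.
  rewrite Ff// !divr_posE ?hfpos// -mulNe lee_wpmul2r ?small_neg//.
  by rewrite lee_fin invr_ge0 ltW// hfpos.
- move=> /Ffin sF; have [eps eps0 leps] := hmoment.
  pose s : R := Num.min eps (2^-1)%R.
  have s0 : (0 < s)%R by rewrite /s lt_min eps0 invr_gt0 ltr0n.
  have s2 : (s <= 2^-1)%R by rewrite ge_min (lexx (2^-1)%R) orbT.
  have seps : (s <= eps)%R by rewrite ge_min (lexx eps).
  have ls := moment_lower hlambda1 s0 seps leps.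
  have lw := log_weight_fin hlambda1 hlog.
  have := signed_value_negligible hd prm s0 s2 hlambda1 ls lw F0 Fnd sF drf.
  apply: filterS => w neg; apply: cvge0_of_abs_le => e e0.
  have [T HT] := neg e e0; exists (Num.max T 1%R) => t; rewrite ge_max => /andP[Tt t1].
  have t0 : (0 < t)%R by exact: lt_le_trans t1.
  rewrite Y0E// divr_posE ?hfpos// abseM abse_EFin gtr0_norm ?invr_gt0 ?hfpos//.
  by rewrite lee_pdivrMr ?hfpos// -Ff//; exact: HT.
- split => [lpos|lneg].
    have := signed_value_lln prm hlambda1 drf sg1 lpos.
    (* Without positive jumps the drift is m plus the mean of the negative part, so subtracting that
       mean leaves m. *)
    rewrite (_ : 1 * drf - mean_side l (- 1) = m)%R; last first.
      by rewrite drfE (mean_sideB hlambda1 sg1) (mean_side_null lpos); ring.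
    by apply: filterS => w; apply => t t1; rewrite Y0E// (lt_le_trans ltr01).
  have := signed_value_lln prm hlambda1 drf sgN1 lneg.
  rewrite (_ : -1 * drf - mean_side l (- -1) = - m)%R; last first.
    by rewrite drfE (mean_sideB hlambda1 sgN1) (mean_side_null lneg); ring.
  (* Since the negative jump part vanishes, no difference of infinities occurs and negation is an
     equality. *)
  apply: filterS2 (jump_part_null prm lneg) => w J0 lln.
  rewrite /limf_einf lln ?EFinN ?oppeK// => t t1.
  have t0 : (0 < t)%R by exact: lt_le_trans t1.
  by rewrite !divr_posE// -mulNe Y0E// signed_valueN_null.
Qed.
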